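(* Let $\Bbbk$ be a commutative ring, let $A$ be a left-noetherian $\Bbbk$-algebra and $B$ a right-noetherian $\Bbbk$-algebra, and let $D={}_AD_B$ be a dualizing complex for the pair $\langle A,B\rangle$. The complexes $\mathbf{R}\mathrm{Hom}_A(D,A)$ and $\mathbf{R}\mathrm{Hom}_{B^{\circ}}(D,B)$ are isomorphic in the derived category $\mathsf D(\Bbbk)$, and when they are homologically bounded, the following hold: (a) If $A$ satisfies condition (AC), then $\operatorname{id}_{A^{\circ}}A$ and $\operatorname{id}_{B^{\circ}}B$ are at most $\operatorname{pd}_A D+\operatorname{id}_{B^{\circ}}D<\infty$. (b) If $B^{\circ}$ satisfies condition (AC), then $\operatorname{id}_A A$ and $\operatorname{id}_B B$ are at most $\operatorname{pd}_{B^{\circ}}D+\operatorname{id}_A D<\infty$.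
   Context: Modules are left modules; $A^\circ$, $B^\circ$ are the opposite rings, and right modules over $A$, $B$ are identified with left $A^\circ$-, $B^\circ$-modules. $\Bbbk$ acts centrally on bimodules. A left-noetherian ring $A$ satisfies condition (AC) if for every finitely generated left $A$-module $M$ there exists an integer $b_M\geq 0$ such that for every finitely generated left $A$-module $N$ one has: if $\operatorname{Ext}_A^{i}(M,N)=0$ for all $i\gg 0$, then $\operatorname{Ext}_A^{i}(M,N)=0$ for all $i>b_M$. Complexes are graded homologically. A complex $X$ is right-bounded if $X_v=0$ for $v\ll0$, bounded if $X_v=0$ for $|v|\gg0$, and homologically bounded if its homology is bounded. The projective dimension of a homologically bounded complex $M$ is $\inf\{\sup\{i : P_i\neq0\}: P\text{ a projective resolution of }M\}$, and the injective dimension is $\inf\{\sup\{-i : I_i\neq0\}: I\text{ an injective resolution of }M\}$. Dualizing complex: a dualizing complex for the pair $\langle A,B\rangle$ is a complex $D={}_AD_B$ of $A$-$B$-bimodules such that: (1) $D$ has bounded homology, and each homology module is finitely generated over $A$ and over $B^{\circ}$; (2) there is a quasi-isomorphism of complexes of bimodules ${}_AP_B\to{}_AD_B$, where $P$ is right-bounded and consists of bimodules that are projective over $A$ and over $B^{\circ}$; (3) there is a quasi-isomorphism of complexes of bimodules ${}_AD_B\to{}_AI_B$, where $I$ is bounded and consists of bimodules that are injective over $A$ and over $B^{\circ}$; (4) the homothety morphisms ${}_AA_A\to\mathbf{R}\mathrm{Hom}_{B^{\circ}}({}_AD_B,{}_AD_B)$ and ${}_BB_B\to\mathbf{R}\mathrm{Hom}_A({}_AD_B,{}_AD_B)$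 are isomorphisms in homology. *)

(* Defs.v *)
From HB Require Import structures.
From mathcomp Require Import all_boot all_order all_algebra.
From mathcomp Require Import boolp classical_sets constructive_ereal.

Set Implicit Arguments.
Unset Strict Implicit.
Unset Printing Implicit Defensive.

Import Order.TTheory GRing.Theory Num.Theory.

Local Open Scope ring_scope.

Definition mk_lin (R : pzRingType) (U V : lmodType R) (f : U -> V)
    (fL : linear f) : {linear U -> V} :=
  HB.pack f (GRing.isLinear.Build R U V *:%R f fL).

(* A k-algebra is a ring with a central ring morphism from k.  The      *)
(* structure [algType k] is not used because it excludes the zero ring  *)
(* and is not available on the opposite ring [A^c].                     *)
Record alg (k : comPzRingType) := Alg {
  alg_ring :> pzRingType;
  alg_str : {rmorphism k -> alg_ring};
  alg_strC : forall c a, alg_str c * a = a * alg_str c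
}.

Section Opposite.
Variables (k : comPzRingType) (A : alg k).

Definition op_str (c : k) : A^c := alg_str A c.

Fact op_str_zmod_morphism : zmod_morphism op_str.
Proof. by move=> a b; rewrite /op_str rmorphB. Qed.

Fact op_str_monoid_morphism : monoid_morphism op_str.
Proof.
split; first exact: (rmorph1 (alg_str A)).
by move=> a b; rewrite /op_str mulrC (rmorphM (alg_str A)).
Qed.

HB.instance Definition _ :=
  GRing.isZmodMorphism.Build k A^c op_str op_str_zmod_morphism.
HB.instance Definition _ :=
  GRing.isMonoidMorphism.Build k A^c op_str op_str_monoid_morphism.

Definition opalg : alg k :=
  @Alg k A^c op_str (fun c a => esym (alg_strC c (a : A))).

End Opposite.

Notation "A ^op" := (opalg A) (at level 2, format "A ^op") : type_scope.

Record lact (R : pzRingType) (V : zmodType) := LAct {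
  lact_fun :> R -> V -> V;
  lactA : forall a b v, lact_fun a (lact_fun b v) = lact_fun (a * b) v;
  lact1 : left_id 1 lact_fun;
  lactDr : right_distributive lact_fun +%R;
  lactDl : forall v, {morph lact_fun^~ v : a b / a + b}
}.

Definition mk_lmod (R : pzRingType) (V : zmodType) (f : lact R V) : Type := V.

Section ModuleOfAction.
Variables (R : pzRingType) (V : zmodType) (f : lact R V).

HB.instance Definition _ := GRing.Zmodule.on (mk_lmod f).
HB.instance Definition _ :=
  GRing.Zmodule_isLmodule.Build R (mk_lmod f) (lactA f) (lact1 f) (lactDr f) (lactDl f).

End ModuleOfAction.

Section Restriction.
Variables (k : comPzRingType) (A : alg k) (M : lmodType A).

Definition restr_act (c : k) (x : M) : M := alg_str A c *: x.

Fact restr_actA a b v : restr_act a (restr_act b v) = restr_act (a * b) v.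
Proof. by rewrite /restr_act scalerA rmorphM. Qed.

Fact restr_act1 : left_id 1 restr_act.
Proof. by move=> x; rewrite /restr_act rmorph1 scale1r. Qed.

Fact restr_actDr : right_distributive restr_act +%R.
Proof. by move=> a x y; rewrite /restr_act scalerDr. Qed.

Fact restr_actDl v : {morph restr_act^~ v : a b / a + b}.
Proof. by move=> a b; rewrite /restr_act rmorphD scalerDl. Qed.

Definition restr : lmodType k :=
  mk_lmod (LAct restr_actA restr_act1 restr_actDr restr_actDl).

End Restriction.

(* Commuting left actions of R and S: as right B-modules are left       *)
(* B°-modules, an A-B-bimodule is a [bimod A B^op].                     *)
Record bimod (k : comPzRingType) (R S : alg k) := Bimod {
  bsort :> zmodType;
  bleft : lact R bsort;
  bright : lact S bsort;
  bcomm : forall r s x, bleft r (bright s x) = bright s (bleft r x);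
  bcentral : forall c x, bleft (alg_str R c) x = bright (alg_str S c) x
}.

Section Bimodules.
Variable k : comPzRingType.

Definition lmod (R S : alg k) (M : bimod R S) : lmodType R :=
  mk_lmod (bleft M).

Definition bswap (R S : alg k) (M : bimod R S) : bimod S R :=
  @Bimod k S R M (bright M) (bleft M)
    (fun s r x => esym (bcomm r s x)) (fun c x => esym (bcentral c x)).

Definition rmod (R S : alg k) (M : bimod R S) : lmodType S := lmod (bswap M).

Definition bilin (R S : alg k) (M N : bimod R S) (f : M -> N) : Prop :=
  linear (f : lmod M -> lmod N) /\ linear (f : rmod M -> rmod N).

(* Transparent, unlike [proj1] and [proj2], so that [lcpx D] and        *)
(* [rcpx (cswap D)] below are convertible.                              *)
Definition bilin_l (R S : alg k) (M N : bimod R S) (f : M -> N) (h : bilin f) :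
  linear (f : lmod M -> lmod N) := let: conj hl _ := h in hl.

Definition bilin_r (R S : alg k) (M N : bimod R S) (f : M -> N) (h : bilin f) :
  linear (f : rmod M -> rmod N) := let: conj _ hr := h in hr.

End Bimodules.

Section Modules.
Variable R : pzRingType.

Definition fin_gen (M : lmodType R) : Prop :=
  exists (n : nat) (g : 'I_n -> M),
    forall x, exists c : 'I_n -> R, x = \sum_i c i *: g i.

Definition projectiveM (P : lmodType R) : Prop :=
  forall (M N : lmodType R) (g : {linear M -> N}) (f : {linear P -> N}),
    (forall y, exists x, g x = y) ->
    exists h : {linear P -> M}, forall x, g (h x) = f x.

Definition injectiveM (I : lmodType R) : Prop :=
  forall (M N : lmodType R) (g : {linear M -> N}) (f : {linear M -> I}),
    injective g ->
    exists h : {linear N -> I}, forall x, h (g x) = f x.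

Definition left_ideal (I : set R) : Prop :=
  [/\ I 0, forall a b, I a -> I b -> I (a + b) & forall r a, I a -> I (r * a)].

Definition left_noetherian : Prop :=
  forall I : set R, left_ideal I ->
    exists (n : nat) (g : 'I_n -> R), (forall i, I (g i)) /\
      forall a, I a -> exists c : 'I_n -> R, a = \sum_i c i * g i.

End Modules.

(* The differential has degree -1.  Carrying a map for each pair of     *)
(* degrees, zero off the differential, avoids transports along          *)
(* equalities in int.                                                   *)
Record cpx (R : pzRingType) := Cpx {
  cobj :> int -> lmodType R;
  cdiff : forall i j, {linear cobj i -> cobj j};
  diff_shape : forall i j, i != j + 1 -> forall x, cdiff i j x = 0;
  diffK : forall i j l x, cdiff j l (cdiff i j x) = 0
}.
Arguments cdiff {R} c i j.

Record cmap (R : pzRingType) (X Y : cpx R) := Cmap {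
  cmap_fun :> forall i, {linear X i -> Y i};
  cmapD : forall i j x, cmap_fun j (cdiff X i j x) = cdiff Y i j (cmap_fun i x)
}.

Section Complexes.
Variable R : pzRingType.
Implicit Types X Y Z : cpx R.

Definition cid X : cmap X X := @Cmap R X X (fun i => idfun) (fun i j x => erefl).

Fact ccomp_subproof X Y Z (g : cmap Y Z) (f : cmap X Y) i j x :
  (g j \o f j) (cdiff X i j x) = cdiff Z i j ((g i \o f i) x).
Proof. by rewrite /= !cmapD. Qed.

Definition ccomp X Y Z (g : cmap Y Z) (f : cmap X Y) : cmap X Z :=
  @Cmap R X Z (fun i => g i \o f i) (ccomp_subproof g f).

Definition cycles X (i : int) : set (X i) := [set x | cdiff X i (i - 1) x = 0].

Definition boundaries X (i : int) : set (X i) :=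
  [set x | exists y, cdiff X (i + 1) i y = x].

(* The statements about homology are spelled out on representatives in  *)
(* H_i(X) = cycles X i / boundaries X i.                                *)
Definition homology0 X (i : int) : Prop :=
  forall x : X i, cycles x -> boundaries x.

Definition homology_fin_gen X (i : int) : Prop :=
  exists (n : nat) (g : 'I_n -> X i), (forall m, cycles (g m)) /\
    forall x, cycles x ->
      exists c : 'I_n -> R, boundaries (x - \sum_m c m *: g m).

Definition quasi_iso X Y (f : cmap X Y) : Prop :=
  forall i,
    (forall x, cycles x -> boundaries (f i x) -> boundaries x) /\
    (forall y, cycles y -> exists2 x, cycles x & boundaries (y - f i x)).

Definition zero_at X (i : int) : Prop := forall x : X i, x = 0.

Definition right_bounded X : Prop := exists n : int, forall i, i < n -> zero_at X i.

Definition left_bounded X : Prop := exists n : int, forall i, n < i -> zero_at X i.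

Definition cbounded X : Prop := exists n : int, forall i, n < `|i| -> zero_at X i.

Definition hbounded X : Prop := exists n : int, forall i, n < `|i| -> homology0 X i.

Definition stalk_obj (M : lmodType R) (i : int) : lmodType R :=
  if i is Posz 0 then M else 'rV[R]_0.

Fact stalk_linear (M : lmodType R) i j :
  linear (fun _ : stalk_obj M i => 0 : stalk_obj M j).
Proof. by move=> a x y; rewrite scaler0 addr0. Qed.

Definition stalk (M : lmodType R) : cpx R :=
  @Cpx R (stalk_obj M) (fun i j => mk_lin (@stalk_linear M i j))
    (fun _ _ _ _ => erefl) (fun _ _ _ _ => erefl).

Record projres X := Projres {
  projres_cpx :> cpx R;
  projres_map : cmap projres_cpx X;
  projres_bounded : right_bounded projres_cpx;
  projres_projective : forall i, projectiveM (projres_cpx i);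
  projres_quasi_iso : quasi_iso projres_map
}.

Record injres X := Injres {
  injres_cpx :> cpx R;
  injres_map : cmap X injres_cpx;
  injres_bounded : left_bounded injres_cpx;
  injres_injective : forall i, injectiveM (injres_cpx i);
  injres_quasi_iso : quasi_iso injres_map
}.

(* Values in the extended integers, the supremum of the empty set being *)
(* -oo and the infimum of the empty set being +oo.                      *)
Definition proj_dim X : \bar int :=
  infimum +oo%E [set e | exists P : projres X,
    e = supremum -oo%E [set i%:E%E | i in [set i | ~ zero_at P i]]].

Definition inj_dim X : \bar int :=
  infimum +oo%E [set e | exists I : injres X,
    e = supremum -oo%E [set (- i)%:E%E | i in [set i | ~ zero_at I i]]].

(* The identity of X p if p = q, and zero otherwise. *)
Definition same_degree X (p q : int) (x : X p) : X q :=
  if p =P q is ReflectT e then ecast i (X i) e x else 0.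

Fact same_degree_linear X p q : linear (@same_degree X p q).
Proof.
move=> a x y; rewrite /same_degree; case: eqP => [e|_]; first by case: q / e.
by rewrite scaler0 addr0.
Qed.

Fact same_degree_diff X p q x :
  cdiff X (q + 1) q (same_degree (q + 1) x) = same_degree q (cdiff X p (p - 1) x).
Proof.
rewrite /same_degree; case: eqP => [e|pq]; case: eqP => [e'|pq'].
- have pE := e; move: x e e'; rewrite {}pE => x e.
  rewrite (eq_axiomK e) /=; move: (q + 1 - 1) => r rq.
  by case: q / rq x {e}.
- by case: pq'; rewrite e addrK.
- by case: pq; rewrite -e' subrK.
- by rewrite linear0.
Qed.

End Complexes.

(* The derived category D(R), as the localization of the category of    *)
(* complexes at the quasi-isomorphisms: its morphisms are the words in  *)
(* chain maps and formal inverses of quasi-isomorphisms modulo [deq].   *)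

Section DerivedCategory.
Variable R : pzRingType.

Inductive dmor : cpx R -> cpx R -> Type :=
| dfwd X Y : cmap X Y -> dmor X Y
| dinv X Y (f : cmap X Y) : quasi_iso f -> dmor Y X
| dcomp X Y Z : dmor Y Z -> dmor X Y -> dmor X Z.

Inductive deq : forall X Y : cpx R, dmor X Y -> dmor X Y -> Prop :=
| deq_refl X Y (u : dmor X Y) : deq u u
| deq_sym X Y (u v : dmor X Y) : deq u v -> deq v u
| deq_trans X Y (u v w : dmor X Y) : deq u v -> deq v w -> deq u w
| deq_dcomp X Y Z (u u' : dmor Y Z) (v v' : dmor X Y) :
    deq u u' -> deq v v' -> deq (dcomp u v) (dcomp u' v')
| deq_assoc X Y Z T (u : dmor Z T) (v : dmor Y Z) (w : dmor X Y) :
    deq (dcomp u (dcomp v w)) (dcomp (dcomp u v) w)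
| deq_idl X Y (u : dmor X Y) : deq (dcomp (dfwd (cid Y)) u) u
| deq_idr X Y (u : dmor X Y) : deq (dcomp u (dfwd (cid X))) u
| deq_fwd_ext X Y (f g : cmap X Y) :
    (forall i x, f i x = g i x) -> deq (dfwd f) (dfwd g)
| deq_fwd_comp X Y Z (g : cmap Y Z) (f : cmap X Y) :
    deq (dcomp (dfwd g) (dfwd f)) (dfwd (ccomp g f))
| deq_invl X Y (f : cmap X Y) (qf : quasi_iso f) :
    deq (dcomp (dinv qf) (dfwd f)) (dfwd (cid X))
| deq_invr X Y (f : cmap X Y) (qf : quasi_iso f) :
    deq (dcomp (dfwd f) (dinv qf)) (dfwd (cid Y)).

Definition D_isomorphic (X Y : cpx R) : Prop :=
  exists (u : dmor X Y) (v : dmor Y X),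
    deq (dcomp v u) (dfwd (cid X)) /\ deq (dcomp u v) (dfwd (cid Y)).

End DerivedCategory.

(* Homogeneous maps of degree n, as families indexed by all pairs of    *)
(* degrees (see [cpx]).                                                 *)
Record ghom (R : pzRingType) (X Y : cpx R) (n : int) := GHom {
  hom_fun :> forall p q, X p -> Y q;
  hom_linear : forall p q, linear (@hom_fun p q);
  hom_deg : forall p q, q != p + n -> forall x, @hom_fun p q x = 0
}.
Arguments hom_fun {R X Y n} _ p q.

Section HomModule.
Variables (R : pzRingType) (X Y : cpx R) (n : int).
Implicit Types f g : ghom X Y n.

Lemma ghomP f g : (forall p q x, f p q x = g p q x) -> f = g.
Proof.
case: f g => [f fl fd] [g gl gd] /= fg.
have {}fg : f = g.
  apply: functional_extensionality_dep => p.
  by apply: functional_extensionality_dep => q; apply: funext => x; apply: fg.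
by move: fl fd gl gd; rewrite fg => *; congr GHom; apply: Prop_irrelevance.
Qed.

HB.instance Definition _ := gen_eqMixin (ghom X Y n).
HB.instance Definition _ := gen_choiceMixin (ghom X Y n).

Fact hom0_linear p q : linear (fun _ : X p => 0 : Y q).
Proof. by move=> a x y; rewrite scaler0 addr0. Qed.

Definition hom0 : ghom X Y n := GHom hom0_linear (fun _ _ _ _ => erefl).

Fact hom_add_linear f g p q : linear (fun x : X p => f p q x + g p q x).
Proof. by move=> a x y; rewrite !hom_linear scalerDr addrACA. Qed.

Fact hom_add_deg f g p q : q != p + n -> forall x, f p q x + g p q x = 0.
Proof. by move=> pq x; rewrite !hom_deg // addr0. Qed.

Definition hom_add f g : ghom X Y n := GHom (hom_add_linear f g) (@hom_add_deg f g).

Fact hom_opp_linear f p q : linear (fun x : X p => - f p q x).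
Proof. by move=> a x y; rewrite !hom_linear opprD scalerN. Qed.

Fact hom_opp_deg f p q : q != p + n -> forall x, - f p q x = 0.
Proof. by move=> pq x; rewrite !hom_deg // oppr0. Qed.

Definition hom_opp f : ghom X Y n := GHom (hom_opp_linear f) (@hom_opp_deg f).

Fact hom_addA : associative hom_add.
Proof. by move=> f g h; apply: ghomP => p q x /=; rewrite addrA. Qed.

Fact hom_addC : commutative hom_add.
Proof. by move=> f g; apply: ghomP => p q x /=; rewrite addrC. Qed.

Fact hom_add0 : left_id hom0 hom_add.
Proof. by move=> f; apply: ghomP => p q x /=; rewrite add0r. Qed.

Fact hom_addN : left_inverse hom0 hom_opp hom_add.
Proof. by move=> f; apply: ghomP => p q x /=; rewrite addNr. Qed.

HB.instance Definition _ :=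
  GRing.isZmodule.Build (ghom X Y n) hom_addA hom_addC hom_add0 hom_addN.

End HomModule.

Section HomComplex.
Variables (k : comPzRingType) (A : alg k) (X Y : cpx A).

Section Scaling.
Variable n : int.
Implicit Types f g : ghom X Y n.

Fact hom_scale_linear (c : k) f p q : linear (fun x : X p => alg_str A c *: f p q x).
Proof. by move=> a x y; rewrite hom_linear scalerDr !scalerA alg_strC. Qed.

Fact hom_scale_deg (c : k) f p q :
  q != p + n -> forall x, alg_str A c *: f p q x = 0.
Proof. by move=> pq x; rewrite hom_deg // scaler0. Qed.

Definition hom_scale c f : ghom X Y n :=
  GHom (hom_scale_linear c f) (@hom_scale_deg c f).

Fact hom_scaleA a b f : hom_scale a (hom_scale b f) = hom_scale (a * b) f.
Proof. by apply: ghomP => p q x /=; rewrite scalerA rmorphM. Qed.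

Fact hom_scale1 : left_id 1 hom_scale.
Proof. by move=> f; apply: ghomP => p q x /=; rewrite rmorph1 scale1r. Qed.

Fact hom_scaleDr : right_distributive hom_scale +%R.
Proof. by move=> a f g; apply: ghomP => p q x /=; rewrite scalerDr. Qed.

Fact hom_scaleDl f : {morph hom_scale^~ f : a b / a + b}.
Proof. by move=> a b; apply: ghomP => p q x /=; rewrite rmorphD scalerDl. Qed.

Definition hom_lmod : lmodType k :=
  mk_lmod (LAct hom_scaleA hom_scale1 hom_scaleDr hom_scaleDl).

End Scaling.

(* d(f) = d_Y f - (-1)^n f d_X for f of degree n. *)
Definition dhom_fun n m (f : ghom X Y n) p q (x : X p) : Y q :=
  if n == m + 1 then
    cdiff Y (q + 1) q (f p (q + 1) x)
      - (-1) ^+ `|n|%N *: f (p - 1) q (cdiff X p (p - 1) x)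
  else 0.

Fact dhom_linear n m (f : ghom X Y n) p q : linear (@dhom_fun n m f p q).
Proof.
move=> a x y; rewrite /dhom_fun; case: ifP => _; last by rewrite scaler0 addr0.
rewrite linearP !hom_linear linearP.
by rewrite scalerBr scalerDr !scalerA commr_sign opprD addrACA.
Qed.

Fact dhom_deg n m (f : ghom X Y n) p q :
  q != p + m -> forall x, @dhom_fun n m f p q x = 0.
Proof.
move=> pq x; rewrite /dhom_fun; case: eqP => // nm.
rewrite !(hom_deg f) ?linear0 ?scaler0 ?subr0 //; apply: contra_neq pq => qE.
  by rewrite qE nm [m + 1]addrC addrA subrK.
by apply: (addIr 1); rewrite qE nm addrA.
Qed.

Definition dhom n m (f : ghom X Y n) : ghom X Y m :=
  GHom (@dhom_linear n m f) (@dhom_deg n m f).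

Fact dhom_is_linear n m : linear (dhom m : hom_lmod n -> hom_lmod m).
Proof.
move=> c f g; apply: ghomP => p q x; rewrite /= /dhom_fun.
case: ifP => _; last by rewrite scaler0 addr0.
rewrite /= linearP.
by rewrite scalerBr scalerDr !scalerA commr_sign opprD addrACA.
Qed.

Fact dhom_shape i j : i != j + 1 -> forall f : ghom X Y i, dhom j f = 0.
Proof. by move=> /negPf ij f; apply: ghomP => p q x; rewrite /= /dhom_fun ij. Qed.

Fact sign_absz (n : int) : (-1) ^+ `|(n + 1)%R|%N = - (-1) ^+ `|n|%N :> A.
Proof.
case: n => m; first by rewrite -PoszD addn1 exprS mulN1r.
have -> : Negz m + 1 = - m%:Z by rewrite NegzE -addn1 PoszD opprD subrK.
by rewrite abszN NegzE abszN !absz_nat exprS mulN1r opprK.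
Qed.

Fact hom_fun0 n (f : ghom X Y n) p q : f p q 0 = 0.
Proof.
by have := @hom_linear _ _ _ _ f p q (-1) 0 0; rewrite scaler0 addr0 scaleN1r addNr.
Qed.

Fact dhomK i j l (f : ghom X Y i) : dhom l (dhom j f) = 0.
Proof.
apply: ghomP => p q x; rewrite /= /dhom_fun /= /dhom_fun; case: eqP => // jE.
have sE : i = j + 1 -> (-1) ^+ `|i|%N = - (-1) ^+ `|j|%N :> A.
  by move->; apply: sign_absz.
case: eqP => [/sE iE|_]; last by rewrite linear0 scaler0 subr0.
rewrite linearB linearZ /= !diffK hom_fun0 scaler0 sub0r subr0 iE.
by rewrite scaleNr opprK subrr.
Qed.

Definition homC : cpx k :=
  @Cpx k hom_lmod (fun i j => mk_lin (@dhom_is_linear i j)) dhom_shape dhomK.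

End HomComplex.

Arguments homC {k A} X Y.

Section RHom.
Variables (k : comPzRingType) (A : alg k).

(* RHom(X, Y), computed by a projective resolution P of X. *)
Definition RHom (X : cpx A) (P : projres X) (Y : cpx A) : cpx k := homC P Y.

(* The vanishing of Ext^i(M, N) = H_{-i}(RHom(M, N)).                   *)
Definition Ext0 (i : nat) (M N : lmodType A) : Prop :=
  forall P : projres (stalk M), homology0 (RHom P (stalk N)) (- i%:Z).

Definition condAC : Prop :=
  forall M : lmodType A, fin_gen M ->
    exists b : nat, forall N : lmodType A, fin_gen N ->
      (exists n : nat, forall i : nat, (n < i)%N -> Ext0 i M N) ->
      forall i : nat, (b < i)%N -> Ext0 i M N.

End RHom.

Record bicpx (k : comPzRingType) (R S : alg k) := Bicpx {
  bobj :> int -> bimod R S;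
  bdiff : forall i j, bobj i -> bobj j;
  bdiff_bilin : forall i j, bilin (@bdiff i j);
  bdiff_shape : forall i j, i != j + 1 -> forall x, @bdiff i j x = 0;
  bdiffK : forall i j l x, @bdiff j l (@bdiff i j x) = 0
}.
Arguments bdiff {k R S} b i j _.

Record bicmap (k : comPzRingType) (R S : alg k) (X Y : bicpx R S) := Bicmap {
  bicmap_fun :> forall i, X i -> Y i;
  bicmap_bilin : forall i, bilin (@bicmap_fun i);
  bicmapD : forall i j x,
    @bicmap_fun j (bdiff X i j x) = bdiff Y i j (@bicmap_fun i x)
}.
Arguments bicmap_fun {k R S X Y} b i _.

Section Bicomplexes.
Variables k : comPzRingType.

Definition lcpx (R S : alg k) (X : bicpx R S) : cpx R :=
  @Cpx R (fun i => lmod (X i)) (fun i j => mk_lin (bilin_l (bdiff_bilin X i j)))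
    (@bdiff_shape k R S X) (@bdiffK k R S X).

Definition lcmap (R S : alg k) (X Y : bicpx R S) (f : bicmap X Y) :
    cmap (lcpx X) (lcpx Y) :=
  @Cmap R (lcpx X) (lcpx Y) (fun i => mk_lin (bilin_l (bicmap_bilin f i)))
    (@bicmapD k R S X Y f).

Definition cswap (R S : alg k) (X : bicpx R S) : bicpx S R :=
  @Bicpx k S R (fun i => bswap (X i)) (bdiff X)
    (fun i j => conj (bilin_r (bdiff_bilin X i j)) (bilin_l (bdiff_bilin X i j)))
    (@bdiff_shape k R S X) (@bdiffK k R S X).

Definition rcpx (R S : alg k) (X : bicpx R S) : cpx S := lcpx (cswap X).

(* The homothety morphism R -> RHom_S(D, D), computed by a projective   *)
(* resolution P of D over S: it maps r to (x |-> r pi(x)), where pi is  *)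
(* the map P -> D, and is considered in D(k).                           *)
Section Homothety.
Variables (R S : alg k) (D : bicpx R S) (P : projres (rcpx D)).

Definition homothety_fun (r : R) (p q : int) (x : P p) : rcpx D q :=
  bleft (D q) r (same_degree q (projres_map P p x)).

Fact bleft_linear (M : bimod R S) r : linear (bleft M r : rmod M -> rmod M).
Proof.
move=> a x y; rewrite -[a *: x]/(bright M a x).
by rewrite [LHS](lactDr (bleft M) r) bcomm.
Qed.

Fact homothety_linear r p q : linear (@homothety_fun r p q).
Proof.
move=> a x y; rewrite /homothety_fun linearP same_degree_linear.
exact: bleft_linear.
Qed.

Fact homothety_deg r p q : q != p + 0 -> forall x, @homothety_fun r p q x = 0.
Proof.
rewrite addr0 eq_sym => /eqP pq x; rewrite /homothety_fun /same_degree.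
case: eqP => // _; exact: (linear0 (mk_lin (@bleft_linear (D q) r))).
Qed.

Definition homothety_hom (r : restr R^o) : RHom P (rcpx D) 0 :=
  GHom (@homothety_linear r) (@homothety_deg r).

Fact homothety_hom_linear : linear homothety_hom.
Proof.
move=> c r s; apply: ghomP => p q x; rewrite /= /homothety_fun.
by rewrite lactDl -lactA bcentral.
Qed.

Fact homothety_homD j r :
  cdiff (RHom P (rcpx D)) 0 j (homothety_hom r) = 0.
Proof.
apply: ghomP => p q x; rewrite /= /dhom_fun; case: eqP => // _.
rewrite expr0 scale1r /= /homothety_fun cmapD -same_degree_diff.
apply/eqP; rewrite subr_eq0; apply/eqP.
exact: (linearZ_LR (mk_lin (bilin_l (bdiff_bilin D (q + 1) q))) r _).
Qed.

Definition homothety_obj (i : int) :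
    stalk (restr R^o) i -> RHom P (rcpx D) i :=
  match i with
  | Posz 0 => homothety_hom
  | _ => fun _ => 0
  end.

Fact homothety_obj_linear i : linear (@homothety_obj i).
Proof.
case: i => [[|n]|n]; first exact: homothety_hom_linear.
- by move=> a x y; rewrite scaler0 addr0.
- by move=> a x y; rewrite scaler0 addr0.
Qed.

Fact homothetyD i j x :
  mk_lin (@homothety_obj_linear j) (cdiff (stalk (restr R^o)) i j x) =
  cdiff (RHom P (rcpx D)) i j (mk_lin (@homothety_obj_linear i) x).
Proof.
rewrite [LHS]linear0.
by case: i x => [[|n]|n] x; rewrite ?[RHS]linear0 // [RHS]homothety_homD.
Qed.

Definition homothety : cmap (stalk (restr R^o)) (RHom P (rcpx D)) :=
  Cmap homothetyD.

End Homothety.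

(* For R = A and S = B°, the two homothety morphisms below are          *)
(* A -> RHom_{B°}(D, D) and B° -> RHom_A(D, D); the latter has the same *)
(* underlying k-linear map as B -> RHom_A(D, D).                        *)
Definition dualizing (R S : alg k) (D : bicpx R S) : Prop :=
  [/\ [/\ hbounded (lcpx D),
         forall i, homology_fin_gen (lcpx D) i &
         forall i, homology_fin_gen (rcpx D) i],
      exists (P : bicpx R S) (f : bicmap P D),
        [/\ quasi_iso (lcmap f), right_bounded (lcpx P),
            forall i, projectiveM (lmod (P i)) &
            forall i, projectiveM (rmod (P i))],
      exists (I : bicpx R S) (f : bicmap D I),
        [/\ quasi_iso (lcmap f), cbounded (lcpx I),
            forall i, injectiveM (lmod (I i)) &
            forall i, injectiveM (rmod (I i))] &
      (forall P : projres (rcpx D), quasi_iso (homothety P)) /\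
      (forall P : projres (rcpx (cswap D)), quasi_iso (homothety P))].

End Bicomplexes.

(* Main.v *)
(* Write R = A and S = B°.  The isomorphism in D(k) comes from the            *)
(* quasi-isomorphisms R -> RHom_S(D, D) and S -> RHom_R(D, D) and from the    *)
(* exchange RHom_R(D, RHom_S(D, D)) = RHom_S(D, RHom_R(D, D)), where the two  *)
(* arguments D are swapped with the sign (-1)^(pq).                           *)
(*                                                                            *)
(* Finiteness of the projective dimension under (AC): let L -> D be a         *)
(* resolution by finitely generated free modules, with modules of cycles Z_j. *)
(* As Hom(L, R) and Hom(L, L) are homologically bounded, Ext^i(Z_j, Z_l) = 0  *)
(* for all large j, l and i >> 0.  By (AC) the bound on i depends on j only,  *)
(* so that Ext^1(Z_(n-1), Z_n) = 0 for some n, and L splits off a bounded     *)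
(* resolution at the degree n.                                                *)
(*                                                                            *)
(* Bounds on the injective dimensions: if P is a complex of bimodules that    *)
(* are projective over R, and J a complex of injective S-modules, then        *)
(* Hom_S(P, J) consists of injective right R-modules (by Baer's criterion and *)
(* dual bases).  With P and J resolving D, truncated at pd_R D and id_S D,    *)
(* this is an injective resolution of R as a right module, and it vanishes    *)
(* beyond pd_R D + id_S D.  A similar complex Hom_R(P, J), with the bimodule  *)
(* structure on J, resolves S.  Truncations are realized as subcomplexes of   *)
(* the Hom complexes, so that no quotient module is needed.                   *)

From HB Require Import structures.
Require Import Defs.
From mathcomp Require Import all_boot all_order all_algebra.
From mathcomp Require Import boolp classical_sets functions constructive_ereal.
From mathcomp Require Import zify.

Set Implicit Arguments.
Unset Strict Implicit.
Unset Printing Implicit Defensive.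

Import Order.TTheory GRing.Theory Num.Theory.

Local Open Scope ring_scope.

(** * Submodules and subcomplexes *)

(** Put R = A and S = B°. Then D carries commuting left actions of R and S, and both halves of the
    theorem are instances of one statement about R and S, [inj_dim_bound], applied to D and to
    [cswap D].

    Isomorphism in D(k). Let P and Q be projective resolutions of D over R and over S, and I a
    complex of bimodules quasi-isomorphic to D. By the homothety conditions Hom_S(Q, I) is a model
    of R and Hom_R(P, I) is a model of S. Hom out of P or Q preserves quasi-isomorphisms
    ([hom_post_quasi_iso]), so RHom_R(D, R) and RHom_S(D, S) become Hom_R(P, Hom_S(Q, I)) and
    Hom_S(Q, Hom_R(P, I)), which differ by exchanging two variables ([swap_quasi_iso]).

    Finite projective dimension. Let L be a resolution of D by finitely generated free R-modules. In
    high degrees L is exact, its modules of cycles Z_j are finitely generated, and the part of L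
    above j resolves Z_j ([syzygy_resolution]). Boundedness of RHom_R(D, R) and of RHom_R(D, D) = S
    gives Ext^i(Z_j, Z_n) = 0 for i large ([coexact_syzygy]). For one fixed j, (AC) turns this into
    a bound b that does not depend on n. With n = j + b + 1 the group Ext^(b+1)(Z_j, Z_n) =
    Ext^1(Z_(n-1), Z_n) vanishes, so Z_n is a direct summand of L_n and L can be cut at n
    ([split_truncation], [finite_proj_dim]).

    Injective dimensions. Suppose pd_R D <= a and id_S D <= b. If X' is an R-projective model of D
    by bimodules in degrees <= a, and J an S-injective one in degrees >= -b, then Hom_S(X', J)
    resolves R over its opposite ring. Similarly Hom_R(P, I') resolves S when P is R-projective in
    degrees <= a and I' is an S-injective model by bimodules in degrees >= -b. The terms are
    injective ([homS_sub_injective], [homT_sub_injective]) and vanish in degrees below -(a + b).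
    Resolutions that realize a or b carry only one action, so X' and I' are truncations of the
    bimodule resolutions of D; comparison with the short resolutions shows that the truncations
    split ([split_top], [split_bottom]). *)

Section MkLin.
Variables (R : pzRingType) (U V : lmodType R).

Lemma mk_linE (f : U -> V) (fL : linear f) x : mk_lin fL x = f x.
Proof. by []. Qed.

End MkLin.

Record submod (R : pzRingType) (V : lmodType R) := Submod {
  submod_set :> V -> Prop;
  submod0 : submod_set 0;
  submodP : forall a x y,
    submod_set x -> submod_set y -> submod_set (a *: x + y)
}.

Section Submodule.
Variables (R : pzRingType) (V : lmodType R) (S : submod V).

Lemma submodD x y : S x -> S y -> S (x + y).
Proof. by move=> Sx Sy; rewrite -[x]scale1r; apply: submodP. Qed.

Lemma submodZ a x : S x -> S (a *: x).
Proof. by move=> Sx; rewrite -[_ *: _]addr0; apply: submodP (submod0 S). Qed.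

Lemma submodN x : S x -> S (- x).
Proof. by rewrite -scaleN1r; apply: submodZ. Qed.

Lemma submodB x y : S x -> S y -> S (x - y).
Proof. by move=> Sx Sy; apply: submodD => //; apply: submodN. Qed.

Lemma submod_sum I (r : seq I) (F : I -> V) :
  (forall i, S (F i)) -> S (\sum_(i <- r) F i).
Proof. by move=> SF; elim/big_ind: _ => //; [apply: submod0|apply: submodD]. Qed.

Definition submod_pred : {pred V} := [pred x | `[< S x >]].

Fact submod_pred_closed : submod_closed submod_pred.
Proof.
split; first exact/asboolP/submod0.
by move=> a x y /asboolP Sx /asboolP Sy; apply/asboolP/submodP.
Qed.

HB.instance Definition _ :=
  GRing.isSubmodClosed.Build R V submod_pred submod_pred_closed.

Record submod_of := SubmodOf { submod_val :> V; submod_valP : submod_val \in submod_pred }.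

HB.instance Definition _ := [isSub for submod_val].
HB.instance Definition _ := [Choice of submod_of by <:].
HB.instance Definition _ := [SubChoice_isSubLmodule of submod_of by <:].

Definition submod_in x (Sx : S x) : submod_of := SubmodOf (introT (asboolP _) Sx).

Lemma submod_valS (x : submod_of) : S (val x).
Proof. exact/asboolP/(submod_valP x). Qed.

End Submodule.

Section SubmoduleMaps.
Variable R : pzRingType.
Implicit Types U V W : lmodType R.

Fact corestr_linear U V (S : submod V) (f : {linear U -> V})
    (Sf : forall x, S (f x)) : linear (fun x => submod_in (Sf x)).
Proof. by move=> a x y; apply: val_inj; rewrite /= linearP. Qed.

Definition corestr U V (S : submod V) (f : {linear U -> V})
    (Sf : forall x, S (f x)) : {linear U -> submod_of S} :=
  mk_lin (corestr_linear Sf).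

Definition sub_incl V (S : submod V) : {linear submod_of S -> V} :=
  mk_lin (fun a x y => linearP (val : submod_of S -> V) a x y).

Fact range_submod0 U V (g : {linear U -> V}) : exists x, g x = 0.
Proof. by exists 0; rewrite linear0. Qed.

Fact range_submodP U V (g : {linear U -> V}) a y y' :
  (exists x, g x = y) -> (exists x, g x = y') -> exists x, g x = a *: y + y'.
Proof. by move=> [x <-] [x' <-]; exists (a *: x + x'); rewrite linearP. Qed.

Definition range_submod U V (g : {linear U -> V}) : submod V :=
  Submod (range_submod0 g) (@range_submodP _ _ g).

Fact ker_submod0 U V (g : {linear U -> V}) : g 0 = 0. Proof. exact: linear0. Qed.

Fact ker_submodP U V (g : {linear U -> V}) a x y :
  g x = 0 -> g y = 0 -> g (a *: x + y) = 0.
Proof. by move=> gx gy; rewrite linearP gx gy scaler0 addr0. Qed.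

Definition ker_submod U V (g : {linear U -> V}) : submod U :=
  Submod (ker_submod0 g) (@ker_submodP _ _ g).

(** Projectivity in the form that solves an equation with parameter [x]: [g] may be replaced by its
    corestriction to its image, so solvability for each [f x] suffices. *)
Lemma projective_lift (P U V : lmodType R) (g : {linear U -> V})
    (f : {linear P -> V}) : projectiveM P ->
  (forall x, exists y, g y = f x) ->
  exists h : {linear P -> U}, forall x, g (h x) = f x.
Proof.
move=> projP fg.
pose g' := corestr (S := range_submod g) (fun x => ex_intro _ x erefl : range_submod g (g x)).
pose f' := corestr (S := range_submod g) (f := f) fg.
have [y|h hE] := projP _ _ g' f'.
  have [x xE] := submod_valS y.
  by exists x; apply: val_inj.
by exists h => x; have /(congr1 val) := hE x.
Qed.

(** The dual form: since [f] kills the kernel of [g], it descends to the image of [g] through a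
    choice [s] of preimages, and extends from there. *)
Lemma injective_extend (J U V : lmodType R) (g : {linear U -> V})
    (f : {linear U -> J}) : injectiveM J ->
  (forall x, g x = 0 -> f x = 0) ->
  exists h : {linear V -> J}, forall x, h (g x) = f x.
Proof.
move=> injJ fg.
pose S := range_submod g.
have /choice [s sE] (y : submod_of S) : exists x, g x = val y := submod_valS y.
have fE x x' : g x = g x' -> f x = f x'.
  move=> gx; apply/eqP; rewrite -subr_eq0 -linearB; apply/eqP/fg.
  by rewrite linearB gx subrr.
have fsL : linear (fun y => f (s y)).
  by move=> a x y; rewrite -linearP; apply: fE; rewrite linearP !sE.
have [|h hE] := injJ _ _ (sub_incl S) (mk_lin fsL); first exact: val_inj.
exists h => x.
have Sx : S (g x) by exists x.
by have := hE (submod_in Sx); rewrite /= => ->; apply: fE; rewrite sE.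
Qed.

Lemma projective_retract (P Q : lmodType R) (i : {linear Q -> P})
    (r : {linear P -> Q}) :
  (forall x, r (i x) = x) -> projectiveM P -> projectiveM Q.
Proof.
move=> ri projP U V g f gs.
have [h hE] := projP _ _ g (f \o r) gs.
by exists (h \o i) => x; rewrite /= hE /= ri.
Qed.

Lemma projective0 (P : lmodType R) : (forall x : P, x = 0) -> projectiveM P.
Proof.
move=> P0 U V g f gs.
have zL : linear (fun _ : P => 0 : U) by move=> a x y; rewrite scaler0 addr0.
by exists (mk_lin zL) => x; rewrite (P0 x) !linear0.
Qed.

End SubmoduleMaps.

Section SubComplex.
Variables (R : pzRingType) (X : cpx R) (S : forall i, submod (X i)).
Hypothesis Sd : forall i j x, S i x -> S j (cdiff X i j x).

Definition subcpx_diff i j : {linear submod_of (S i) -> submod_of (S j)} :=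
  corestr (f := cdiff X i j \o sub_incl (S i)) (fun x => Sd j (submod_valS x)).

Fact subcpx_shape i j : i != j + 1 -> forall x, subcpx_diff i j x = 0.
Proof. by move=> ij x; apply: val_inj; rewrite /= diff_shape. Qed.

Fact subcpx_diffK i j l x : subcpx_diff j l (subcpx_diff i j x) = 0.
Proof. by apply: val_inj; rewrite /= diffK. Qed.

Definition subcpx : cpx R := Cpx subcpx_shape subcpx_diffK.

Definition subcpx_incl : cmap subcpx X :=
  @Cmap R subcpx X (fun i => sub_incl (S i)) (fun i j x => erefl).

End SubComplex.

(** * Cycles, boundaries and quasi-isomorphisms *)

HB.instance Definition _ (R : pzRingType) (X Y : cpx R) n (f : ghom X Y n) p q :=
  GRing.isLinear.Build R (X p) (Y q) *:%R (@hom_fun R X Y n f p q) (@hom_linear R X Y n f p q).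

Section ComplexBasics.
Variable R : pzRingType.
Implicit Types X Y Z : cpx R.

Lemma same_degree_id X p (x : X p) : same_degree p x = x.
Proof. by rewrite /same_degree; case: eqP => // e; rewrite (eq_axiomK e). Qed.

Lemma same_degree_neq X p q (x : X p) : p != q -> same_degree q x = 0.
Proof. by rewrite /same_degree; case: eqP. Qed.

HB.instance Definition _ X p q :=
  GRing.isLinear.Build R (X p) (X q) *:%R (@same_degree R X p q)
    (@same_degree_linear R X p q).

Lemma boundary_intro X i j (y : X j) : j = i + 1 -> boundaries (cdiff X j i y).
Proof. by move=> jE; subst j; exists y. Qed.

Lemma cyclesP X i j (x : X i) : i = j + 1 -> cycles x -> cdiff X i j x = 0.
Proof. by move=> iE; subst i; rewrite /cycles /=; move: (j + 1 - 1) (addrK 1 j) => l ->. Qed.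

Lemma cycles_intro X i j (x : X i) : i = j + 1 -> cdiff X i j x = 0 -> cycles x.
Proof. by move=> iE; subst i; rewrite /cycles /=; move: (j + 1 - 1) (addrK 1 j) => l ->. Qed.

Lemma cycle_diff X i j (x : X i) : cycles (cdiff X i j x).
Proof. exact: diffK. Qed.

Lemma boundary_cycle X i (x : X i) : boundaries x -> cycles x.
Proof. by move=> [y <-]; exact: diffK. Qed.

Lemma cycle_all X i (x : X i) : cycles x -> forall j, cdiff X i j x = 0.
Proof.
move=> cx j; have [iE|ij] := eqVneq i (j + 1); first exact: cyclesP.
exact: diff_shape.
Qed.

Lemma cycles_linear X i a (x y : X i) : cycles x -> cycles y -> cycles (a *: x + y).
Proof. by rewrite /cycles /= linearP => -> ->; rewrite scaler0 addr0. Qed.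

Lemma boundaries_linear X i a (x y : X i) :
  boundaries x -> boundaries y -> boundaries (a *: x + y).
Proof. by move=> [u <-] [v <-]; exists (a *: u + v); rewrite linearP. Qed.

Fact cycles0 X i : cycles (0 : X i). Proof. exact: linear0. Qed.

Fact boundaries0 X i : boundaries (0 : X i).
Proof. by exists 0; rewrite linear0. Qed.

Definition cycles_submod X i : submod (X i) :=
  Submod (@cycles0 X i) (@cycles_linear X i).

Definition boundaries_submod X i : submod (X i) :=
  Submod (@boundaries0 X i) (@boundaries_linear X i).

Lemma cyclesB X i (x y : X i) : cycles x -> cycles y -> cycles (x - y).
Proof. exact: (@submodB _ _ (cycles_submod X i)). Qed.

Lemma boundariesB X i (x y : X i) : boundaries x -> boundaries y -> boundaries (x - y).
Proof. exact: (@submodB _ _ (boundaries_submod X i)). Qed.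

Lemma boundariesD X i (x y : X i) : boundaries x -> boundaries y -> boundaries (x + y).
Proof. exact: (@submodD _ _ (boundaries_submod X i)). Qed.

Lemma boundariesN X i (x : X i) : boundaries x -> boundaries (- x).
Proof. exact: (@submodN _ _ (boundaries_submod X i)). Qed.

Lemma cmap_cycles X Y (f : cmap X Y) i (x : X i) : cycles x -> cycles (f i x).
Proof. by rewrite /cycles /= -cmapD => ->; rewrite linear0. Qed.

Lemma cmap_boundaries X Y (f : cmap X Y) i (x : X i) :
  boundaries x -> boundaries (f i x).
Proof. by move=> [y <-]; exists (f _ y); rewrite cmapD. Qed.

Fact zero_cmapD X Y i j (x : X i) :
  (\0 : {linear X j -> Y j}) (cdiff X i j x) = cdiff Y i j ((\0 : {linear X i -> Y i}) x).
Proof. by rewrite /= linear0. Qed.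

Definition zero_cmap X Y : cmap X Y := Cmap (@zero_cmapD X Y).

Lemma quasi_iso_comp X Y Z (g : cmap Y Z) (f : cmap X Y) :
  quasi_iso f -> quasi_iso g -> quasi_iso (ccomp g f).
Proof.
move=> qf qg i; have [f1 f2] := qf i; have [g1 g2] := qg i; split=> [x cx bx|z cz].
  by apply: f1 => //; apply: g1 => //; apply: cmap_cycles.
have [y cy [u uE]] := g2 _ cz; have [x cx [v vE]] := f2 _ cy.
exists x => //; exists (u + g _ v).
by rewrite linearD uE -cmapD vE linearB /= addrA subrK.
Qed.

Lemma quasi_iso_id X : quasi_iso (Defs.cid X).
Proof. by move=> i; split=> // x cx; exists x => //=; rewrite subrr; apply: boundaries0. Qed.

Lemma quasi_iso_cancel_l X Y Z (g : cmap Y Z) (f : cmap X Y) :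
  quasi_iso g -> quasi_iso (ccomp g f) -> quasi_iso f.
Proof.
move=> qg qgf i; have [f1 f2] := qgf i; have [g1 g2] := qg i; split=> [x cx bx|y cy].
  exact: f1 (cmap_boundaries g bx).
have [|x cx bx] := f2 (g i y); first exact: cmap_cycles.
exists x => //; apply: g1; first by apply: cyclesB => //; apply: cmap_cycles.
by rewrite linearB.
Qed.

Lemma quasi_iso_cancel_r X Y Z (g : cmap Y Z) (f : cmap X Y) :
  quasi_iso f -> quasi_iso (ccomp g f) -> quasi_iso g.
Proof.
move=> qf qgf i; have [gf1 gf2] := qgf i; have [f1 f2] := qf i; split=> [y cy by_|z cz].
  have [x cx bx] := f2 y cy.
  have bfx : boundaries x.
    apply: gf1 => //=; rewrite -[g i _](subKr (g i y)) -linearB.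
    by apply: boundariesB by_ (cmap_boundaries g bx).
  by rewrite -[y](subrK (f i x)); apply: boundariesD bx _; apply: cmap_boundaries.
by have [x cx bx] := gf2 z cz; exists (f i x) => //; apply: cmap_cycles.
Qed.

Lemma quasi_iso_homotopic X Y (f g : cmap X Y) :
  (forall i x, cycles x -> boundaries (f i x - g i x)) -> quasi_iso f -> quasi_iso g.
Proof.
move=> fg qf i; have [f1 f2] := qf i; split=> [x cx bx|y cy].
  apply: f1 => //; rewrite -[f i x](subrK (g i x)); apply: boundariesD => //.
  exact: fg.
have [x cx bx] := f2 y cy; exists x => //.
rewrite -[y](subrK (f i x)) -addrA; apply: boundariesD => //; exact: fg.
Qed.

Lemma quasi_iso_acyclic X Y (f : cmap X Y) i :
  quasi_iso f -> homology0 X i <-> homology0 Y i.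
Proof.
move=> qf; have [f1 f2] := qf i; split=> [X0 y cy|Y0 x cx].
  have [x cx bx] := f2 y cy; rewrite -[y](subrK (f i x)).
  by apply: boundariesD bx _; apply: cmap_boundaries; apply: X0.
by apply: f1 => //; apply: Y0; apply: cmap_cycles.
Qed.

(* Exactness of the mapping cone, in terms of representatives. *)
Lemma quasi_iso_cone X Y (f : cmap X Y) i i1 i2 (a : X i) (e : Y i1) :
  quasi_iso f -> i1 = i + 1 -> i2 = i1 + 1 ->
  cycles a -> cdiff Y i1 i e = - f i a ->
  exists (w : X i1) (t : Y i2), cdiff X i1 i w = a /\ cdiff Y i2 i1 t - f i1 w = e.
Proof.
move=> qf i1E i2E; subst i1 i2 => ca de.
have [f1 _] := qf i; have [_ f2] := qf (i + 1).
have [|w0 w0E] := f1 a ca.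
  by rewrite -[f i a]opprK -de; apply: boundariesN; exists e.
have [|z cz [t tE]] := f2 (e + f _ w0).
  rewrite /cycles /= (addrK 1 i).
  by rewrite linearD de -cmapD w0E addNr.
exists (w0 - z), t; split; first by rewrite linearB w0E (cyclesP _ cz) ?subr0.
by rewrite tE linearB /= opprB addrA subrK addrK.
Qed.

End ComplexBasics.

(** * Homogeneous maps and Hom complexes *)

Definition hsign (A : pzRingType) (n : int) : A := (-1) ^+ `|n|%N.

Section GradedHom.
Variables (k : comPzRingType) (A : alg k).
Implicit Types X Y Z P J : cpx A.

Lemma hsignS n : hsign A (n + 1) = - hsign A n.
Proof. exact: sign_absz. Qed.

Lemma hsignK n : hsign A n * hsign A n = 1.
Proof. by rewrite /hsign -expr2 sqrr_sign. Qed.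

Lemma hsignZK (V : lmodType A) n (x : V) : hsign A n *: (hsign A n *: x) = x.
Proof. by rewrite scalerA hsignK scale1r. Qed.

Lemma dhomE X Y n m (f : ghom X Y n) p q p' q' x :
  n = m + 1 -> p = p' + 1 -> q' = q + 1 ->
  dhom m f p q x = cdiff Y q' q (f p q' x) - hsign A n *: f p' q (cdiff X p p' x).
Proof.
move=> nE pE qE; subst n q' p; rewrite /= /dhom_fun eqxx.
by move: (p' + 1 - 1) (addrK 1 p') => r ->.
Qed.

Lemma dhom_eq0 X Y n m (f : ghom X Y n) : n != m + 1 -> dhom m f = 0.
Proof. by move=> /negPf nm; apply: ghomP => p q x; rewrite /= /dhom_fun nm. Qed.

(** This locality lets a map be corrected one component at a time: changing the components out of a
    new degree keeps the equations already solved. *)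
Lemma dhom_local X Y n m (f g : ghom X Y n) p :
  (forall q x, f p q x = g p q x) -> (forall q x, f (p - 1) q x = g (p - 1) q x) ->
  forall q x, dhom m f p q x = dhom m g p q x.
Proof. by move=> fg fg1 q x; rewrite /= /dhom_fun fg fg1. Qed.

Definition ghom_lin X Y n (f : ghom X Y n) p q : {linear X p -> Y q} :=
  mk_lin (@hom_linear _ X Y n f p q).

Lemma ghom_eqP X Y n (f g : ghom X Y n) :
  (forall p q, q = p + n -> forall x, f p q x = g p q x) -> f = g.
Proof.
move=> fg; apply: ghomP => p q x; have [qE|qp] := eqVneq q (p + n); first exact: fg.
by rewrite !(hom_deg _ qp).
Qed.

Section Update.
Variables (X Y : cpx A) (n : int) (f : ghom X Y n) (M c : int) (cE : c = M + n).
Variable h : {linear X M -> Y c}.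

(** The target degree [c] is a variable with a proof of [c = M + n], so that each use chooses the
    expression for it; [same_degree] replaces a transport. *)
Definition gupdate_fun p q (x : X p) : Y q :=
  if p == M then same_degree q (h (same_degree M x)) else f p q x.

Fact gupdate_linear p q : linear (@gupdate_fun p q).
Proof. by move=> a x y; rewrite /gupdate_fun; case: ifP => _; rewrite !linearP. Qed.

Fact gupdate_deg p q : q != p + n -> forall x, @gupdate_fun p q x = 0.
Proof.
move=> qp x; rewrite /gupdate_fun; case: eqP => [pM|_]; last exact: hom_deg.
by rewrite same_degree_neq // cE -pM eq_sym.
Qed.

Definition gupdate : ghom X Y n := GHom gupdate_linear gupdate_deg.

Lemma gupdateE x : gupdate M c x = h x.
Proof. by rewrite /= /gupdate_fun eqxx !same_degree_id. Qed.

Lemma gupdate_out p q x : p != M -> gupdate p q x = f p q x.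
Proof. by rewrite /= /gupdate_fun => /negPf ->. Qed.

End Update.

(** [B i p] says that the components out of degree [p] are final from stage [i] on, so the limit
    reads them off at a stage [l p] chosen for [p]. *)
Lemma ghom_limit X Y n (B : nat -> int -> bool) (s : nat -> ghom X Y n) :
  (forall p, exists i, B i p) -> (forall i p, B i p -> B i.+1 p) ->
  (forall i p q x, B i p -> s i.+1 p q x = s i p q x) ->
  exists t : ghom X Y n, forall i p q x, B i p -> t p q x = s i p q x.
Proof.
move=> /choice [l Bl] Bmon sS.
have stab i j p q x : B i p -> s (j + i)%N p q x = s i p q x.
  move=> Bi; elim: j => // j <-; rewrite addSn sS //.
  by elim: j => // j; rewrite addSn; apply: Bmon.
exists (@GHom _ X Y n (fun p q x => s (l p) p q x)
  (fun p q => hom_linear (s (l p)) q) (fun p q qp x => hom_deg (s (l p)) qp x)).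
move=> i p q x Bi /=.
have [ij|ij] := leqP i (l p); first by rewrite -(subnK ij) stab.
by rewrite -(subnK (ltnW ij)) stab.
Qed.

(* A pair of homogeneous maps is built by successive corrections, the i-th  *)
(* of which does not change the components already fixed by [B1 i], [B2 i]. *)
Lemma ghom_recursion X Y X' Y' n n' (B1 B2 : nat -> int -> bool)
    (G : nat -> ghom X Y n -> ghom X' Y' n' -> Prop) w0 t0 :
  (forall p, exists i, B1 i p) -> (forall i p, B1 i p -> B1 i.+1 p) ->
  (forall p, exists i, B2 i p) -> (forall i p, B2 i p -> B2 i.+1 p) ->
  G 0 w0 t0 ->
  (forall i w t, G i w t -> exists w' t', [/\ G i.+1 w' t',
    forall p q x, B1 i p -> w' p q x = w p q x &
    forall p q x, B2 i p -> t' p q x = t p q x]) ->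
  exists (w : ghom X Y n) (t : ghom X' Y' n'), [/\
    forall p q x, B1 0 p -> w p q x = w0 p q x,
    forall p q x, B2 0 p -> t p q x = t0 p q x &
    forall i, exists w' t', [/\ G i w' t',
    forall p q x, B1 i p -> w p q x = w' p q x &
    forall p q x, B2 i p -> t p q x = t' p q x]].
Proof.
move=> ex1 mon1 ex2 mon2 G0 step.
pose St := (ghom X Y n * ghom X' Y' n')%type.
have /choice [F FP] (s : nat * St) : exists s' : St, G s.1 s.2.1 s.2.2 ->
    [/\ G s.1.+1 s'.1 s'.2,
    forall p q x, B1 s.1 p -> s'.1 p q x = s.2.1 p q x &
    forall p q x, B2 s.1 p -> s'.2 p q x = s.2.2 p q x].
  have [/step [w' [t' wt]]|nG] := pselect (G s.1 s.2.1 s.2.2); first by exists (w', t').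
  by exists (w0, t0).
pose fix s i : St := if i is j.+1 then F (j, s j) else (w0, t0).
have Gs i : G i (s i).1 (s i).2 by elim: i => //= i /(FP (i, s i)) [].
have [|w wE] := @ghom_limit _ _ _ B1 (fun i => (s i).1) ex1 mon1.
  by move=> i p q x; have [_ + _] := FP (i, s i) (Gs i); apply.
have [|t tE] := @ghom_limit _ _ _ B2 (fun i => (s i).2) ex2 mon2.
  by move=> i p q x; have [_ _] := FP (i, s i) (Gs i); apply.
exists w, t; split=> [p q x|p q x|i]; [exact: (wE 0%N)|exact: (tE 0%N)|].
by exists (s i).1, (s i).2; split=> // p q x; [apply: wE|apply: tE].
Qed.

Section PrePost.

Fact gpost_linear X Y Z n (f : cmap Y Z) (g : ghom X Y n) p q :
  linear (fun x : X p => f q (g p q x)).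
Proof. by move=> a x y; rewrite !linearP. Qed.

Fact gpost_deg X Y Z n (f : cmap Y Z) (g : ghom X Y n) p q :
  q != p + n -> forall x : X p, f q (g p q x) = 0.
Proof. by move=> qp x; rewrite hom_deg ?linear0. Qed.

Definition gpost X Y Z n (f : cmap Y Z) (g : ghom X Y n) : ghom X Z n :=
  GHom (gpost_linear f g) (@gpost_deg _ _ _ _ f g).

Fact gpre_linear X Y Z n (f : cmap X Y) (g : ghom Y Z n) p q :
  linear (fun x : X p => g p q (f p x)).
Proof. by move=> a x y; rewrite !linearP. Qed.

Fact gpre_deg X Y Z n (f : cmap X Y) (g : ghom Y Z n) p q :
  q != p + n -> forall x : X p, g p q (f p x) = 0.
Proof. by move=> qp x; rewrite hom_deg. Qed.

Definition gpre X Y Z n (f : cmap X Y) (g : ghom Y Z n) : ghom X Z n :=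
  GHom (gpre_linear f g) (@gpre_deg _ _ _ _ f g).

Lemma dhom_post X Y Z n m (f : cmap Y Z) (g : ghom X Y n) :
  dhom m (gpost f g) = gpost f (dhom m g).
Proof.
apply: ghomP => p q x; rewrite /= /dhom_fun; case: eqP => _; last by rewrite linear0.
by rewrite linearB (linearZ_LR (f q)) /= cmapD.
Qed.

Lemma dhom_pre X Y Z n m (f : cmap X Y) (g : ghom Y Z n) :
  dhom m (gpre f g) = gpre f (dhom m g).
Proof. by apply: ghomP => p q x; rewrite /= /dhom_fun; case: eqP => _ //=; rewrite cmapD. Qed.

Fact hom_post_linear X Y Z n (f : cmap Y Z) :
  linear (gpost f : homC X Y n -> homC X Z n).
Proof.
move=> c g h; apply: ghomP => p q x; rewrite /= linearD; congr (_ + _).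
exact: (linearZ_LR (f q)).
Qed.

Definition hom_post X Y Z (f : cmap Y Z) : cmap (homC X Y) (homC X Z) :=
  @Cmap k (homC X Y) (homC X Z) (fun n => mk_lin (@hom_post_linear X Y Z n f))
    (fun i j x => esym (dhom_post j f x)).

Fact hom_pre_linear X Y Z n (f : cmap X Y) :
  linear (gpre f : homC Y Z n -> homC X Z n).
Proof. by move=> c g h; exact: (@ghomP A X Z n). Qed.

Definition hom_pre X Y Z (f : cmap X Y) : cmap (homC Y Z) (homC X Z) :=
  @Cmap k (homC Y Z) (homC X Z) (fun n => mk_lin (@hom_pre_linear X Y Z n f))
    (fun i j x => esym (dhom_pre j f x)).

End PrePost.

End GradedHom.

Section LinearPairs.
Variable R : pzRingType.
Implicit Types U V W : lmodType R.

Fact lin_pair_linear U V W (f : {linear U -> V}) (g : {linear U -> W}) :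
  linear (fun x => (f x, g x)).
Proof. by move=> a x y; rewrite !linearP. Qed.

Definition lin_pair U V W (f : {linear U -> V}) (g : {linear U -> W}) :
  {linear U -> (V * W)%type} := mk_lin (lin_pair_linear f g).

Fact lin_copair_linear U V W (f : {linear U -> W}) (g : {linear V -> W}) :
  linear (fun x : U * V => f x.1 + g x.2).
Proof. by move=> a x y; rewrite !linearP scalerDr addrACA. Qed.

Definition lin_copair U V W (f : {linear U -> W}) (g : {linear V -> W}) :
  {linear (U * V)%type -> W} := mk_lin (lin_copair_linear f g).

Fact lin_sign_linear V n : linear (fun x : V => hsign R n *: x).
Proof. by move=> a x y; rewrite scalerDr !scalerA commr_sign. Qed.

Definition lin_sign V n : {linear V -> V} := mk_lin (@lin_sign_linear V n).

End LinearPairs.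

(** * Solving for components degree by degree against a mapping cone *)

Section Lifting.
Variables (k : comPzRingType) (A : alg k).
Implicit Types X Y Z P J : cpx A.

(** Exactness of the cone at the single spot formed by [X i] and [Y (i + 1)]. It is separated from
    [quasi_iso] in order to treat also the zero map of a complex that is exact only in high
    degrees. *)
Definition cone_exact X Y (f : cmap X Y) (i : int) : Prop :=
  forall i1 i2, i1 = i + 1 -> i2 = i1 + 1 ->
  forall (a : X i) (e : Y i1), cycles a -> cdiff Y i1 i e = - f i a ->
  exists (w : X i1) (t : Y i2), cdiff X i1 i w = a /\ cdiff Y i2 i1 t - f i1 w = e.

(* The pair (g, u) is a cycle of Hom(P, cone f), and it is exhibited as the *)
(* boundary of a pair (w, t) that is prescribed below the degree N.         *)
Lemma proj_extend P X Y (f : cmap X Y) (N n n1 n2 : int) (g : ghom P X n)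
    (u : ghom P Y n1) (w0 : ghom P X n1) (t0 : ghom P Y n2) :
  n1 = n + 1 -> n2 = n1 + 1 ->
  (forall p, N <= p -> projectiveM (P p)) ->
  (forall i, N + n <= i -> cone_exact f i) ->
  dhom (n - 1) g = 0 -> dhom n u = gpost f g ->
  (forall p q x, p < N -> dhom n w0 p q x = g p q x) ->
  (forall p q x, p < N -> dhom n1 t0 p q x = f q (w0 p q x) - u p q x) ->
  exists (w : ghom P X n1) (t : ghom P Y n2),
    [/\ forall p q x, p < N -> w p q x = w0 p q x,
        forall p q x, p < N -> t p q x = t0 p q x,
        dhom n w = g & dhom n1 t = gpost f w - u].
Proof.
move=> n1E n2E projP exf dg du w0g t0u.
have s1 : hsign A n1 = - hsign A n by rewrite n1E hsignS.
have s2 : hsign A n2 = - hsign A n1 by rewrite n2E hsignS.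
pose B (i : nat) (p : int) := p < N + i%:Z.
have exB p : exists i, B i p.
  by exists `|p - N|.+1%N; rewrite /B; lia.
have monB i p : B i p -> B i.+1 p by rewrite /B; lia.
pose G i (w : ghom P X n1) (t : ghom P Y n2) :=
  (forall p q x, B i p -> dhom n w p q x = g p q x) /\
  (forall p q x, B i p -> dhom n1 t p q x = f q (w p q x) - u p q x).
have [||w [t [ww0 tt0 Gwt]]] := ghom_recursion (G := G) (w0 := w0) (t0 := t0) exB monB exB monB.
- by split=> p q x; rewrite /B addr0 => ?; [apply: w0g|apply: t0u].
- move=> i w t [Qw Qt]; have [M ME] : exists M, M = N + i%:Z by exists (N + i%:Z).
  have wd y : cdiff X (M + n) (M - 1 + n) (w (M - 1) (M + n) (cdiff P M (M - 1) y)) =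
      g (M - 1) (M - 1 + n) (cdiff P M (M - 1) y).
    have /= <- := Qw (M - 1) (M - 1 + n) (cdiff P M (M - 1) y) ltac:(rewrite /B; lia).
    rewrite -[RHS]/(dhom n w _ _ _) (dhomE _ _ (p' := M - 2) (q' := M + n)); [|lia..].
    by rewrite diffK linear0 scaler0 subr0.
  have td y : cdiff Y (M + n1) (M + n) (t (M - 1) (M + n1) (cdiff P M (M - 1) y)) =
      f (M + n) (w (M - 1) (M + n) (cdiff P M (M - 1) y)) -
      u (M - 1) (M + n) (cdiff P M (M - 1) y).
    have /= <- := Qt (M - 1) (M + n) (cdiff P M (M - 1) y) ltac:(rewrite /B; lia).
    rewrite -[RHS]/(dhom n1 t _ _ _) (dhomE _ _ (p' := M - 2) (q' := M + n1)); [|lia..].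
    by rewrite diffK linear0 scaler0 subr0.
  have gd y : cdiff X (M + n) (M - 1 + n) (g M (M + n) y) =
      hsign A n *: g (M - 1) (M - 1 + n) (cdiff P M (M - 1) y).
    have /(congr1 (fun h : ghom P X _ => h M (M - 1 + n) y)) := dg.
    rewrite (dhomE _ _ (p' := M - 1) (q' := M + n)); [|lia..].
    by move/eqP; rewrite subr_eq0 => /eqP.
  have ud y : cdiff Y (M + n1) (M + n) (u M (M + n1) y) =
      f (M + n) (g M (M + n) y) + hsign A n1 *: u (M - 1) (M + n) (cdiff P M (M - 1) y).
    have /(congr1 (fun h : ghom P Y _ => h M (M + n) y)) := du.
    rewrite (dhomE _ _ (p' := M - 1) (q' := M + n1)); [|lia..].
    by move/eqP; rewrite subr_eq => /eqP.
  (* The unknown components [(w, t)] out of [P M] have to satisfy [D (w, t) = (a, e)], where [D] is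
     the differential of the cone. The equations in lower degrees make [(a x, e x)] a cycle of the
     cone, hence a value of [D], and projectivity of [P M] chooses the preimage linearly. *)
  pose a : {linear P M -> X (M + n)} := ghom_lin g M (M + n) \+
    (lin_sign _ n1 \o (ghom_lin w (M - 1) (M + n) \o cdiff P M (M - 1))).
  pose e : {linear P M -> Y (M + n1)} :=
    (lin_sign _ n2 \o (ghom_lin t (M - 1) (M + n1) \o cdiff P M (M - 1))) \- ghom_lin u M (M + n1).
  pose D : {linear (X (M + n1)%R * Y (M + n2)%R)%type -> (X (M + n)%R * Y (M + n1)%R)%type} :=
    lin_pair (cdiff X (M + n1) (M + n) \o fst)
      ((cdiff Y (M + n2) (M + n1) \o snd) \- (f (M + n1) \o fst)).
  have [||h hE] := @projective_lift _ _ _ _ D (lin_pair a e) (projP M _); first by lia.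
    move=> x.
    have cx : cycles (a x).
      rewrite /cycles /= (_ : M + n - 1 = M - 1 + n); last lia.
      by rewrite linearD linearZ_LR /= gd wd s1 scaleNr subrr.
    have ex : cdiff Y (M + n1) (M + n) (e x) = - f (M + n) (a x).
      rewrite linearB linearD !linearZ_LR /= td ud s2.
      rewrite scaleNr scalerBr opprB !opprD.
      by rewrite [LHS]addrC -[LHS]addrA addKr.
    have [wx [tx [wxE txE]]] :=
      exf (M + n) ltac:(lia) (M + n1) (M + n2) ltac:(lia) ltac:(lia) _ _ cx ex.
    by exists (wx, tx); rewrite /= wxE txE.
  pose w' := gupdate w (erefl (M + n1)) (fst \o h).
  pose t' := gupdate t (erefl (M + n2)) (snd \o h).
  have h1 x : cdiff X (M + n1) (M + n) (h x).1 = a x by have [] := hE x.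
  have h2 x : cdiff Y (M + n2) (M + n1) (h x).2 - f (M + n1) (h x).1 = e x by have [] := hE x.
  exists w', t'; split=> [|p q x Bp|p q x Bp];
    try by rewrite gupdate_out //; move: Bp; rewrite /B; lia.
  have BM p : B i.+1 p -> p = M \/ B i p /\ p != M /\ p - 1 != M by rewrite /B; lia.
  split=> p q x /BM [?|[Bp [pM pM1]]].
  - subst p; have [qE|qM] := eqVneq q (M + n); last by rewrite !(hom_deg _ qM).
    subst q; rewrite (dhomE _ _ (p' := M - 1) (q' := M + n1)); [|lia..].
    by rewrite gupdateE gupdate_out /= ?h1 ?addrK //; lia.
  - rewrite -Qw //; apply: dhom_local => r y; rewrite gupdate_out //.
  - subst p; have [qE|qM] := eqVneq q (M + n1); last by rewrite !(hom_deg _ qM) linear0 subr0.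
    subst q; rewrite (dhomE _ _ (p' := M - 1) (q' := M + n2)); [|lia..].
    rewrite !gupdateE gupdate_out; last lia.
    have /eqP := h2 x; rewrite subr_eq => /eqP -> /=; rewrite s2.
    by rewrite scaleNr opprK [LHS]addrC -(addrA (- _)) addNKr addrC.
  - rewrite [w' p q x]gupdate_out // -Qt //; apply: dhom_local => r y; rewrite gupdate_out //.
exists w, t; split=> [p q x pN|p q x pN||].
- by rewrite ww0 // /B addr0.
- by rewrite tt0 // /B addr0.
- apply: ghomP => p q x; have [i Bi] := exB p.
  have [w' [t' [[Qw _] wE _]]] := Gwt i; rewrite -(Qw _ _ _ Bi).
  by apply: dhom_local => r y; apply: wE => //; move: Bi; rewrite /B; lia.
- apply: ghomP => p q x; have [i Bi] := exB p.
  have [w' [t' [[_ Qt] wE tE]]] := Gwt i.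
  rewrite [RHS]/= (wE _ _ _ Bi) -(Qt _ _ _ Bi).
  by apply: dhom_local => r y; apply: tE => //; move: Bi; rewrite /B; lia.
Qed.

End Lifting.

Section InjectiveLifting.
Variables (k : comPzRingType) (A : alg k).
Implicit Types X Y J : cpx A.

(* Dually, (g, u) represents a cycle of Hom(cone f, J). *)
Lemma inj_lift X Y J (f : cmap X Y) (n n1 n2 : int) (g : ghom Y J n) (u : ghom X J n1) :
  n1 = n + 1 -> n2 = n1 + 1 ->
  left_bounded J -> (forall q, injectiveM (J q)) -> quasi_iso f ->
  dhom (n - 1) g = 0 -> dhom n u = gpre f g ->
  exists (w : ghom Y J n1) (t : ghom X J n2), dhom n w = g /\ dhom n1 t = gpre f w - u.
Proof.
move=> n1E n2E [c J0] injJ qf dg du.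
have s1 : hsign A n1 = - hsign A n by rewrite n1E hsignS.
have s2 : hsign A n2 = - hsign A n1 by rewrite n2E hsignS.
(* Both equations hold trivially out of the degrees where the targets lie above [c], and the
   recursion descends from there. The map [t] is one degree ahead of [w], because its component out
   of [M - 1] already enters the equation at [M]. *)
pose N := c - n.
pose B1 (i : nat) (p : int) := N - i%:Z <= p.
pose B2 (i : nat) (p : int) := N - i%:Z - 1 <= p.
have exB1 p : exists i, B1 i p by exists `|p - N|%N; rewrite /B1; lia.
have exB2 p : exists i, B2 i p by exists `|p - N|%N; rewrite /B2; lia.
have monB1 i p : B1 i p -> B1 i.+1 p by rewrite /B1; lia.
have monB2 i p : B2 i p -> B2 i.+1 p by rewrite /B2; lia.
pose G i (w : ghom Y J n1) (t : ghom X J n2) :=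
  (forall p q x, N - i%:Z < p -> dhom n w p q x = g p q x) /\
  (forall p q x, N - i%:Z <= p -> dhom n1 t p q x = w p q (f p x) - u p q x).
have [||w [t [_ _ Gwt]]] := ghom_recursion (G := G) (w0 := 0) (t0 := 0) exB1 monB1 exB2 monB2.
- split=> p q x pN.
    have [qE|qp] := eqVneq q (p + n); last by rewrite !(hom_deg _ qp).
    by apply: etrans (J0 _ _ _) (esym (J0 _ _ _)); rewrite qE; move: pN; rewrite /N; lia.
  have [qE|qp] := eqVneq q (p + n1); last by rewrite !(hom_deg _ qp) subr0.
  by apply: etrans (J0 _ _ _) (esym (J0 _ _ _)); rewrite qE; move: pN; rewrite /N; lia.
- move=> i w t [Qw Qt]; have [M ME] : exists M, M = N - i%:Z by exists (N - i%:Z).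
  rewrite -ME in Qw Qt.
  have wd y : cdiff J (M + n1) (M + n) (w M (M + n1) (cdiff Y (M + 1) M y)) =
      g M (M + n) (cdiff Y (M + 1) M y).
    have gd : cdiff J (M + n1) (M + n) (g (M + 1) (M + n1) y) =
        hsign A n *: g M (M + n) (cdiff Y (M + 1) M y).
      have /(congr1 (fun h : ghom Y J _ => h (M + 1) (M + n) y)) := dg.
      rewrite (dhomE _ _ (p' := M) (q' := M + n1)); [|lia..].
      by move/eqP; rewrite subr_eq0 => /eqP.
    apply: (can_inj (@hsignZK _ A _ n)); rewrite -gd.
    have := Qw (M + 1) (M + n1) y ltac:(lia).
    rewrite (dhomE _ _ (p' := M) (q' := M + 2 + n)); [|lia..] => <-.
    by rewrite linearB diffK linearZ_LR /= s1 scaleNr opprK add0r.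
  have td x : hsign A n1 *: cdiff J (M + n1) (M + n) (t (M - 1) (M + n1) (cdiff X M (M - 1) x)) =
      cdiff J (M + n1) (M + n) (w M (M + n1) (f M x)) - g M (M + n) (f M x)
      - hsign A n1 *: u (M - 1) (M + n) (cdiff X M (M - 1) x).
    have ud : cdiff J (M + n1) (M + n) (u M (M + n1) x) =
        g M (M + n) (f M x) + hsign A n1 *: u (M - 1) (M + n) (cdiff X M (M - 1) x).
      have /(congr1 (fun h : ghom X J _ => h M (M + n) x)) := du.
      rewrite (dhomE _ _ (p' := M - 1) (q' := M + n1)); [|lia..].
      by move/eqP; rewrite subr_eq => /eqP.
    have /(congr1 (cdiff J (M + n1) (M + n))) := Qt M (M + n1) x ltac:(lia).
    rewrite (dhomE _ _ (p' := M - 1) (q' := M + n2)); [|lia..].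
    by rewrite !linearB linearZ_LR /= diffK ud s2 scaleNr sub0r opprK opprD addrA.
  (* The new components, [w] out of [Y (M - 1)] and [t] out of [X (M - 2)], form a map whose
     composite with [H] has to be [F]. Exactness of the cone of [f] shows that [F] kills the kernel
     of [H]. *)
  pose H : {linear (Y M * X (M - 1)%R)%type -> (Y (M - 1)%R * X (M - 2)%R)%type} :=
    lin_pair ((lin_sign _ n1 \o (cdiff Y M (M - 1) \o fst)) \+ (f (M - 1) \o snd))
      (lin_sign _ n2 \o (cdiff X (M - 1) (M - 2) \o snd)).
  pose L1 : {linear Y M -> J (M + n)} :=
    (cdiff J (M + n1) (M + n) \o ghom_lin w M (M + n1)) \- ghom_lin g M (M + n).
  pose F : {linear (Y M * X (M - 1)%R)%type -> J (M + n)} :=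
    lin_copair L1
      ((cdiff J (M + n1) (M + n) \o ghom_lin t (M - 1) (M + n1)) \+ ghom_lin u (M - 1) (M + n)).
  have [|h hE] := @injective_extend _ _ _ _ H F (injJ _).
    move=> [y x] [yE xE].
    have cx : cycles x.
      rewrite /cycles /= (_ : M - 1 - 1 = M - 2); last lia.
      by rewrite -[LHS](hsignZK n2) xE scaler0.
    have ey : cdiff Y M (M - 1) (hsign A n1 *: y) = - f (M - 1) x.
      by rewrite linearZ_LR /=; apply/eqP; rewrite -addr_eq0; apply/eqP.
    have [w' [t' [w'E t'E]]] := quasi_iso_cone qf (esym (subrK 1 M)) erefl cx ey.
    apply: (can_inj (@hsignZK _ A _ n1)); rewrite scaler0 /F mk_linE [_.1]/= [_.2]/= scalerDr.
    rewrite -(linearZ_LR L1) -t'E linearB /= wd subrr sub0r -w'E scalerDr td.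
    by rewrite subrK addNr.
  pose w1 := gupdate w (ltac:(lia) : M + n = (M - 1) + n1) (h \o lin_pair idfun \0).
  pose t1 := gupdate t (ltac:(lia) : M + n = (M - 2) + n2) (h \o lin_pair \0 idfun).
  have h1 y : hsign A n1 *: w1 (M - 1) (M + n) (cdiff Y M (M - 1) y) =
      cdiff J (M + n1) (M + n) (w M (M + n1) y) - g M (M + n) y.
    rewrite gupdateE -linearZ_LR /=.
    have -> : (hsign A n1 *: cdiff Y M (M - 1) y, 0) = H (y, 0).
      by rewrite /H /= !linear0 addr0 scaler0.
    by rewrite hE /F /= !linear0 !addr0.
  have h2 x : w1 (M - 1) (M + n) (f (M - 1) x) +
        hsign A n2 *: t1 (M - 2) (M + n) (cdiff X (M - 1) (M - 2) x) =
      cdiff J (M + n1) (M + n) (t (M - 1) (M + n1) x) + u (M - 1) (M + n) x.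
    rewrite !gupdateE /= -(linearZ_LR h) -(linearD h).
    have -> : (f (M - 1) x, 0) + hsign A n2 *: (0, cdiff X (M - 1) (M - 2) x) = H (0, x).
      by apply: injective_projections; rewrite /H /= ?linear0 ?scaler0 ?addr0 ?add0r.
    by rewrite hE /F mk_linE (linear0 L1) add0r.

  exists w1, t1; split=> [|p q x Bp|p q x Bp]; last 2 first.
  + by rewrite gupdate_out //; move: Bp; rewrite /B1; lia.
  + by rewrite gupdate_out //; move: Bp; rewrite /B2; lia.
  split=> p q x pN.
    have [pM|pM] := eqVneq p M; last first.
      rewrite -Qw; last by move: pM pN; lia.
      by apply: dhom_local => r y; rewrite gupdate_out //; move: pM pN; lia.
    subst p; have [qE|qM] := eqVneq q (M + n); last by rewrite !(hom_deg _ qM).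
    subst q; rewrite (dhomE _ _ (p' := M - 1) (q' := M + n1)); [|lia..].
    by rewrite h1 gupdate_out ?subKr //; lia.
  have [pM|pM] := eqVneq p (M - 1); last first.
    rewrite [w1 _ _ _]gupdate_out // -Qt; last by move: pM pN; lia.
    by apply: dhom_local => r y; rewrite gupdate_out //; move: pM pN; lia.
  subst p; have [qE|qM] := eqVneq q (M + n); last first.
    have qM1 : q != M - 1 + n1 by apply: contra_neq qM => ->; lia.
    by rewrite !(hom_deg _ qM1) subr0.
  subst q; rewrite (dhomE _ _ (p' := M - 2) (q' := M + n1)); [|lia..].
  have -> : t1 (M - 1) (M + n1) x = t (M - 1) (M + n1) x by rewrite gupdate_out //; lia.
  by apply/eqP; rewrite subr_eq addrAC [w1 _ _ _ + _]h2 addrK.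
exists w, t; split; apply: ghomP => p q x.
- have [i [Bi Bi1]] : exists i, B1 i (p - 1) /\ B1 i p.
    by have [i Bi] := exB1 (p - 1); exists i; split=> //; move: Bi; rewrite /B1; lia.
  have [w' [t' [[Qw _] wE _]]] := Gwt i.
  rewrite -Qw; last by move: Bi; rewrite /B1; lia.
  by apply: dhom_local => r y; apply: wE.
- have [i Bi] := exB1 p; have [w' [t' [[_ Qt] wE tE]]] := Gwt i.
  rewrite [RHS]/= (wE _ _ _ Bi) -(Qt _ _ _ Bi).
  by apply: dhom_local => r y; apply: tE => //; move: Bi; rewrite /B1 /B2; lia.
Qed.

End InjectiveLifting.

(** * Homotopies and comparison of resolutions *)

Lemma quasi_iso_2of6 (R : pzRingType) (X Y : cpx R) (f : cmap X Y) (g : cmap Y X) :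
  quasi_iso (ccomp g f) -> quasi_iso (ccomp f g) -> quasi_iso f.
Proof.
move=> qgf qfg i; have [gf _] := qgf i; have [_ fg] := qfg i; split=> [x cx bx|y cy].
  by apply: gf => //; exact: (cmap_boundaries g bx).
by have [z cz bz] := fg y cy; exists (g i z) => //; apply: cmap_cycles.
Qed.

Lemma quasi_iso_ext (R : pzRingType) (X Y : cpx R) (f g : cmap X Y) :
  (forall i x, f i x = g i x) -> quasi_iso f -> quasi_iso g.
Proof.
by move=> fg; apply: quasi_iso_homotopic => i x _; rewrite fg subrr; apply: boundaries0.
Qed.

Section Comparison.
Variables (k : comPzRingType) (A : alg k).
Implicit Types X Y Z P J : cpx A.

(** Injectivity on homology is [proj_extend] for a cycle [g] with [u] bounding its image,
    surjectivity is the case [g = 0]. The recursion starts from zero maps below [N], where [P]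
    vanishes. *)
Lemma hom_post_quasi_iso P X Y (f : cmap X Y) :
  right_bounded P -> (forall i, projectiveM (P i)) -> quasi_iso f ->
  quasi_iso (hom_post P f).
Proof.
move=> [N P0] projP qf.
have ext := @proj_extend k A P X Y f N; split=> [g cg [u uE]|u cu].
  have [||||||w [t [_ _ dw _]]] := ext i _ _ g u 0 0 erefl erefl; last by exists w.
  - by move=> p _; apply: projP.
  - by move=> j _ i1 i2 i1E i2E a e; apply: quasi_iso_cone.
  - exact: cg.
  - exact: uE.
  - by move=> p q x pN; rewrite (P0 p pN x) !linear0.
  - by move=> p q x pN; rewrite (P0 p pN x) !linear0 addr0.
have [||||||w [t [_ _ dw dt]]] := ext (i - 1) i (i + 1) 0 u 0 0 (esym (subrK 1 i)) erefl.
- by move=> p _; apply: projP.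
- by move=> j _ i1 i2 i1E i2E a e; apply: quasi_iso_cone.
- exact: (linear0 (cdiff (homC P X) (i - 1) (i - 1 - 1))).
- by rewrite [LHS]cu; apply: ghomP => p q x; rewrite /= linear0.
- by move=> p q x pN; rewrite (P0 p pN x) !linear0.
- by move=> p q x pN; rewrite (P0 p pN x) !linear0 addr0.
exists w; first exact: dw.
by rewrite -[_ - _]opprB; apply: boundariesN; exists t.
Qed.

Lemma hom_pre_quasi_iso J X Y (f : cmap X Y) :
  left_bounded J -> (forall i, injectiveM (J i)) -> quasi_iso f ->
  quasi_iso (hom_pre J f).
Proof.
move=> J0 injJ qf i; split=> [g cg [u uE]|u cu].
  by have [w [t [dw _]]] := inj_lift erefl erefl J0 injJ qf cg uE; exists w.
have d0 : dhom (i - 1 - 1) (0 : ghom Y J (i - 1)) = 0.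
  exact: (linear0 (cdiff (homC Y J) (i - 1) (i - 1 - 1))).
have du : dhom (i - 1) u = gpre f 0 by rewrite [LHS]cu; apply: ghomP.
have [w [t [dw dt]]] := inj_lift (esym (subrK 1 i)) erefl J0 injJ qf d0 du.
exists w; first exact: dw.
by rewrite -[_ - _]opprB; apply: boundariesN; exists t.
Qed.

Section CmapHom.
Variables X Y : cpx A.

Fact gcmap_linear (f : cmap X Y) p q : linear (fun x : X p => same_degree q (f p x)).
Proof. by move=> a x y; rewrite !linearP. Qed.

Fact gcmap_deg (f : cmap X Y) p q : q != p + 0 -> forall x : X p, same_degree q (f p x) = 0.
Proof. by rewrite addr0 eq_sym => pq x; apply: same_degree_neq. Qed.

(** Chain maps are the cycles of degree 0 of the Hom complex and homotopies their boundaries, so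
    lifting up to homotopy becomes a statement about homology. *)
Definition gcmap (f : cmap X Y) : ghom X Y 0 := GHom (gcmap_linear f) (@gcmap_deg f).

Lemma gcmapE (f : cmap X Y) p x : gcmap f p p x = f p x.
Proof. exact: same_degree_id. Qed.

Lemma gcmap_cycle (f : cmap X Y) m : dhom m (gcmap f) = 0.
Proof.
apply: ghomP => p q x; rewrite /= /dhom_fun; case: eqP => // _.
by rewrite expr0 scale1r /= cmapD same_degree_diff subrr.
Qed.

Variables (g : ghom X Y 0) (dg : dhom (0 - 1) g = 0).

Fact cmap_of_cycle_subproof i j x :
  ghom_lin g j j (cdiff X i j x) = cdiff Y i j (ghom_lin g i i x).
Proof.
have [iE|ij] := eqVneq i (j + 1); last by rewrite !diff_shape ?linear0.
have /(congr1 (fun h : ghom X Y _ => h i j x)) := dg.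
rewrite (dhomE _ _ (p' := j) (q' := i)) // /hsign expr0 scale1r.
by move/eqP; rewrite subr_eq0 => /eqP.
Qed.

Definition cmap_of_cycle : cmap X Y := Cmap cmap_of_cycle_subproof.

Lemma gcmap_of_cycle : gcmap cmap_of_cycle = g.
Proof.
apply: ghom_eqP => p q; rewrite addr0 => qE x; subst q.
exact: gcmapE.
Qed.

End CmapHom.

Lemma cycle_cmap X Y (g : homC X Y 0) : cycles g -> exists f : cmap X Y, g = gcmap f.
Proof. by move=> cg; exists (cmap_of_cycle cg); rewrite gcmap_of_cycle. Qed.

Lemma gpost_gcmap X Y Z (f : cmap Y Z) (g : cmap X Y) :
  gpost f (gcmap g) = gcmap (ccomp f g).
Proof.
apply: ghom_eqP => p q; rewrite addr0 => qE x; subst q.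
by rewrite gcmapE /= same_degree_id.
Qed.

Lemma gpre_gcmap X Y Z (f : cmap X Y) (g : cmap Y Z) :
  gpre f (gcmap g) = gcmap (ccomp g f).
Proof. exact: ghomP. Qed.

Definition homotopic X Y (f g : cmap X Y) : Prop :=
  exists h : ghom X Y 1, dhom 0 h = gcmap f - gcmap g.

Lemma homotopicE X Y (f g : cmap X Y) : homotopic f g ->
  exists h : ghom X Y 1, forall i j l x, i = j + 1 -> l = i + 1 ->
    f i x - g i x = cdiff Y l i (h i l x) + h j i (cdiff X i j x).
Proof.
move=> [h dh]; exists h => i j l x iE lE.
have /(congr1 (fun h : ghom X Y _ => h i i x)) := dh.
rewrite [RHS]/= !same_degree_id => <-; rewrite -[h j i _]opprK.
rewrite -[LHS]/(dhom 0 h _ _ _) (dhomE _ _ (p' := j) (q' := l)) //.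
by rewrite /hsign expr1 scaleN1r opprK.
Qed.

Lemma homotopic_homology X Y (f g : cmap X Y) i x :
  homotopic f g -> cycles x -> boundaries (f i x - g i x).
Proof.
move=> /homotopicE [h hE] cx; rewrite (hE i (i - 1) (i + 1)) ?subrK // cx linear0 addr0.
exact: boundary_intro.
Qed.

Fact gcomp1_linear X Y Z n (f : ghom Y Z n) (h : ghom X Y 1) p q :
  linear (fun x : X p => f (p + 1) q (h p (p + 1) x)).
Proof. by move=> a x y; rewrite !linearP. Qed.

Fact gcomp1_deg X Y Z n (f : ghom Y Z n) (h : ghom X Y 1) p q :
  q != p + (n + 1) -> forall x : X p, f (p + 1) q (h p (p + 1) x) = 0.
Proof. by move=> qp x; apply: hom_deg; apply: contra_neq qp => ->; lia. Qed.

Definition gcomp1 X Y Z n (f : ghom Y Z n) (h : ghom X Y 1) : ghom X Z (n + 1) :=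
  GHom (gcomp1_linear f h) (@gcomp1_deg _ _ _ _ f h).

Lemma gcomp1E X Y Z n (f : ghom Y Z n) (h : ghom X Y 1) p p' q x :
  p' = p + 1 -> gcomp1 f h p q x = f p' q (h p p' x).
Proof. by move=> ->. Qed.

Lemma hsign_cases n : hsign A n = 1 \/ hsign A n = -1.
Proof. by rewrite /hsign -signr_odd; case: odd; [right|left]; rewrite ?expr1 ?expr0. Qed.

(** Composing the cycle [y] with the homotopy gives a map with differential [(-1)^n] times the
    difference; the two cases of the sign are treated at the end. *)
Lemma hom_pre_homotopic X Y Z (f g : cmap X Y) n (y : homC Y Z n) :
  homotopic f g -> cycles y -> boundaries (hom_pre Z f n y - hom_pre Z g n y).
Proof.
move=> /homotopicE [h hE] cy.
have dE : dhom n (gcomp1 y h) = GHom (hom_scale_linear (hsign k n) (gpre f y - gpre g y))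
    (@hom_scale_deg _ _ _ _ _ (hsign k n) (gpre f y - gpre g y)).
  apply: ghom_eqP => p q qE x.
  have yd v : cdiff Z (q + 1) q (y (p + 1) (q + 1) v) = hsign A n *: y p q (cdiff Y (p + 1) p v).
    have /(congr1 (fun h : ghom Y Z _ => h (p + 1) q v)) : dhom (n - 1) y = 0 := cy.
    rewrite (dhomE _ _ (p' := p) (q' := q + 1)); [|lia..].
    by move/eqP; rewrite subr_eq0 => /eqP.
  rewrite (dhomE _ _ (p' := p - 1) (q' := q + 1)) ?subrK //.
  rewrite (gcomp1E _ _ _ _ erefl) (gcomp1E _ _ _ _ (esym (subrK 1 p))) yd hsignS scaleNr opprK.
  rewrite -scalerDr -linearD -(hE p) ?subrK //= linearB.
  by rewrite /hsign rmorphXn rmorphN rmorph1.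
have [sE|sE] := hsign_cases n.
- exists (gcomp1 y h); rewrite -[LHS]/(dhom n _) dE; apply: ghomP => p q x.
  by rewrite /= rmorphXn rmorphN rmorph1 -/(hsign A n) sE scale1r.
- rewrite -[X in boundaries X]opprK; apply: boundariesN.
  exists (gcomp1 y h); rewrite -[LHS]/(dhom n _) dE; apply: ghomP => p q x.
  by rewrite /= rmorphXn rmorphN rmorph1 -/(hsign A n) sE scaleN1r.
Qed.

Lemma homotopic_sym X Y (f g : cmap X Y) : homotopic f g -> homotopic g f.
Proof.
move=> [h dh]; exists (- h); rewrite -opprB -dh.
exact: (linearN (cdiff (homC X Y) 1 0)).
Qed.

Lemma hom_pre_homotopic_id Z X (f : cmap X X) :
  homotopic f (Defs.cid X) -> quasi_iso (hom_pre Z f).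
Proof.
move=> fh; apply: (quasi_iso_homotopic _ (@quasi_iso_id _ (homC X Z))).
move=> i y cy; have := hom_pre_homotopic (homotopic_sym fh) cy.
by congr (boundaries (_ - _)); apply: ghomP.
Qed.

(** Surjectivity of [f] composed on the left lifts the identity of [P'] to [g]. Then [f g f] is
    homotopic to [f], and injectivity of the same operation cancels [f]. *)
Lemma proj_homotopy_inverse P P' (f : cmap P P') :
  right_bounded P -> (forall i, projectiveM (P i)) ->
  right_bounded P' -> (forall i, projectiveM (P' i)) -> quasi_iso f ->
  exists g : cmap P' P, homotopic (ccomp f g) (Defs.cid P') /\ homotopic (ccomp g f) (Defs.cid P).
Proof.
move=> bP pP bP' pP' qf.
have [_ f2] := hom_post_quasi_iso bP' pP' qf 0.
have [g0 /cycle_cmap [g ->] [h dh]] := f2 (gcmap (Defs.cid P')) (gcmap_cycle _ _).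
have fg : homotopic (Defs.cid P') (ccomp f g) by exists h; rewrite -gpost_gcmap.
exists g; split; first exact: homotopic_sym.
have [f1 _] := hom_post_quasi_iso bP pP qf 0.
have [||h' dh'] := f1 (gcmap (ccomp g f) - gcmap (Defs.cid P)).
- rewrite /cycles /=; apply: etrans (linearB (cdiff (homC P P) 0 (0 - 1)) _ _) _.
  by rewrite /= !gcmap_cycle subrr.
- have [l dl] := homotopic_sym fg; exists (gpre f l).
  apply: etrans (dhom_pre 0 f l) _; rewrite dl.
  apply: ghom_eqP => p q; rewrite addr0 => qE x; subst q.
  by rewrite /= !same_degree_id linearB.
by exists h'.
Qed.

(** Since [Y] is arbitrary, no lifting into [Y] is available; the homotopy inverse of [f] is used
    instead. *)
Lemma hom_pre_projective P P' Y (f : cmap P P') :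
  right_bounded P -> (forall i, projectiveM (P i)) ->
  right_bounded P' -> (forall i, projectiveM (P' i)) -> quasi_iso f ->
  quasi_iso (hom_pre Y f).
Proof.
move=> bP pP bP' pP' qf; have [g [fg gf]] := proj_homotopy_inverse bP pP bP' pP' qf.
apply: (@quasi_iso_2of6 _ _ _ _ (hom_pre Y g)).
  by apply: quasi_iso_ext (hom_pre_homotopic_id Y fg) => i y; apply: ghomP.
by apply: quasi_iso_ext (hom_pre_homotopic_id Y gf) => i y; apply: ghomP.
Qed.

Lemma projres_lift X P (Q : projres X) (f : cmap P X) :
  right_bounded P -> (forall i, projectiveM (P i)) ->
  exists g : cmap P Q, homotopic f (ccomp (projres_map Q) g).
Proof.
move=> bP pP; have [_ q2] := hom_post_quasi_iso bP pP (@projres_quasi_iso _ _ Q) 0.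
have [g0 /cycle_cmap [g ->] [h dh]] := q2 (gcmap f) (gcmap_cycle _ _).
by exists g, h; rewrite -gpost_gcmap.
Qed.

Lemma projres_compare X (P Q : projres X) : exists g : cmap P Q, quasi_iso g.
Proof.
have [g gh] := projres_lift Q (projres_map P) (projres_bounded P) (@projres_projective _ _ P).
exists g; apply: quasi_iso_cancel_l (@projres_quasi_iso _ _ Q) _.
apply: quasi_iso_homotopic (@projres_quasi_iso _ _ P) => i x.
exact: homotopic_homology.
Qed.

Lemma RHom_compare X (P Q : projres X) Y : exists g : cmap (RHom Q Y) (RHom P Y), quasi_iso g.
Proof.
have [g qg] := projres_compare P Q; exists (hom_pre Y g).
apply: hom_pre_projective qg; try exact: projres_bounded; exact: projres_projective.
Qed.

Lemma RHom_homology0 X (P Q : projres X) Y i :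
  homology0 (RHom P Y) i <-> homology0 (RHom Q Y) i.
Proof. by have [g qg] := RHom_compare P Q Y; split=> /(quasi_iso_acyclic i qg). Qed.

Lemma inj_homotopy_inverse J J' (f : cmap J J') :
  left_bounded J -> (forall i, injectiveM (J i)) -> quasi_iso f ->
  exists g : cmap J' J, homotopic (ccomp g f) (Defs.cid J).
Proof.
move=> bJ iJ qf; have [_ f2] := hom_pre_quasi_iso bJ iJ qf 0.
have [g0 /cycle_cmap [g ->] [h dh]] := f2 (gcmap (Defs.cid J)) (gcmap_cycle _ _).
by exists g; apply: homotopic_sym; exists h; rewrite -gpre_gcmap.
Qed.

Lemma injres_compare X J (I : injres X) (f : cmap X J) :
  left_bounded J -> (forall i, injectiveM (J i)) -> quasi_iso f ->
  exists g : cmap J I, quasi_iso g.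
Proof.
move=> bJ iJ qf.
have [_ f2] := hom_pre_quasi_iso (@injres_bounded _ _ I) (@injres_injective _ _ I) qf 0.
have [g0 /cycle_cmap [g ->] [h dh]] := f2 (gcmap (injres_map I)) (gcmap_cycle _ _).
exists g; apply: (quasi_iso_cancel_r qf).
apply: (quasi_iso_homotopic _ (@injres_quasi_iso _ _ I)) => i x; apply: homotopic_homology.
by exists h; rewrite -gpre_gcmap.
Qed.

(** In degree [n + 1] the composite through [P'] is zero, so the homotopy gives
    [- y = d h y + h d y]. Applying [d] shows that [- d h] is the identity on boundaries in degree
    [n]. *)
Lemma split_top P P' (f : cmap P P') (g : cmap P' P) n :
  homotopic (ccomp g f) (Defs.cid P) -> (forall i, n < i -> zero_at P' i) ->
  exists r : {linear P n -> P n},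
    (forall x, boundaries (r x)) /\ (forall x, boundaries x -> r x = x).
Proof.
move=> /homotopicE [h hE] P'0.
exists (\- (cdiff P (n + 1) n \o ghom_lin h n (n + 1))); split=> [x|x [y <-]] /=.
  exact/boundariesN/boundary_intro.
have := hE (n + 1) n (n + 2) y erefl ltac:(lia).
rewrite /= (P'0 (n + 1) ltac:(lia) (f (n + 1) y)) linear0 sub0r.
move/(congr1 (cdiff P (n + 1) n)); rewrite linearN linearD diffK add0r => /eqP.
by rewrite eqr_oppLR => /eqP.
Qed.

(** Dually, [1 + h d] is a projection onto the cycles in degree [n], because the composite through
    [J'] vanishes in degree [n - 1]. *)
Lemma split_bottom J J' (f : cmap J J') (g : cmap J' J) n :
  homotopic (ccomp g f) (Defs.cid J) -> (forall i, i < n -> zero_at J' i) ->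
  exists r : {linear J n -> J n},
    (forall x, cycles (r x)) /\ (forall x, cycles x -> r x = x).
Proof.
move=> /homotopicE [h hE] J'0.
exists (idfun \+ (ghom_lin h (n - 1) n \o cdiff J n (n - 1))); split=> [x|x cx] /=; last first.
  by rewrite cx linear0 addr0.
rewrite /cycles /= linearD.
have := hE (n - 1) (n - 2) n (cdiff J n (n - 1) x) ltac:(lia) ltac:(lia).
rewrite /= (J'0 (n - 1) ltac:(lia) (f (n - 1) _)) linear0 sub0r diffK linear0 addr0 => <-.
by rewrite subrr.
Qed.

End Comparison.

(** * Hom complexes with an additional action *)

Section HomActions.
Variables (k : comPzRingType) (R S : alg k).

Definition bright_lin (M : bimod R S) s : {linear lmod M -> lmod M} :=
  mk_lin (@bleft_linear k S R (bswap M) s).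

Definition bleft_lin (M : bimod R S) r : {linear rmod M -> rmod M} :=
  mk_lin (@bleft_linear k R S M r).

Lemma brightr0 (M : bimod R S) s : bright M s 0 = 0.
Proof. exact: (linear0 (bright_lin M s)). Qed.

Lemma brightrB (M : bimod R S) s x y : bright M s (x - y) = bright M s x - bright M s y.
Proof. exact: (linearB (bright_lin M s)). Qed.

Lemma brightrZ (M : bimod R S) s a (x : lmod M) :
  bright M s (a *: x) = a *: (bright M s x : lmod M).
Proof. exact: (linearZ_LR (bright_lin M s)). Qed.

Lemma bdiff_right (X : bicpx R S) i j s (x y : X i) :
  bdiff X i j (bright (X i) s x + y) = bright (X j) s (bdiff X i j x) + bdiff X i j y.
Proof. exact: (bilin_r (bdiff_bilin X i j) s x y). Qed.

Lemma bdiff_leftZ (X : bicpx R S) i j r (x : X i) :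
  bdiff X i j (bleft (X i) r x) = bleft (X j) r (bdiff X i j x).
Proof. exact: (linearZ_LR (mk_lin (bilin_l (bdiff_bilin X i j))) r x). Qed.

Section TargetAction.
Variables (X : cpx R) (I : bicpx R S).

Section Degree.
Variable n : int.
Implicit Type f : ghom X (lcpx I) n.

Definition tact_lin f s p q : {linear X p -> lcpx I q} :=
  bright_lin (I q) s \o ghom_lin f p q.

Fact tact_linear f s p q : linear (fun x : X p => (bright (I q) s (f p q x) : lcpx I q)).
Proof. exact: (linearP (tact_lin f s p q)). Qed.

Fact tact_deg f s p q : q != p + n ->
  forall x : X p, (bright (I q) s (f p q x) : lcpx I q) = 0.
Proof. by move=> qp x; rewrite (hom_deg _ qp) brightr0. Qed.

Definition tact s f : ghom X (lcpx I) n := GHom (tact_linear f s) (@tact_deg f s).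

Fact tactA a b f : tact a (tact b f) = tact (a * b) f.
Proof. by apply: ghomP => p q x; rewrite /= lactA. Qed.

Fact tact1 : left_id 1 tact.
Proof. by move=> f; apply: ghomP => p q x; rewrite /= lact1. Qed.

Fact tactDr : right_distributive tact +%R.
Proof. by move=> a f g; apply: ghomP => p q x; rewrite /= lactDr. Qed.

Fact tactDl f : {morph tact^~ f : a b / a + b}.
Proof. by move=> a b; apply: ghomP => p q x; rewrite /= lactDl. Qed.

Definition homT_obj : lmodType S := mk_lmod (LAct tactA tact1 tactDr tactDl).

End Degree.

Fact homT_diff_linear i j : linear (dhom j : homT_obj i -> homT_obj j).
Proof.
move=> s f g; apply: ghomP => p q x; rewrite [LHS]/= [RHS]/= /dhom_fun.
case: ifP => _; last by rewrite brightr0 addr0.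
by rewrite /= bdiff_right scalerDr opprD addrACA brightrB brightrZ.
Qed.

Definition homT : cpx S :=
  @Cpx S homT_obj (fun i j => mk_lin (@homT_diff_linear i j))
    (@dhom_shape k R X (lcpx I)) (@dhomK k R X (lcpx I)).

End TargetAction.

(* T is opposite to R through the anti-isomorphism theta.  Taking T = R^op    *)
(* would not suffice: for R = B^op we need T = B, and the opposite of B^op is *)
(* not convertible to B.                                                      *)
Section SourceAction.
Variables (T : pzRingType) (theta : T -> R) (X : bicpx R S) (J : cpx S).
Hypotheses (thetaD : {morph theta : a b / a + b})
  (theta1 : theta 1 = 1) (thetaM : forall a b, theta (a * b) = theta b * theta a).

Section Degree.
Variable n : int.
Implicit Type f : ghom (rcpx X) J n.

Definition sact_lin f t p q : {linear rcpx X p -> J q} :=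
  ghom_lin f p q \o bleft_lin (X p) (theta t).

Fact sact_linear f t p q : linear (fun x : rcpx X p => f p q (bleft (X p) (theta t) x)).
Proof. exact: (linearP (sact_lin f t p q)). Qed.

Fact sact_deg f t p q : q != p + n ->
  forall x : rcpx X p, f p q (bleft (X p) (theta t) x) = 0.
Proof. by move=> qp x; rewrite (hom_deg _ qp). Qed.

Definition sact t f : ghom (rcpx X) J n := GHom (sact_linear f t) (@sact_deg f t).

Fact sactA a b f : sact a (sact b f) = sact (a * b) f.
Proof. by apply: ghomP => p q x; rewrite /= lactA thetaM. Qed.

Fact sact1 : left_id 1 sact.
Proof. by move=> f; apply: ghomP => p q x; rewrite /= theta1 lact1. Qed.

Fact sactDr : right_distributive sact +%R.
Proof. by move=> a f g; apply: ghomP. Qed.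

Fact sactDl f : {morph sact^~ f : a b / a + b}.
Proof. by move=> a b; apply: ghomP => p q x; rewrite /= thetaD lactDl linearD. Qed.

Definition homS_obj : lmodType T := mk_lmod (LAct sactA sact1 sactDr sactDl).

End Degree.

Fact homS_diff_linear i j : linear (dhom j : homS_obj i -> homS_obj j).
Proof.
move=> t f g; apply: ghomP => p q x; rewrite [LHS]/= [RHS]/= /dhom_fun.
case: ifP => _; last by rewrite addr0.
by rewrite /= bdiff_leftZ linearD scalerDr opprD addrACA.
Qed.

Definition homS : cpx T :=
  @Cpx T homS_obj (fun i j => mk_lin (@homS_diff_linear i j))
    (@dhom_shape k S (rcpx X) J) (@dhomK k S (rcpx X) J).

End SourceAction.

End HomActions.

(** * Injectivity of Hom modules *)

Section FiniteCombinations.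
Variables (R : pzRingType) (E : choiceType) (U : lmodType R).

(** A linear map from [U] to the free module on [E], given by coordinates. When [E = U] and
    [comb c id] is the identity, it is a dual basis. *)
Record coords := Coords {
  coord :> U -> E -> R;
  coord_linear : forall e a x y, coord (a *: x + y) e = a * coord x e + coord y e;
  coord_supp : U -> seq E;
  coord_uniq : forall x, uniq (coord_supp x);
  coord_out : forall x e, e \notin coord_supp x -> coord x e = 0
}.

Variable c : coords.

Definition comb (V : lmodType R) (v : E -> V) (x : U) : V :=
  \sum_(e <- coord_supp c x) c x e *: v e.

Lemma comb_widen (V : lmodType R) (v : E -> V) x (s : seq E) :
  uniq s -> {subset coord_supp c x <= s} ->
  comb v x = \sum_(e <- s) c x e *: v e.
Proof.
move=> us ss.
rewrite [RHS](bigID (mem (coord_supp c x))) /= [X in _ + X]big1 ?addr0; last first.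
  by move=> e /coord_out ->; rewrite scale0r.
rewrite -big_filter; apply: perm_big; apply: uniq_perm; rewrite ?coord_uniq ?filter_uniq //.
by move=> e; rewrite mem_filter; apply: esym; apply: andb_idr => /ss.
Qed.

Lemma comb_linear (V : lmodType R) (v : E -> V) : linear (comb v).
Proof.
move=> a x y.
pose s := undup (coord_supp c x ++ coord_supp c y ++ coord_supp c (a *: x + y)).
have us : uniq s by apply: undup_uniq.
rewrite !(comb_widen v us); try by move=> e es; rewrite mem_undup !mem_cat es ?orbT.
rewrite scaler_sumr -big_split; apply: eq_bigr => e _.
by rewrite coord_linear scalerDl scalerA.
Qed.

Definition comb_lin (V : lmodType R) (v : E -> V) : {linear U -> V} :=
  mk_lin (comb_linear v).

End FiniteCombinations.

Section FreeModule.
Variables (R : pzRingType) (E : choiceType).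

Let finsupp (w : E -> R^o) : Prop := exists s : seq E, forall e, e \notin s -> w e = 0.

Fact finsupp0 : finsupp 0. Proof. by exists [::]. Qed.

Fact finsuppP a w w' : finsupp w -> finsupp w' -> finsupp (a *: w + w').
Proof.
move=> [s sP] [t tP]; exists (s ++ t) => e.
rewrite mem_cat negb_or => /andP [es et].
by rewrite -[LHS]/(a * w e + w' e) sP // tP // mulr0 addr0.
Qed.

Definition free_mod : lmodType R := submod_of (Submod finsupp0 finsuppP).

Lemma free_coords : exists c : coords E free_mod, forall w e, c w e = val w e.
Proof.
have /choice [s sP] (w : free_mod) : exists s : seq E,
    uniq s /\ forall e, e \notin s -> (val w : E -> R^o) e = 0.
  have [s sP] := submod_valS w; exists (undup s); split; first exact: undup_uniq.
  by move=> e; rewrite mem_undup; apply: sP.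
have vL e a (w w' : free_mod) : val (a *: w + w') e = a * val w e + val w' e by [].
by exists (Coords vL (fun w => (sP w).1) (fun w => (sP w).2)).
Qed.

Fact delta_finsupp (e : E) : finsupp (fun x => (x == e)%:R).
Proof. by exists [:: e] => x; rewrite inE => /negPf ->. Qed.

Definition free_delta (e : E) : free_mod :=
  submod_in (S := Submod finsupp0 finsuppP) (delta_finsupp e).

Lemma comb_free_delta (c : coords E free_mod) (cE : forall w e, c w e = val w e)
  (V : lmodType R) (v : E -> V) e : comb c v (free_delta e) = v e.
Proof.
pose s := undup (e :: coord_supp c (free_delta e)).
rewrite (@comb_widen _ _ _ _ _ v _ s) ?undup_uniq //; last first.
  by move=> x xs; rewrite mem_undup inE xs orbT.
rewrite (bigD1_seq e) ?undup_uniq ?mem_undup ?inE ?eqxx //= cE /= eqxx scale1r.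
by rewrite big1 ?addr0 // => x /negPf xe; rewrite cE /= xe scale0r.
Qed.

End FreeModule.

(** The free module on the set [P] maps onto [P]; the coordinates of a section of this map form the
    dual basis. *)
Lemma projective_dual_basis (R : pzRingType) (P : lmodType R) :
  projectiveM P -> exists c : coords P P, forall x, comb c id x = x.
Proof.
move=> projP; have [c cE] := free_coords R P.
have [y|h hE] := projP _ _ (comb_lin c id) idfun.
  by exists (free_delta R y); rewrite /= comb_free_delta.
have cL e a x y : c (h (a *: x + y)) e = a * c (h x) e + c (h y) e.
  by rewrite linearP coord_linear.
by exists (Coords cL (fun x => coord_uniq c (h x)) (fun x => coord_out (x := h x))).
Qed.

(** * Baer's criterion *)

Section Baer.
Variables (T : pzRingType) (J : lmodType T).

Hypothesis ideal_ext : forall (L : submod T^o) (f : T -> J),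
  (forall t a b : T, L a -> L b -> f (t * a + b) = t *: f a + f b) ->
  exists j : J, forall a : T, L a -> f a = a *: j.

(** Zorn's lemma is applied to graphs of partial extensions inside [N * J], so that the union of a
    chain is directly an upper bound. *)
Lemma baer : injectiveM J.
Proof.
move=> M N g f injg.
pose lin (A : set (N * J)) := forall a u v, A u -> A v -> A (a *: u + v).
pose fn (A : set (N * J)) := forall y, A (0, y) -> y = 0.
pose good (A : set (N * J)) := [/\ lin A, fn A & forall m, A (g m, f m)].
pose P (A : set (N * J)) := A = set0 \/ good A.
have [|A [PA Amax]] := @Zorn_bigcup _ P.
  move=> F FP tot.
  have [F0|/existsNP [X /not_implyP [FX X0]]] := pselect (forall X, F X -> X = set0).
    left; apply/seteqP; split=> // u [X FX]; by rewrite (F0 X FX).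
  right; have {X FX X0} [X FX gX] : exists2 X, F X & good X.
    by exists X => //; have [] := FP X FX.
  have goodF Y u : F Y -> Y u -> good Y by move=> /FP [->|].
  split.
  - move=> a u v [Y FY Yu] [Z FZ Zv].
    have [YZ|ZY] := tot _ _ FY FZ.
      by exists Z => //; have [lZ _ _] := goodF _ _ FZ Zv; apply: lZ => //; apply: YZ.
    by exists Y => //; have [lY _ _] := goodF _ _ FY Yu; apply: lY => //; apply: ZY.
  - by move=> y [Y FY Yy]; have [_ fY _] := goodF _ _ FY Yy; apply: fY.
  - by move=> m; exists X => //; have [_ _] := gX; apply.
have gA : good A.
  have [A0|//] := PA; exfalso; pose B : set (N * J) := fun u => exists m, u = (g m, f m).
  apply: (Amax B).
    split; first by rewrite A0.
    by rewrite A0 => /(_ (g 0, f 0)) B0; apply: B0; exists 0.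
  right; split=> [a _ _ [m ->] [m' ->]|y [m [g0 ->]]|m]; last by exists m.
    by exists (a *: m + m'); rewrite !linearP.
  by rewrite (_ : m = 0) ?linear0 //; apply: injg; rewrite -g0 linear0.
have [lA fA bA] := gA.
have A0 : A (0, 0) by have := bA 0; rewrite !linear0.
have Aeq u y y' : A (u, y) -> A (u, y') -> y = y'.
  move=> Ay Ay'; apply/eqP; rewrite -subr_eq0; apply/eqP/fA.
  have := lA (-1) _ _ Ay' Ay; congr (A (_, _)); rewrite scaleN1r ?addNr //.
  by rewrite addrC.
(* If [x] were outside the domain of [A], the scalars [a] with [a *: x] in the domain would form a
   left ideal; the element [j] given by [ideal_ext] is a consistent value at [x] and yields the
   larger graph [B]. *)
have Aall x : exists y, A (x, y).
  apply: contrapT => nx.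
  have L0 : exists y, A ((0 : T) *: x, y) by exists 0; rewrite scale0r.
  have LP t a b : (exists y, A (a *: x, y)) -> (exists y, A (b *: x, y)) ->
      exists y, A ((t * a + b) *: x, y).
    move=> [y Ay] [z Az]; exists (t *: y + z).
    by rewrite scalerDl -scalerA; apply: (lA t _ _ Ay Az).
  pose L : submod T^o := @Submod _ T^o (fun a : T => exists y, A (a *: x, y)) L0 LP.
  have /choice [h hP] (a : T) : exists y : J, L a -> A (a *: x, y).
    by have [[y]|nL] := pselect (L a); [exists y|exists 0].
  have [|j jE] := ideal_ext (L := L) (f := h).
    move=> t a b La Lb; apply: Aeq (hP _ (LP t a b La Lb)) _.
    by rewrite scalerDl -scalerA; apply: (lA t _ _ (hP _ La) (hP _ Lb)).
  pose B : set (N * J) := fun u => exists v (a : T), A v /\ u = v + a *: (x, j).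
  apply: (Amax B).
    split; first by move=> u Au; exists u, 0; rewrite scale0r addr0.
    move=> BA; apply: nx; exists j; apply: BA; exists (0, 0), 1.
    by rewrite scale1r add0r.
  right; split.
  - move=> t _ _ [u [a [Au ->]]] [v [b [Av ->]]].
    exists (t *: u + v), (t * a + b); split; first exact: lA.
    by rewrite scalerDr scalerDl scalerA addrACA.
  - move=> y [[u v] [a [Auv [uE vE]]]].
    have Lu : A (a *: x, - v).
      have := lA (-1) _ _ Auv A0; congr (A (_, _)).
        by rewrite scaleN1r addr0; apply/eqP; rewrite eq_sym -addr_eq0 addrC -uE.
      by rewrite scaleN1r addr0.
    have La : L a by exists (- v).
    by rewrite vE -jE // -(Aeq _ _ _ Lu (hP _ La)) subrr.
  - by move=> m; exists (g m, f m), 0; rewrite scale0r addr0.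
have /choice [h hA] := Aall.
have hL : linear h by move=> a x y; apply: Aeq (hA _) (lA a _ _ (hA x) (hA y)).
by exists (mk_lin hL) => m; apply: Aeq (hA _) (bA m).
Qed.

End Baer.

Lemma comb_map (R : pzRingType) (E : choiceType) (U V W : lmodType R) (c : coords E U)
    (f : {linear V -> W}) (v : E -> V) x :
  f (comb c v x) = comb c (f \o v) x.
Proof. by rewrite /comb linear_sum; apply: eq_bigr => e _; rewrite linearZ_LR. Qed.

Lemma lact0l (R : pzRingType) (V : zmodType) (f : lact R V) v : f 0 v = 0.
Proof. by apply: (addrI (f 0 v)); rewrite -lactDl !addr0. Qed.

(** * Injectivity of Hom into a submodule and out of a quotient *)

Section TargetSubcomplex.
Variables (k : comPzRingType) (R S : alg k) (X : cpx R) (I : bicpx R S).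
Variable W : forall q, submod (lcpx I q).
Hypothesis WS : forall q s x, W q x -> W q (bright (I q) s x).
Hypothesis Wd : forall i j x, W i x -> W j (bdiff I i j x).

Section Degree.
Variable n : int.

Definition homT_in (f : homT X I n) : Prop :=
  forall p q x, W q ((f : ghom X (lcpx I) n) p q x).

Fact homT_in0 : homT_in 0. Proof. by move=> p q x; apply: submod0. Qed.

Fact homT_inP s f g : homT_in f -> homT_in g -> homT_in (s *: f + g).
Proof. by move=> Wf Wg p q x; apply: submodD (Wg p q x); apply: WS. Qed.

Definition homT_sub : submod (homT X I n) := Submod homT_in0 homT_inP.

(** A dual basis of [X p] determines a map by its values at the elements [e]. Each evaluation at [e]
    is an S-linear map into the injective module [I q], so it extends to [N]; the retraction moves
    the extension into [W], and the coordinates reassemble the map. *)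
Lemma homT_sub_injective :
  (forall p, projectiveM (X p)) -> (forall q, injectiveM (rcpx I q)) ->
  (forall q, exists r : {linear rcpx I q -> rcpx I q},
    (forall x, W q (r x)) /\ (forall x, W q x -> r x = x)) ->
  injectiveM (submod_of homT_sub).
Proof.
move=> projX injI retr M N g f injg.
pose c p := sval (cid (projective_dual_basis (projX p))).
have cE p x : comb (c p) id x = x := svalP (cid (projective_dual_basis (projX p))) x.
pose r q := sval (cid (retr q)).
have rW q x : W q (r q x) := (svalP (cid (retr q))).1 x.
have rE q x : W q x -> r q x = x := (svalP (cid (retr q))).2 x.
pose fv m : ghom X (lcpx I) n := val (f m).
have fvL p q (e : X p) : linear (fun m => (fv m p q e : rcpx I q)).
  by move=> s m m'; rewrite /fv linearP.
have extF p q e : exists F : {linear N -> rcpx I q}, forall m, F (g m) = fv m p q e.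
  have [F FE] := injI q _ _ g (mk_lin (fvL p q e)) injg.
  by exists F => m; rewrite FE.
pose F p q e := sval (cid (extF p q e)).
have FE p q e m : F p q e (g m) = fv m p q e := svalP (cid (extF p q e)) m.
pose v p q (y : N) (e : X p) : lcpx I q := r q (F p q e y).
pose h y p q (x : X p) : lcpx I q := if q == p + n then comb (c p) (v p q y) x else 0.
have hL y p q : linear (h y p q).
  by move=> a x x'; rewrite /h; case: ifP; rewrite ?comb_linear // scaler0 addr0.
have hD y p q : q != p + n -> forall x, h y p q x = 0.
  by move=> /negPf qp x; rewrite /h qp.
pose H y : homT X I n := GHom (hL y) (hD y).
have HW y : homT_in (H y).
  move=> p q x; rewrite /= /h; case: ifP => _; last exact: submod0.
  by apply: submod_sum => e; apply/submodZ/rW.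
have HL : linear (fun y => submod_in (S := homT_sub) (HW y)).
  move=> s y y'; apply: val_inj; apply: ghomP => p q x; rewrite /= /h.
  case: ifP => _; last by rewrite brightr0 addr0.
  apply: etrans (congr1 (+%R^~ _) (esym (comb_map (c p) (bright_lin (I q) s) _ _))).
  rewrite /comb -big_split; apply: eq_bigr => e _.
  by rewrite /= -scalerDr /v !linearP.
exists (mk_lin HL) => m; apply: val_inj; apply: ghom_eqP => p q qE x.
rewrite /= /h qE eqxx -[in RHS](cE p x).
rewrite -/(fv m) -[RHS]/(ghom_lin (fv m) p (p + n) _) comb_map; apply: eq_bigr => e _.
by rewrite /v FE rE //; apply: (submod_valS (f m)).
Qed.

End Degree.

Fact homT_sub_diff i j x : homT_sub i x -> homT_sub j (cdiff (homT X I) i j x).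
Proof.
move=> Wf p q y; rewrite /= /dhom_fun; case: ifP => _; last exact: submod0.
by apply: (submodB (S := W q)); [apply/Wd/Wf|apply/submodZ/Wf].
Qed.

End TargetSubcomplex.

Section SourceSubcomplex.
Variables (k : comPzRingType) (R S : alg k) (X : bicpx R S) (J : cpx S).
Variables (T : pzRingType) (theta : T -> R) (tau : R -> T).
Hypotheses (thetaD : {morph theta : a b / a + b})
  (theta1 : theta 1 = 1) (thetaM : forall a b, theta (a * b) = theta b * theta a).
Hypotheses (thetaK : cancel theta tau) (tauK : cancel tau theta).
Variable K : forall p, submod (rcpx X p).
Hypothesis KR : forall p r x, K p x -> K p (bleft (X p) r x).
Hypothesis Kd : forall i j x, K i x -> K j (bdiff X i j x).

Local Notation H := (homS X J thetaD theta1 thetaM).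

Section Degree.
Variable n : int.

Definition homS_kill (f : H n) : Prop :=
  forall p q x, K p x -> (f : ghom (rcpx X) J n) p q x = 0.

Fact homS_kill0 : homS_kill 0. Proof. by []. Qed.

Fact homS_killP t f g : homS_kill f -> homS_kill g -> homS_kill (t *: f + g).
Proof.
move=> f0 g0 p q x Kx.
by apply: etrans (congr2 +%R (f0 _ _ _ (KR _ Kx)) (g0 _ _ _ Kx)) _; rewrite addr0.
Qed.

Definition homS_sub : submod (H n) := Submod homS_kill0 homS_killP.

(** This is Hom_S(X / K, J), where [retr] makes X / K projective over R. In Baer's criterion for [f]
    on a left ideal L, the element sought has to send a sum of [theta a_i x_i] to the sum of
    [f(a_i)(x_i)] and to kill K. This is well defined by projectivity of X / K, and S-injectivity of
    [J] extends it to all of [X p]. *)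
Lemma homS_sub_injective :
  (forall p, projectiveM (lcpx X p)) -> (forall q, injectiveM (J q)) ->
  (forall p, exists r : {linear lcpx X p -> lcpx X p},
    (forall x, K p x -> r x = 0) /\ (forall x, K p (x - r x))) ->
  injectiveM (submod_of homS_sub).
Proof.
move=> projX injJ retr; apply: baer => L f fL.
pose c p := sval (cid (projective_dual_basis (projX p))).
have cE p x : comb (c p) id x = x := svalP (cid (projective_dual_basis (projX p))) x.
pose r p := sval (cid (retr p)).
have rK p x : K p x -> r p x = 0 := (svalP (cid (retr p))).1 x.
have rE p x : K p (x - r p x) := (svalP (cid (retr p))).2 x.
pose fv a : ghom (rcpx X) J n := val (f a).
have fv0 a p q x : K p x -> fv a p q x = 0 by apply: (submod_valS (f a)).
have fvD a b p q x : L a -> L b -> fv (a + b) p q x = fv a p q x + fv b p q x.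
  by move=> La Lb; rewrite /fv -[a]mul1r fL // scale1r mul1r.
have fvM t a p q x : L a -> fv (t * a) p q x = fv a p q (bleft (X p) (theta t) x).
  move=> La; have L0 := submod0 L.
  have f0 : f 0 = 0.
    by have := fL (-1) 0 0 L0 L0; rewrite mulr0 addr0 scaleN1r addNr.
  by rewrite /fv -[t * a]addr0 fL // f0 addr0.
have theta0 : theta 0 = 0 by apply: (addrI (theta 0)); rewrite -thetaD !addr0.
have fv_zero p q e : fv 0 p q e = 0.
  by rewrite -(mul0r 0) fvM; [rewrite theta0 lact0l linear0|apply: submod0].
have fv_sum (I : eqType) (l : seq I) (a : I -> T) p q e : (forall i, i \in l -> L (a i)) ->
    fv (\sum_(i <- l) a i) p q e = \sum_(i <- l) fv (a i) p q e.
  elim: l => [|i l IH] La; first by rewrite !big_nil fv_zero.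
  have Ll j : j \in l -> L (a j) by move=> jl; apply: La; rewrite inE jl orbT.
  rewrite !big_cons fvD ?IH //; first by apply: La; rewrite inE eqxx.
  rewrite big_seq; elim/big_rec: _ => [|j x /Ll Lj Lx]; first exact: submod0.
  exact: (submodD (S := L)).
(* Expanding the x_i in a dual basis e: if the sum of the a_i x_i is zero    *)
(* modulo K, then its coordinates are zero, and so is the sum of f(a_i)(x_i), *)
(* which is the sum of the values of f on these coordinates at the e.        *)
have key p q (l : seq (T * X p)) b : (forall t, t \in l -> L t.1) -> K p b ->
    \sum_(t <- l) bleft (X p) (theta t.1) t.2 + b = 0 ->
    \sum_(t <- l) fv t.1 p q t.2 = 0.
  move=> Ll Kb l0.
  pose s := undup (flatten [seq coord_supp (c p) (r p t.2) | t <- l]).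
  have fvE t : t \in l -> fv t.1 p q t.2 = \sum_(e <- s) fv (tau (c p (r p t.2) e) * t.1) p q e.
    move=> tl.
    have rx : r p t.2 = \sum_(e <- s) c p (r p t.2) e *: (e : lcpx X p).
      rewrite -{1}(cE p (r p t.2)); apply: comb_widen; first exact: undup_uniq.
      by move=> e et; rewrite mem_undup; apply/flatten_mapP; exists t.
    have fr : fv t.1 p q t.2 = fv t.1 p q (r p t.2).
      by apply/eqP; rewrite -subr_eq0 -linearB; apply/eqP/(fv0 _ _ _ _ (rE p t.2)).
    have {}rx : (r p t.2 : X p) = \sum_(e <- s) bleft (X p) (c p (r p t.2) e) e := rx.
    rewrite fr {1}rx; have fvS (F : X p -> X p) :
        fv t.1 p q (\sum_(e <- s) F e) = \sum_(e <- s) fv t.1 p q (F e).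
      by apply: (big_morph (fv t.1 p q)) => [x y|]; [exact: linearD|exact: linear0].
    rewrite fvS; apply: eq_bigr => e _; rewrite fvM ?tauK //; exact: Ll.
  rewrite big_seq_cond.
  rewrite (eq_bigr (fun t => \sum_(e <- s) fv (tau (c p (r p t.2) e) * t.1) p q e)); last first.
    by move=> t /andP [/fvE].
  rewrite -big_seq_cond exchange_big big1 // => e _; rewrite -fv_sum; last first.
    by move=> t /Ll Lt; apply: (submodZ (S := L) _ Lt).
  rewrite (_ : \sum_(t <- l) _ = 0) ?fv_zero //; apply: (can_inj thetaK).
  rewrite theta0 (big_morph theta thetaD theta0).
  have ceL : linear (fun x : lcpx X p => c p x e : R^o) by move=> a x y; rewrite [LHS]coord_linear.
  pose ce : {linear lcpx X p -> R^o} := mk_lin ceL.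
  have -> : \sum_(t <- l) theta (tau (c p (r p t.2) e) * t.1) =
      \sum_(t <- l) (ce \o r p) (theta t.1 *: (t.2 : lcpx X p)).
    by apply: eq_bigr => t _; rewrite thetaM tauK !linearZ_LR.
  rewrite -linear_sum; have -> : \sum_(t <- l) theta t.1 *: (t.2 : lcpx X p) = - b.
    by apply/eqP; rewrite -addr_eq0; apply/eqP.
  by rewrite linearN [_ b]/= rK // (linear0 ce : c p 0 e = 0) oppr0.
have ext p q : exists h : {linear rcpx X p -> J q},
    (forall a x, L a -> h (bleft (X p) (theta a) x) = fv a p q x) /\
    (forall x, K p x -> h x = 0).
  (* The graph of the map to be extended, defined on the submodule generated by the multiples
     [theta a x] with [a] in [L], together with [K p]. *)
  pose Gr (u : rcpx X p * J q) := exists (l : seq (T * X p)) (b : X p),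
    [/\ forall t, t \in l -> L t.1, K p b,
        u.1 = \sum_(t <- l) bleft (X p) (theta t.1) t.2 + b &
        u.2 = \sum_(t <- l) fv t.1 p q t.2].
  have Gr0 : Gr 0 by exists [::], 0; rewrite !big_nil addr0; split=> //; apply: submod0.
  have GrP a u v : Gr u -> Gr v -> Gr (a *: u + v).
    move=> [l [b [Ll Kb u1 u2]]] [l' [b' [Ll' Kb' v1 v2]]].
    exists ([seq (t.1, bright (X p) a t.2) | t <- l] ++ l'), (bright (X p) a b + b'); split.
    - move=> t; rewrite mem_cat => /orP [/mapP [t' /Ll + ->] //|]; exact: Ll'.
    - exact: (submodP a Kb Kb').
    - rewrite [LHS]/= u1 v1 big_cat big_map [RHS]addrACA; congr (_ + _).
      apply: etrans (lactDr (bright (X p)) a _ _) _; congr (_ + _).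
      rewrite (big_morph (bright (X p) a) (lactDr (bright (X p)) a) (brightr0 _ _)).
      by apply: eq_bigr => t _; rewrite -bcomm.
    - rewrite [LHS]/= u2 v2 big_cat big_map /= scaler_sumr; congr (_ + _).
      apply: eq_bigr => t _.
      exact: (esym (linearZ_LR (ghom_lin (fv t.1) p q) a (t.2 : rcpx X p))).
  pose U := submod_of (Submod Gr0 GrP).
  pose i := sub_incl (Submod Gr0 GrP).
  have [|h hE] := @injective_extend _ _ U _ (fst \o i) (snd \o i) (injJ q).
    move=> u /= u0; have [l [b [Ll Kb u1 u2]]] := submod_valS u.
    by rewrite u2; apply: key Kb _ => //; rewrite -u1.
  exists h; split=> [a x La|x Kx].
    have Gax : Gr (bleft (X p) (theta a) x, fv a p q x).
      exists [:: (a, x)], 0; rewrite !big_seq1 addr0; split=> //; last exact: submod0.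
      by move=> t; rewrite inE => /eqP ->.
    exact: (hE (submod_in (S := Submod Gr0 GrP) Gax)).
  have Gx : Gr (x, 0) by exists [::], x; rewrite !big_nil add0r; split.
  exact: (hE (submod_in (S := Submod Gr0 GrP) Gx)).
pose h p q := sval (cid (ext p q)).
have hE p q a x : L a -> h p q (bleft (X p) (theta a) x) = fv a p q x.
  exact: (svalP (cid (ext p q))).1.
have hK p q x : K p x -> h p q x = 0 := (svalP (cid (ext p q))).2 x.
pose z p q (x : rcpx X p) : J q := if q == p + n then h p q x else 0.
have zL p q : linear (@z p q).
  by move=> a x x'; rewrite /z; case: ifP; rewrite ?linearP // scaler0 addr0.
have zD p q : q != p + n -> forall x, @z p q x = 0.
  by move=> /negPf qp x; rewrite /z qp.
have zK : homS_kill (GHom zL zD).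
  by move=> p q x Kx; rewrite /= /z hK // if_same.
exists (submod_in (S := homS_sub) zK) => a La; apply: val_inj.
apply: ghom_eqP => p q qE x; rewrite /= /z qE eqxx hE //.
Qed.

End Degree.

Fact homS_sub_diff i j x : homS_sub i x -> homS_sub j (cdiff H i j x).
Proof.
move=> Wf p q y Ky; rewrite /= /dhom_fun; case: ifP => _ //.
by rewrite !Wf ?linear0 ?scaler0 ?subr0 //; apply: Kd.
Qed.

End SourceSubcomplex.

(** * Injective resolutions of the rings *)

Section StalkMaps.
Variables (T : pzRingType).

Section StalkQuasiIso.
Variables (M : lmodType T) (C : cpx T).

Lemma stalk_cycles (x : M) : cycles (x : stalk M 0).
Proof. by []. Qed.

Lemma stalk_boundaries i (x : stalk M i) : boundaries x -> x = 0.
Proof. by move=> [y <-]. Qed.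

Lemma stalk_obj0 i (x : stalk M i) : i != 0 -> x = 0.
Proof. by case: i x => [[|n]|n] x //= _; apply/rowP; case. Qed.

(** The right-hand side mentions cycles and boundaries but no scalars, so it transfers a
    quasi-isomorphism from the k-linear homothety to the same map over a ring acting on the Hom
    complex. *)
Lemma stalk_quasi_isoP (f : cmap (stalk M) C) : quasi_iso f <->
  [/\ forall i, i != 0 -> homology0 C i,
      forall x : M, boundaries (f 0 x) -> x = 0 &
      forall c : C 0, cycles c -> exists x : M, boundaries (c - f 0 x)].
Proof.
split=> [qf|[H0 inj surj] i].
  split=> [i i0 x cx|x bx|c cc].
  - have [_ /(_ x cx) [y _]] := qf i.
    by rewrite (stalk_obj0 y i0) linear0 subr0.
  - by have [q1 _] := qf 0; apply: stalk_boundaries (q1 x (stalk_cycles x) bx).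
  - by have [_ /(_ c cc) [x _ bx]] := qf 0; exists x.
have [i0|i0] := eqVneq i 0; last first.
  split=> [x _ _|y /(H0 i i0) by_]; first by rewrite (stalk_obj0 x i0); apply: boundaries0.
  by exists 0; [exact: cycles0|rewrite linear0 subr0].
subst i; split=> [x _ /inj ->|y /surj [x bx]]; first exact: boundaries0.
by exists x => //; apply: stalk_cycles.
Qed.

End StalkQuasiIso.

Variables (C : cpx T) (z : C 0) (cz : cycles z).

Definition stalk_fun i : stalk (T^o : lmodType T) i -> C i :=
  match i with
  | Posz 0 => fun t : T => t *: z
  | _ => fun _ => 0
  end.

Fact stalk_fun_linear i : linear (@stalk_fun i).
Proof.
case: i => [[|n]|n] a x y /=; rewrite ?scaler0 ?addr0 //.
by rewrite scalerDl scalerA.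
Qed.

Fact stalk_funD i j x :
  mk_lin (@stalk_fun_linear j) (cdiff (stalk (T^o : lmodType T)) i j x) =
  cdiff C i j (mk_lin (@stalk_fun_linear i) x).
Proof.
rewrite [LHS](linear0 (mk_lin (@stalk_fun_linear j))).
by case: i x => [[|n]|n] x /=; rewrite ?linear0 // linearZ_LR /= cycle_all ?scaler0.
Qed.

Definition stalk_map : cmap (stalk (T^o : lmodType T)) C := Cmap stalk_funD.

End StalkMaps.

(** * Passing to a quasi-isomorphic subcomplex *)

Section DeformationSubcomplex.
Variables (T : pzRingType) (C : cpx T) (V : forall i, submod (C i)).
Hypothesis Vd : forall i j x, V i x -> V j (cdiff C i j x).
(** Acyclicity of the quotient C / V, expressed without the quotient. *)
Hypothesis deform : forall n (g : C n),
  V (n - 1) (cdiff C n (n - 1) g) ->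
  exists u : C (n + 1), V n (g - cdiff C (n + 1) n u).

Lemma subcpx_quasi_iso : quasi_iso (subcpx_incl Vd).
Proof.
move=> i; split=> [x cx [y yE]|y cy].
  have [|u Vu] := deform (g := y); first by rewrite (addrK 1 i) yE; apply: submod_valS.
  exists (submod_in Vu); apply: val_inj.
  by rewrite /= linearB diffK subr0 yE.
have [|u Vu] := deform (g := y); first by rewrite cy; apply: submod0.
exists (submod_in Vu); first by apply: val_inj; rewrite /= linearB cy diffK subr0.
by rewrite /= subKr; exists u.
Qed.

Lemma stalk_map_deform (z : C 0) (cz : cycles z) : quasi_iso (stalk_map cz) ->
  exists (z' : subcpx Vd 0) (cz' : cycles z'), quasi_iso (stalk_map cz').
Proof.
move=> qz; have [|u Vu] := deform (g := z); first by rewrite cz; apply: submod0.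
have cz' : cycles (submod_in Vu : subcpx Vd 0).
  by apply: val_inj; rewrite /= linearB cz diffK subr0.
exists (submod_in Vu), cz'; apply: quasi_iso_cancel_l subcpx_quasi_iso _.
apply: quasi_iso_homotopic qz => -[[|n]|n] x _ /=; rewrite ?subrr; try exact: boundaries0.
by rewrite -scalerBr subKr -linearZ_LR; exists ((x : T) *: u).
Qed.

End DeformationSubcomplex.

Section SourceDeformation.
Variables (k : comPzRingType) (R S : alg k) (X : bicpx R S) (J : cpx S).
Variables (T : pzRingType) (theta : T -> R).
Hypotheses (thetaD : {morph theta : a b / a + b})
  (theta1 : theta 1 = 1) (thetaM : forall a b, theta (a * b) = theta b * theta a).
Variable K : forall p, submod (rcpx X p).
Hypothesis KR : forall p r x, K p x -> K p (bleft (X p) r x).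
Hypothesis Kd : forall i j (x : rcpx X i), K i x -> K j (cdiff (rcpx X) i j x).
Hypothesis K0 : forall i, homology0 (subcpx Kd) i.
Hypotheses (bJ : left_bounded J) (injJ : forall q, injectiveM (J q)).

Local Notation H := (homS X J thetaD theta1 thetaM).

(** The restriction of [g] to the acyclic complex K is a cycle, hence a boundary by [inj_lift] along
    the zero map of K, which is a quasi-isomorphism. A primitive extends from K to X degreewise by
    injectivity of J, and subtracting its differential makes [g] vanish on K. *)
Lemma homS_deform n (g : H n) :
  homS_sub J thetaD theta1 thetaM KR (n - 1) (cdiff H n (n - 1) g) ->
  exists u : H (n + 1), homS_sub J thetaD theta1 thetaM KR n (g - cdiff H (n + 1) n u).
Proof.
move=> dgK; pose i := subcpx_incl Kd.
pose gK : ghom (subcpx Kd) J n := gpre i g.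
have dgK0 : dhom (n - 1) gK = 0.
  rewrite /gK dhom_pre; apply: ghomP => p q x; exact/dgK/submod_valS.
pose z := zero_cmap (subcpx Kd) (subcpx Kd).
have qz : quasi_iso z.
  move=> p; split=> [x cx _|y cy]; first exact: K0.
  by exists 0; [exact: cycles0|rewrite subr0; exact: K0].
have z0 : dhom n (0 : ghom (subcpx Kd) J (n + 1)) = gpre z gK.
  apply: etrans (linear0 (cdiff (homC (subcpx Kd) J) (n + 1) n)) _.
  by apply: ghomP => p q x; rewrite /= linear0.
have [w [_ [dw _]]] := inj_lift erefl erefl bJ injJ qz dgK0 z0.
have ext p q : exists h : {linear rcpx X p -> J q}, forall x, h (i p x) = w p q x.
  by have [h hE] := @injJ q _ _ (i p) (ghom_lin w p q) val_inj; exists h.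
pose h p q := sval (cid (ext p q)).
have hE p q x : h p q (i p x) = w p q x := svalP (cid (ext p q)) x.
pose u p q (x : rcpx X p) : J q := if q == p + (n + 1) then h p q x else 0.
have uL p q : linear (@u p q).
  by move=> a x y; rewrite /u; case: ifP; rewrite ?linearP // scaler0 addr0.
have uD p q : q != p + (n + 1) -> forall x, @u p q x = 0.
  by move=> /negPf qp x; rewrite /u qp.
pose U : ghom (rcpx X) J (n + 1) := GHom uL uD.
have Uw : gpre i U = w.
  by apply: ghom_eqP => p q qE x; rewrite /= /u qE eqxx hE.
exists U => p q x Kx.
have := congr1 (fun h : ghom (subcpx Kd) J n => h p q (submod_in (S := K p) Kx)) dw.
by rewrite -Uw dhom_pre => dU; apply/eqP; rewrite subr_eq0; apply/eqP/esym.
Qed.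

End SourceDeformation.

Section TargetDeformation.
Variables (k : comPzRingType) (R S : alg k) (X : cpx R) (I : bicpx R S).
Variable W : forall q, submod (lcpx I q).
Hypothesis WS : forall q s x, W q x -> W q (bright (I q) s x).
Hypothesis Wd : forall i j (x : lcpx I i), W i x -> W j (cdiff (lcpx I) i j x).
Hypothesis qW : quasi_iso (subcpx_incl Wd).
Hypotheses (bX : right_bounded X) (projX : forall p, projectiveM (X p)).

(** The differential of [g] is a cycle [V] with values in W that bounds in I. Since the inclusion of
    W is a quasi-isomorphism, [proj_extend] gives [t] and a map [w] into W with [dhom t = w - g]. *)
Lemma homT_deform n (g : homT X I n) :
  homT_sub X WS (n - 1) (cdiff (homT X I) n (n - 1) g) ->
  exists u : homT X I (n + 1), homT_sub X WS n (g - cdiff (homT X I) (n + 1) n u).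
Proof.
move=> dgW; pose i := subcpx_incl Wd.
pose dg : ghom X (lcpx I) (n - 1) := dhom (n - 1) (g : ghom X (lcpx I) n).
pose v p q : {linear X p -> subcpx Wd q} := corestr (f := ghom_lin dg p q) (fun x => dgW p q x).
have vD p q : q != p + (n - 1) -> forall x, v p q x = 0.
  by move=> qp x; apply: val_inj; apply: (hom_deg dg qp).
pose V : ghom X (subcpx Wd) (n - 1) := GHom (fun p q => linearP (v p q)) vD.
have iV : gpost i V = dg by apply: ghomP.
have dV : dhom (n - 1 - 1) V = 0.
  apply: ghomP => p q x; apply: val_inj.
  have : gpost i (dhom (n - 1 - 1) V) = 0 by rewrite -dhom_post iV; exact: dhomK.
  by move/(congr1 (fun h : ghom _ _ _ => h p q x)).
have [N X0] := bX.
have [||||||w [t [_ _ _ dt]]] :=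
  @proj_extend k R X _ _ i N (n - 1) n (n + 1) V g 0 0 (esym (subrK 1 n)) erefl.
- by move=> p _; apply: projX.
- by move=> j _ i1 i2 i1E i2E a e; apply: quasi_iso_cone.
- exact: dV.
- by rewrite iV.
- by move=> p q x pN; rewrite (X0 p pN x) !linear0.
- by move=> p q x pN; rewrite (X0 p pN x) !linear0 addr0.
pose t' : homT X I (n + 1) := t; exists (- t'); rewrite linearN opprK => p q x.
have -> : g + cdiff (homT X I) (n + 1) n t' = (gpost i w : homT X I n).
  by rewrite [cdiff _ _ _ t']dt addrC; exact: subrK.
exact: submod_valS.
Qed.

End TargetDeformation.

Section Bicomplexes.
Variables (k : comPzRingType) (R S : alg k).

Definition rcmap (X Y : bicpx R S) (f : bicmap X Y) : cmap (rcpx X) (rcpx Y) :=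
  @Cmap S (rcpx X) (rcpx Y) (fun i => mk_lin (bilin_r (bicmap_bilin f i)))
    (@bicmapD k R S X Y f).

Lemma quasi_iso_rcmap (X Y : bicpx R S) (f : bicmap X Y) :
  quasi_iso (lcmap f) -> quasi_iso (rcmap f).
Proof. exact. Qed.

Lemma bicmap_left (X Y : bicpx R S) (f : bicmap X Y) i r x :
  f i (bleft (X i) r x) = bleft (Y i) r (f i x).
Proof. exact: (linearZ_LR (mk_lin (bilin_l (bicmap_bilin f i))) r x). Qed.

Lemma bicmap_right (X Y : bicpx R S) (f : bicmap X Y) i s x :
  f i (bright (X i) s x) = bright (Y i) s (f i x).
Proof. exact: (linearZ_LR (mk_lin (bilin_r (bicmap_bilin f i))) s x). Qed.

End Bicomplexes.

(** * Resolutions of the two rings by truncated Hom complexes *)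

Section SourceResolution.
Variables (k : comPzRingType) (R S : alg k) (D : bicpx R S).
Variables (T : pzRingType) (theta : T -> R) (tau : R -> T).
Hypotheses (thetaD : {morph theta : a b / a + b})
  (theta1 : theta 1 = 1) (thetaM : forall a b, theta (a * b) = theta b * theta a).
Hypotheses (thetaK : cancel theta tau) (tauK : cancel tau theta).
Hypothesis homothetyD : forall P : projres (rcpx D), quasi_iso (homothety P).
Variables (X : bicpx R S) (f : bicmap X D).
Hypotheses (qf : quasi_iso (lcmap f)) (bX : right_bounded (lcpx X))
  (projl : forall i, projectiveM (lmod (X i)))
  (projr : forall i, projectiveM (rmod (X i))).
Variables (P : projres (lcpx D)) (a : int).
Hypothesis Pa : forall i, a < i -> zero_at P i.
Variables (J : injres (rcpx D)) (b : int).
Hypothesis Jb : forall i, i < - b -> zero_at J i.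

Let Xl : projres (lcpx D) := Projres bX projl qf.
Let Xr : projres (rcpx D) := @Projres _ _ _ (rcmap f) bX projr (quasi_iso_rcmap qf).

Let H : cpx T := homS X J thetaD theta1 thetaM.
Let z : H 0 := gcmap (ccomp (injres_map J) (rcmap f)).

Let cz : cycles z. Proof. exact: gcmap_cycle. Qed.

Let quasi_iso_z : quasi_iso (stalk_map cz).
Proof.
have qh : quasi_iso (ccomp (hom_post Xr (injres_map J)) (homothety Xr)).
  apply: quasi_iso_comp (homothetyD Xr) _.
  exact: (@hom_post_quasi_iso k S (rcpx X) _ _ (injres_map J) bX projr (@injres_quasi_iso _ _ J)).
have /stalk_quasi_isoP [H0 inj surj] := qh.
have zE (r : R) : gpost (injres_map J) (homothety_hom Xr r) = tau r *: z.
  apply: ghom_eqP => p q; rewrite addr0 => qE x; subst q.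
  rewrite /= /homothety_fun !same_degree_id /= tauK.
  by rewrite bicmap_left.
apply/stalk_quasi_isoP; split.
- exact: H0.
- move=> t bt; rewrite -[t]thetaK [theta t](_ : _ = 0).
    by apply: (can_inj thetaK); rewrite tauK; apply: (addrI (theta 0)); rewrite -thetaD !addr0.
  by apply: inj; rewrite [X in boundaries X]zE thetaK.
- move=> c /surj [r br]; exists (tau r).
  by move: br; rewrite [X in _ - X]zE.
Qed.

(** The resolution is Hom_S(X / K, J), with X / K in degrees at most [a] and [J] in degrees at least
    [- b]. The complex [P] has no action of S and enters only through the splitting of X in degree
    [a]. *)
Lemma source_resolution :
  exists I : injres (stalk (T^o : lmodType T)), forall i, i < - (a + b) -> zero_at I i.
Proof.
have [phi qphi] := projres_compare Xl P.
have [psi [_ psiphi]] := proj_homotopy_inverse bX projl (projres_bounded P)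
  (@projres_projective _ _ P) qphi.
have [r [rB rE]] := split_top psiphi Pa.
(* X / K is the truncation of X at a: it is projective over R, since r splits *)
(* the boundaries off in degree a, and K is acyclic.                         *)
pose Kset p (x : rcpx X p) := (p < a -> x = 0) /\ (p = a -> boundaries x).
have Kset0 p : Kset p 0 by split=> // _; apply: boundaries0.
have KsetP p s x y : Kset p x -> Kset p y -> Kset p (s *: x + y).
  move=> [x0 xB] [y0 yB]; split=> pa; first by rewrite x0 // y0 // scaler0 addr0.
  by apply: boundaries_linear; [apply: xB|apply: yB].
pose K p := Submod (Kset0 p) (@KsetP p).
have KR p t x : K p x -> K p (bleft (X p) t x).
  move=> [x0 xB]; split=> pa; first by rewrite x0 // [LHS](brightr0 (bswap (X p)) t).
  exact: (@submodZ _ _ (boundaries_submod (lcpx X) p) t _ (xB pa)).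
have Kd i j (x : rcpx X i) : K i x -> K j (cdiff (rcpx X) i j x).
  move=> [x0 xB]; have [iE|ij] := eqVneq i (j + 1); last by rewrite diff_shape //; apply: submod0.
  split=> ja; last exact: boundary_intro.
  have [ia|ia|ia] := ltgtP i a; first by rewrite x0 // linear0.
    by move: ja ia; clear -iE; lia.
  by apply: cycle_all; apply: boundary_cycle; apply: xB.
have K0 i : homology0 (subcpx Kd) i.
  move=> x cx; have cvx : cycles (val x) := cmap_cycles (subcpx_incl Kd) cx.
  have [ia|ia] := ltP i a.
    have [x0 _] := submod_valS x.
    by rewrite (_ : x = 0); [apply: boundaries0|apply: val_inj; apply: x0].
  have [y yE] : boundaries (val x).
    have [_ xB] := submod_valS x; have [ai|ia'|ai] := ltgtP a i; last by apply: xB.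
      apply: (quasi_iso_acyclic i qphi).2 cvx => v _.
      by rewrite (Pa ai v); apply: boundaries0.
    by move: ia ia'; lia.
  have Ky : K (i + 1) y by split=> ?; lia.
  by exists (submod_in Ky); apply: val_inj.
have retr p : exists h : {linear lcpx X p -> lcpx X p},
    (forall x, K p x -> h x = 0) /\ (forall x, K p (x - h x)).
  have [pa|pa|pa] := ltgtP p a.
  - exists idfun; split=> [x [x0 _]|x /=]; first exact: x0.
    by rewrite subrr; exact: Kset0.
  - exists \0; split=> // x; split=> ?; move: pa; lia.
  - subst p; exists (idfun \- r); split=> [x [_ /(_ erefl) xB]|x] /=.
      by rewrite rE ?subrr.
    by rewrite subKr; split=> [|_]; [lia|exact: rB].
have injT n : injectiveM (submod_of (homS_sub J thetaD theta1 thetaM KR n)).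
  exact: (homS_sub_injective (tau := tau) thetaK tauK projl (@injres_injective _ _ J) retr).
have Hd : forall i j (h : H i), homS_sub J thetaD theta1 thetaM KR i h ->
    homS_sub J thetaD theta1 thetaM KR j (cdiff H i j h) by exact: homS_sub_diff Kd.
have [z' [cz' qz']] := @stalk_map_deform _ _ _ Hd
  (@homS_deform _ _ _ _ _ _ _ thetaD theta1 thetaM _ KR Kd K0
    (injres_bounded J) (@injres_injective _ _ J)) z cz quasi_iso_z.
have zero i (h : subcpx Hd i) :
    (forall p q, q = p + i -> p <= a -> zero_at (rcpx X) p \/ zero_at J q) -> h = 0.
  move=> XJ; apply: val_inj; apply: ghom_eqP => p q qE x.
  have [pa|ap] := leP p a; last by apply: (submod_valS h); split=> ?; lia.
  have [Xp|Jq] := XJ p q qE pa; last exact: Jq.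
  by rewrite (Xp x) !linear0.
have bT : left_bounded (subcpx Hd).
  have [s Xs] := bX; have [t Jt] := injres_bounded J.
  exists (t - s) => i ti h; apply: zero => p q qE _.
  by have [ps|sp] := ltP p s; [left; apply: Xs|right; apply: Jt; lia].
exists (Injres bT injT qz') => i iab h; apply: zero => p q qE pa.
by right; apply: Jb; lia.
Qed.

End SourceResolution.

Section HomUnit.
Variables (k : comPzRingType) (R S : alg k) (D : bicpx R S).
Hypothesis homothetyD : forall P : projres (rcpx (cswap D)), quasi_iso (homothety P).
Variables (X : bicpx R S) (f : bicmap D X) (qf : quasi_iso (lcmap f)).
Variable P : projres (lcpx D).

Definition homT_unit : homT P X 0 := gcmap (ccomp (lcmap f) (projres_map P)).

Lemma homT_unit_cycle : cycles homT_unit.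
Proof. exact: gcmap_cycle. Qed.

Lemma homT_unit_quasi_iso : quasi_iso (stalk_map homT_unit_cycle).
Proof.
pose P' : projres (rcpx (cswap D)) := P.
have qh : quasi_iso (ccomp (hom_post P (lcmap f)) (homothety P')).
  apply: quasi_iso_comp (homothetyD P') _.
  exact: (hom_post_quasi_iso (projres_bounded P) (@projres_projective _ _ P) qf).
have /stalk_quasi_isoP [H0 inj surj] := qh.
have zE (s : S) : gpost (lcmap f) (homothety_hom P' s) = s *: homT_unit.
  apply: ghom_eqP => p q; rewrite addr0 => qE x; subst q.
  rewrite /= /homothety_fun !same_degree_id /=.
  exact: bicmap_right.
apply/stalk_quasi_isoP; split.
- exact: H0.
- by move=> s bs; apply: inj; rewrite [X in boundaries X]zE.
- move=> c /surj [s bs]; exists s.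
  by move: bs; rewrite [X in _ - X]zE.
Qed.

End HomUnit.

Section TargetResolution.
Variables (k : comPzRingType) (R S : alg k) (D : bicpx R S).
Hypothesis homothetyD : forall P : projres (rcpx (cswap D)), quasi_iso (homothety P).
Variables (X : bicpx R S) (f : bicmap D X).
Hypotheses (qf : quasi_iso (lcmap f)) (bX : left_bounded (lcpx X))
  (injr : forall i, injectiveM (rmod (X i))).
Variables (P : projres (lcpx D)) (a : int).
Hypothesis Pa : forall i, a < i -> zero_at P i.
Variables (J : injres (rcpx D)) (b : int).
Hypothesis Jb : forall i, i < - b -> zero_at J i.

Let H : cpx S := homT P X.

(** The resolution is Hom_R(P, W), with S acting through the truncation W of X. Here [J], which has
    no action of R, enters only through the splitting of X in degree [- b]. *)
Lemma target_resolution :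
  exists I : injres (stalk (S^o : lmodType S)), forall i, i < - (a + b) -> zero_at I i.
Proof.
have bXr : left_bounded (rcpx X) := bX.
have [phi qphi] := injres_compare J bXr injr (quasi_iso_rcmap qf).
have [psi psiphi] := inj_homotopy_inverse bXr injr qphi.
have [r [rZ rE]] := split_bottom psiphi Jb.
(* The truncation of X at -b, injective over S by the splitting r. *)
pose Wset q (x : lcpx X q) := (q < - b -> x = 0) /\ (q = - b -> cycles x).
have Wset0 q : Wset q 0 by split=> // _; apply: cycles0.
have WsetP q s x y : Wset q x -> Wset q y -> Wset q (s *: x + y).
  move=> [x0 xZ] [y0 yZ]; split=> qb; first by rewrite x0 // y0 // scaler0 addr0.
  by apply: cycles_linear; [apply: xZ|apply: yZ].
pose W q := Submod (Wset0 q) (@WsetP q).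
have WS q s x : W q x -> W q (bright (X q) s x).
  move=> [x0 xZ]; split=> qb; first by rewrite x0 // brightr0.
  exact: (@submodZ _ _ (cycles_submod (rcpx X) q) s _ (xZ qb)).
have Wd i j (x : lcpx X i) : W i x -> W j (cdiff (lcpx X) i j x).
  move=> [x0 xZ]; have [iE|ij] := eqVneq i (j + 1); last by rewrite diff_shape //; apply: submod0.
  split=> jb; last exact: cycle_diff.
  have [ib|ib|ib] := ltgtP i (- b); first by rewrite x0 // linear0.
    by move: jb ib; clear -iE; lia.
  by apply: cycle_all; apply: xZ.
have qW : quasi_iso (subcpx_incl Wd).
  move=> i; split=> [x cx [y yE]|y cy].
    have [ib|bi] := ltP i (- b).
      have [x0 _] := submod_valS x.
      by rewrite (_ : x = 0); [apply: boundaries0|apply: val_inj; apply: x0].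
    have Wy : W (i + 1) y by split=> ?; lia.
    by exists (submod_in Wy); apply: val_inj.
  have [ib|bi] := ltP i (- b).
    exists 0; first exact: cycles0.
    rewrite subr0; apply: (quasi_iso_acyclic i qphi).2 cy => v _.
    by rewrite (Jb ib v); apply: boundaries0.
  have Wy : W i y by split=> [|_ //]; lia.
  exists (submod_in Wy); first exact: val_inj.
  by rewrite /= subrr; apply: boundaries0.
have retr q : exists h : {linear rcpx X q -> rcpx X q},
    (forall x, W q (h x)) /\ (forall x, W q x -> h x = x).
  have [qb|qb|qb] := ltgtP q (- b).
  - by exists \0; split=> [x|x [x0 _]] /=; [exact: Wset0|rewrite x0].
  - by exists idfun; split=> // x; split=> ?; move: qb; lia.
  - subst q; exists r; split=> [x|x [_ /(_ erefl) xZ]] /=; last exact: rE.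
    by split=> [|_]; [lia|exact: rZ].
have injT n := homT_sub_injective (WS := WS) (n := n) (@projres_projective _ _ P) injr retr.
have Hd : forall i j (h : H i), homT_sub P WS i h -> homT_sub P WS j (cdiff H i j h).
  exact: homT_sub_diff Wd.
have [z' [cz' qz']] := @stalk_map_deform _ _ _ Hd
  (@homT_deform _ _ _ _ _ _ WS Wd qW (projres_bounded P) (@projres_projective _ _ P))
  (homT_unit f P) (homT_unit_cycle f P) (homT_unit_quasi_iso homothetyD qf P).
have zero i (h : subcpx Hd i) :
    (forall p q, q = p + i -> - b <= q -> zero_at P p \/ zero_at (lcpx X) q) -> h = 0.
  move=> PX; apply: val_inj; apply: ghom_eqP => p q qE x.
  have [bq|qb] := leP (- b) q; last by have [h0 _] := submod_valS h p q x; apply: h0.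
  have [Pp|Xq] := PX p q qE bq; last exact: Xq.
  by rewrite (Pp x) !linear0.
have bT : left_bounded (subcpx Hd).
  have [s Ps] := projres_bounded P; have [t Xt] := bX.
  exists (t - s) => i ti h; apply: zero => p q qE _.
  by have [ps|sp] := ltP p s; [left; apply: Ps|right; apply: Xt; lia].
exists (Injres bT injT qz') => i iab h; apply: zero => p q qE bq.
by left; apply: Pa; lia.
Qed.

End TargetResolution.

(** * Homological dimensions *)

Section IntegerExtrema.
Local Open Scope classical_set_scope.
Local Open Scope ereal_scope.
Implicit Types (Z : set int) (A : set (\bar int)).

Lemma int_set_max Z m : Z m -> (exists n, forall i, Z i -> (i <= n)%R) ->
  exists2 c, Z c & forall i, Z i -> (i <= c)%R.
Proof.
move=> Zm [n Zn].
have ex : exists d : nat, `[< Z (n - d%:Z)%R >].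
  exists `|n - m|%N; apply/asboolP; have := Zn _ Zm => mn.
  by rewrite (_ : (n - `|n - m|%N%:Z)%R = m) //; lia.
exists (n - (ex_minn ex)%:Z)%R; first by case: ex_minnP => d /asboolP.
move=> i Zi; case: ex_minnP => d _ dmin.
have := dmin `|n - i|%N; have in_ := Zn _ Zi.
rewrite (_ : (n - `|n - i|%N%:Z)%R = i); last lia.
by move=> /(_ (introT (asboolP _) Zi)); lia.
Qed.

(** [supremum] is meaningful only when a least upper bound exists; it is the maximum of a bounded
    nonempty set of integers, and [+oo] for an unbounded one. *)
Lemma int_supremum_le Z a :
  supremum -oo [set i%:E | i in Z]%classic <= a%:E <-> forall i, Z i -> (i <= a)%R.
Proof.
have [Z0|/existsNP [m /contrapT Zm]] := pselect (forall i, ~ Z i).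
  split=> [_ i /Z0 //|_].
  rewrite (_ : [set _ | _ in _]%classic = set0) ?supremum0 ?leNye //.
  by apply/seteqP; split=> [e [i /Z0]|].
set B := [set _ | _ in _]%classic.
have B0 : B !=set0 by exists m%:E, m.
have supB : supremums B !=set0.
  have [bd|nbd] := pselect (exists n, forall i, Z i -> (i <= n)%R).
    have [c Zc cmax] := int_set_max Zm bd; exists c%:E; split.
      by move=> _ [i Zi <-]; rewrite lee_fin; apply: cmax.
    by move=> y; apply; exists c.
  exists +oo; split=> [x _|y yB]; first exact: leey.
  case: y yB => [n|_ //|] yB; exfalso.
    by apply: nbd; exists n => i Zi; have := yB i%:E; rewrite lee_fin; apply; exists i.
  by have := yB m%:E; rewrite leeNy_eq => /(_ (ex_intro2 _ _ m Zm erefl)).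
have [ub lub] : supremums B (supremum -oo B).
  by rewrite /supremum; case: ifPn => [/eqP B0'|_]; [move: B0; rewrite B0' => -[]|apply: xgetPex].
split=> [le i Zi|le]; last by apply: lub => _ [i Zi <-]; rewrite lee_fin; apply: le.
by rewrite -lee_fin; apply: le_trans le; apply: ub; exists i.
Qed.

Lemma int_infimums A : A !=set0 -> infimums A !=set0.
Proof.
move=> [e Ae]; have [Any|nAny] := pselect (A -oo).
  by exists -oo; split=> [x _|y]; [exact: leNye|apply].
have [Z0|/existsNP [m /contrapT Am]] := pselect (forall i : int, ~ A i%:E).
  by exists +oo; split=> [[i /Z0| |]|y _] //; exact: leey.
have [bd|nbd] := pselect (exists n, forall i, A i%:E -> (n <= i)%R).
  have [n nA] := bd; pose Z : set int := fun i => A (- i)%:E.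
  have Zm : Z (- m)%R by rewrite /Z opprK.
  have [|c Zc cmax] := int_set_max Zm.
    by exists (- n)%R => i /nA; rewrite lerNr.
  exists (- c)%:E; split=> [[i| |] Ai|y]; [|exact: leey|by []|by apply].
  by rewrite lee_fin lerNl; apply: cmax; rewrite /Z opprK.
exists -oo; split=> [x _|y yA]; first exact: leNye.
case: y yA => [n yA|yA|//]; last by have := yA m%:E Am; rewrite leye_eq.
by exfalso; apply: nbd; exists n => i /yA; rewrite lee_fin.
Qed.

(** Integers are discrete: if no element of [A] is at most [a], then [a + 1] is a lower bound. This
    is what makes dimensions attained by actual resolutions. *)
Lemma int_infimum_le A (a : int) : infimum +oo A <= a%:E <-> exists2 e, A e & e <= a%:E.
Proof.
have [A0|/set0P A0] := eqVneq A set0.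
  rewrite A0 /infimum eqxx; split=> [|[e []]]; by rewrite leye_eq.
have [lb glb] : infimums A (infimum +oo A).
  rewrite /infimum; case: ifPn => [/eqP A0'|_]; first by move: A0; rewrite A0' => -[].
  exact: xgetPex (int_infimums A0).
split=> [le|[e Ae]]; last exact/le_trans/lb.
apply: contrapT => nA; have : (a + 1)%R%:E <= infimum +oo A.
  apply: glb => -[i| |] Ai; [|exact: leey|].
    rewrite lee_fin; have [//|ia] := leP (a + 1)%R i.
    by exfalso; apply: nA; exists i%:E => //; rewrite lee_fin; lia.
  by exfalso; apply: nA; exists -oo => //; exact: leNye.
by move=> /le_trans /(_ le); rewrite lee_fin; lia.
Qed.

End IntegerExtrema.

Section Dimensions.
Variable R : pzRingType.
Implicit Type X : cpx R.

Lemma proj_dim_le X (a : int) : (proj_dim X <= a%:E)%E <->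
  exists P : projres X, forall i, a < i -> zero_at P i.
Proof.
rewrite /proj_dim int_infimum_le; split=> [[_ [P ->] /int_supremum_le Pa]|[P Pa]].
  by exists P => i ai; apply: contrapT => /Pa; lia.
eexists; first by exists P.
by apply/int_supremum_le => i nz; apply: contrapT => ia; apply: nz; apply: Pa; lia.
Qed.

Lemma inj_dim_le X (a : int) : (inj_dim X <= a%:E)%E <->
  exists I : injres X, forall i, i < - a -> zero_at I i.
Proof.
rewrite /inj_dim int_infimum_le.
have imE (Z : set int) :
    [set (- i)%:E%E | i in Z]%classic = [set i%:E%E | i in [set - i | i in Z]]%classic.
  by rewrite image_comp.
split=> [[_ [I ->]]|[I Ia]].
  rewrite imE => /int_supremum_le Ia; exists I => i ia; apply: contrapT => nz.
  by have := Ia (- i) (ex_intro2 _ _ i nz erefl); lia.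
eexists; first by exists I.
rewrite imE; apply/int_supremum_le => _ [i nz <-]; apply: contrapT => ia.
by apply: nz; apply: Ia; lia.
Qed.

End Dimensions.

(** * Finite free resolutions *)

Section NatComplex.
Variables (R : pzRingType) (V : nat -> lmodType R).
Variable del : forall n, {linear V n.+1 -> V n}.
Hypothesis delK : forall n x, del n (del n.+1 x) = 0.

Definition nat_obj (i : int) : lmodType R := if i is Posz n then V n else 'rV[R]_0.

Definition nat_diff_fun a b : {linear V a -> V b} :=
  match a with
  | 0%N => \0
  | n.+1 => if n =P b is ReflectT e then ecast m {linear V n.+1 -> V m} e (del n) else \0
  end.

Arguments nat_diff_fun : simpl never.

Lemma nat_diff_succ n : nat_diff_fun n.+1 n = del n.
Proof. by rewrite /nat_diff_fun; case: eqP => // e; rewrite (eq_axiomK e). Qed.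

Lemma nat_diff_eq0 a b x : a != b.+1 -> nat_diff_fun a b x = 0.
Proof. by rewrite /nat_diff_fun; case: a x => //= n x; case: eqP => // e /eqP []; rewrite e. Qed.

Definition nat_diff i j : {linear nat_obj i -> nat_obj j} :=
  match i, j with
  | Posz a, Posz b => nat_diff_fun a b
  | _, _ => \0
  end.

Fact nat_diff_shape i j : i != j + 1 -> forall x, nat_diff i j x = 0.
Proof.
case: i j => [a|a] [b|b] //= ij x; apply: nat_diff_eq0.
by apply: contra_neq ij => ->; rewrite -addn1.
Qed.

Fact nat_diffK i j l x : nat_diff j l (nat_diff i j x) = 0.
Proof.
case: i j l x => [a|a] [b|b] [c|c] x //=; rewrite ?linear0 //.
have [aE|ab] := eqVneq a b.+1; last by rewrite (nat_diff_eq0 _ ab) linear0.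
have [bE|bc] := eqVneq b c.+1; last by rewrite (nat_diff_eq0 _ bc).
by subst a b; rewrite !nat_diff_succ delK.
Qed.

Definition nat_cpx : cpx R := Cpx nat_diff_shape nat_diffK.

Variables (Y : cpx R) (phi : forall n : nat, {linear V n -> Y n}).
Hypothesis phiD : forall (n : nat) x, cdiff Y n.+1 n (phi n.+1 x) = phi n (del n x).
Hypothesis phi0 : forall x, cycles (phi 0 x).

Definition nat_cmap_fun i : {linear nat_cpx i -> Y i} :=
  match i with
  | Posz n => phi n
  | Negz _ => \0
  end.

Fact nat_cmapD i j x : nat_cmap_fun j (cdiff nat_cpx i j x) = cdiff Y i j (nat_cmap_fun i x).
Proof.
have [iE|ij] := eqVneq i (j + 1); last by rewrite !diff_shape ?linear0.
case: i j iE x => [a|a] [b|b] iE x /=; rewrite ?linear0 //.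
  have aE : a = b.+1 by move: iE; lia.
  by subst a; rewrite nat_diff_succ phiD.
have aE : a = 0%N by move: iE; lia.
by subst a; rewrite (cycle_all (phi0 x)).
Qed.

Definition nat_cmap : cmap nat_cpx Y := Cmap nat_cmapD.

Lemma nat_cmap_quasi_iso :
  (forall i, i < 0 -> homology0 Y i) ->
  (forall y : Y 0, cycles y -> exists x, boundaries (y - phi 0 x)) ->
  (forall (n : nat) (y : Y n.+1), cycles y ->
    exists2 x, del n x = 0 & boundaries (y - phi n.+1 x)) ->
  (forall x, boundaries (phi 0 x) -> exists x', del 0 x' = x) ->
  (forall n x, del n x = 0 -> boundaries (phi n.+1 x) -> exists x', del n.+1 x' = x) ->
  quasi_iso nat_cmap.
Proof.
move=> Yneg surj0 surjS inj0 injS.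
have bdry n (x : V n) x' : del n x' = x -> boundaries (x : nat_cpx n).
  move=> xE; have <- : cdiff nat_cpx n.+1 n x' = x by rewrite [LHS]/= nat_diff_succ.
  by apply: boundary_intro; lia.
have cyc n (x : V n.+1) : cycles (x : nat_cpx n.+1) <-> del n x = 0.
  split=> [cx|dx]; first by have := cycle_all cx n; rewrite /= nat_diff_succ.
  apply: (@cycles_intro _ nat_cpx n.+1 n); first lia.
  by rewrite /= nat_diff_succ.
move=> [[|n]|n]; split=> [x cx bx|y cy].
- by have [x' x'E] := inj0 x bx; apply: bdry x'E.
- by have [x bx] := surj0 y cy; exists x.
- by have [x' x'E] := injS n x ((cyc n x).1 cx) bx; apply: bdry x'E.
- by have [x dx bx] := surjS n y cy; exists x => //; apply/cyc.
- by rewrite (_ : x = 0); [exact: boundaries0|apply/rowP; case].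
- by exists 0; [exact: cycles0|rewrite [nat_cmap _ 0]linear0 subr0; exact: Yneg].
Qed.

End NatComplex.

Arguments nat_diff_fun : simpl never.

Section FiniteGeneration.
Variable R : pzRingType.

Definition fin_gen_submod (V : lmodType R) (N : submod V) : Prop :=
  exists (n : nat) (g : 'I_n -> V), (forall i, N (g i)) /\
    forall x, N x -> exists c : 'I_n -> R, x = \sum_i c i *: g i.

Definition cat_fun (T : Type) m n (f : 'I_m -> T) (g : 'I_n -> T) (i : 'I_(m + n)) : T :=
  match fintype.split i with inl j => f j | inr j => g j end.

Lemma cat_fun_lshift T m n (f : 'I_m -> T) (g : 'I_n -> T) i : cat_fun f g (lshift n i) = f i.
Proof. by rewrite /cat_fun (unsplitK (inl i)). Qed.

Lemma cat_fun_rshift T m n (f : 'I_m -> T) (g : 'I_n -> T) i : cat_fun f g (rshift m i) = g i.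
Proof. by rewrite /cat_fun (unsplitK (inr i)). Qed.

Lemma sum_cat_fun (V : lmodType R) m n (c : 'I_m -> R) (d : 'I_n -> R)
    (f : 'I_m -> V) (g : 'I_n -> V) :
  \sum_i cat_fun c d i *: cat_fun f g i = \sum_i c i *: f i + \sum_i d i *: g i.
Proof.
by rewrite big_split_ord; congr (_ + _); apply: eq_bigr => i _;
  rewrite ?cat_fun_lshift ?cat_fun_rshift.
Qed.

Fact row_comb_linear (V : lmodType R) n (v : 'I_n -> V) :
  linear (fun x : 'rV[R]_n => \sum_i x 0 i *: v i).
Proof.
move=> a x y; rewrite scaler_sumr -big_split; apply: eq_bigr => i _.
by rewrite !mxE scalerDl scalerA.
Qed.

Definition row_comb (V : lmodType R) n (v : 'I_n -> V) : {linear 'rV[R]_n -> V} :=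
  mk_lin (row_comb_linear v).

Hypothesis noethR : left_noetherian R.

(** Induction on the rank: the first coordinates of elements of [N] form a left ideal, and the
    elements with first coordinate zero form a submodule of smaller rank. *)
Lemma noetherian_row r (N : submod 'rV[R]_r) : fin_gen_submod N.
Proof.
elim: r N => [|r IH] N.
  exists 0%N, (fun _ => 0); split=> [[]//|x _]; exists (fun _ => 0).
  by apply/rowP; case.
change (submod 'rV[R]_(1 + r)) in N.
pose I : set R := fun a => exists2 x, N x & x 0 0 = a.
have idI : left_ideal I.
  split=> [|a b [x Nx xa] [y Ny yb]|a b [x Nx xb]].
  - by exists 0; [exact: submod0|rewrite mxE].
  - by exists (x + y); [exact: submodD|rewrite mxE xa yb].
  - by exists (a *: x); [exact: submodZ|rewrite mxE xb].
have [n [g [Ig gI]]] := noethR idI.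
have /choice [x xP] i : exists x, N x /\ x 0 0 = g i by have [x] := Ig i; exists x.
have embL : linear (fun y : 'rV[R]_r => row_mx (0 : 'rV[R]_1) y).
  by move=> a y y'; rewrite scale_row_mx scaler0 add_row_mx addr0.
pose emb : {linear 'rV[R]_r -> 'rV[R]_(1 + r)} := mk_lin embL.
have N'P a y y' : N (emb y) -> N (emb y') -> N (emb (a *: y + y')).
  by move=> Ny Ny'; rewrite linearP; apply: submodP.
have N'0 : N (emb 0) by rewrite linear0; apply: submod0.
have [n' [g' [Ng' g'N]]] := IH (@Submod _ _ (fun y => N (emb y)) N'0 N'P).
exists (n + n')%N, (cat_fun x (emb \o g')); split=> [i|y0 Ny].
  by rewrite /cat_fun; case: fintype.split => j; [case: (xP j)|exact: Ng'].
have [y yE] : exists y : 'rV[R]_(1 + r), y = y0 by exists y0.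
subst y0.
have [c cE] : exists c : 'I_n -> R, y 0 0 = \sum_i c i * g i by apply: gI; exists y.
pose w : 'rV[R]_(1 + r) := y - \sum_i c i *: x i.
have wE : w = emb (rsubmx w).
  rewrite /= -[LHS]hsubmxK; congr row_mx; apply/rowP => i; rewrite ord1 !mxE.
  rewrite (_ : lshift r 0 = 0) ?cE; last exact: val_inj.
  rewrite summxE -sumrB big1 // => j _.
  by rewrite mxE (proj2 (xP j)) subrr.
have Nw : N (emb (rsubmx w)).
  rewrite -wE; apply: submodB => //; apply: submod_sum => i; apply: submodZ.
  by case: (xP i).
have [d dE] := g'N _ Nw; exists (cat_fun c d); rewrite sum_cat_fun.
rewrite -[LHS](subrK (\sum_i c i *: x i)) addrC; congr (_ + _).
rewrite -/w wE dE linear_sum; apply: eq_bigr => i _; exact: (linearZ_LR emb).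
Qed.

End FiniteGeneration.

Section FiniteFreeResolution.
Variables (R : pzRingType) (X : cpx R).
Hypotheses (noethR : left_noetherian R) (fgX : forall i, homology_fin_gen X i).
Hypothesis X0 : forall i, i <= 0 -> homology0 X i.

(** One degree of the resolution under construction. [stage_cycles] stands for the kernel of the
    differential out of the free module, and it already maps onto the homology of [X] in degree
    [n]. *)
Record stage (n : nat) := Stage {
  stage_rank : nat;
  stage_map : {linear 'rV[R]_stage_rank -> X n};
  stage_cycles : submod 'rV[R]_stage_rank;
  stage_sub : forall x, stage_cycles x -> cycles (stage_map x);
  stage_onto : forall y : X n, cycles y ->
    exists2 x, stage_cycles x & boundaries (y - stage_map x)
}.

(** The next free module has two kinds of generators: those with differential [l j], which kill the
    cycles that become boundaries in X, and those with differential zero, which generate the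
    homology in degree [n + 1]. *)
Lemma next_stage n (s : stage n) :
  exists (t : stage n.+1) (del : {linear 'rV[R]_(stage_rank t) -> 'rV[R]_(stage_rank s)}),
    [/\ forall x, cdiff X n.+1 n (stage_map t x) = stage_map s (del x),
        forall x, stage_cycles s (del x),
        forall x, stage_cycles t x <-> del x = 0 &
        forall x, stage_cycles s x -> boundaries (stage_map s x) -> exists x', del x' = x].
Proof.
pose Nset x := stage_cycles s x /\ boundaries (stage_map s x).
have Nset0 : Nset 0 by split; [exact: submod0|rewrite linear0; exact: boundaries0].
have NsetP a x y : Nset x -> Nset y -> Nset (a *: x + y).
  move=> [xc xb] [yc yb]; split; first exact: submodP.
  by rewrite linearP; apply: boundaries_linear.
have [c [l [Nl lN]]] := noetherian_row noethR (Submod Nset0 NsetP).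
have [d [g [cg gH]]] := fgX n.+1.
have SE : (n.+1 : int) = n%:Z + 1 by lia.
have /choice [y yE] j : exists y : X n.+1, cdiff X n.+1 n y = stage_map s (l j).
  have [_ [y yE]] := Nl j; move: y yE; rewrite -SE => y yE; by exists y.
pose r := (c + d)%N.
pose phi : {linear 'rV[R]_r -> X n.+1} := row_comb (cat_fun y g).
pose del : {linear 'rV[R]_r -> 'rV[R]_(stage_rank s)} := row_comb (cat_fun l (fun=> 0)).
have phiD x : cdiff X n.+1 n (phi x) = stage_map s (del x).
  rewrite /= !linear_sum; apply: eq_bigr => i _; rewrite !linearZ_LR; congr (_ *: _).
  rewrite /cat_fun; case: fintype.split => j; first exact: yE.
  by rewrite linear0 (cycle_all (cg j)).
have cyc x : del x = 0 -> cycles (phi x).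
  by move=> dx; apply: (cycles_intro SE); rewrite phiD dx linear0.
have onto z : cycles z -> exists2 x, del x = 0 & boundaries (z - phi x).
  move=> /gH [e eb]; exists (\row_i cat_fun (fun=> 0) e i).
    rewrite /=; apply: etrans (eq_bigr _ (fun i _ => congr1 (fun t => t *: _) (mxE _ _ _ _))) _.
    rewrite sum_cat_fun !big1 ?addr0 // => i _; first by rewrite scaler0.
    by rewrite scale0r.
  move: eb; congr (boundaries (_ - _)); apply/esym; rewrite /=.
  apply: etrans (eq_bigr _ (fun i _ => congr1 (fun t => t *: _) (mxE _ _ _ _))) _.
  by rewrite sum_cat_fun big1 ?add0r // => i _; rewrite scale0r.
exists (@Stage _ _ phi (ker_submod del) cyc onto), del; split=> //.
- move=> x; apply: submod_sum => i; apply: submodZ; rewrite /cat_fun.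
  by case: fintype.split => j; [case: (Nl j)|exact: submod0].
- move=> x xc xb; have [e eE] := lN x (conj xc xb).
  exists (\row_i cat_fun e (fun=> 0) i); rewrite eE /=.
  apply: etrans (eq_bigr _ (fun i _ => congr1 (fun t => t *: _) (mxE _ _ _ _))) _.
  by rewrite sum_cat_fun [X in _ + X]big1 ?addr0 // => i _; rewrite scale0r.
Qed.

Lemma row_projective n : projectiveM 'rV[R]_n.
Proof.
move=> M N g f gs.
have /choice [y yE] (i : 'I_n) : exists y, g y = f (delta_mx 0 i) := gs _.
exists (row_comb y) => x; rewrite [in RHS](row_sum_delta x) /= !linear_sum.
by apply: eq_bigr => i _; rewrite !linearZ_LR yE.
Qed.

Definition finite_free (V : lmodType R) : Prop :=
  exists (n : nat) (e : {linear 'rV[R]_n -> V}) (c : {linear V -> 'rV[R]_n}),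
    cancel e c /\ cancel c e.

Lemma finite_free_row n : finite_free 'rV[R]_n.
Proof. by exists n, idfun, idfun. Qed.

(** The construction starts with the zero module in degree 0, so the homology has to vanish there
    too; the general case follows by a shift. *)
Lemma finite_free_resolution_pos : exists P : projres X, forall i, finite_free (P i).
Proof.
have onto0 (y : X 0%N) : cycles y ->
    exists2 x : 'rV[R]_0, True & boundaries (y - (\0 : {linear 'rV[R]_0 -> X 0%N}) x).
  by move=> cy; exists 0 => //; rewrite subr0; apply: X0.
pose full : submod 'rV[R]_0 := @Submod _ _ (fun=> True) I (fun _ _ _ _ _ => I).
pose s0 : stage 0 := @Stage 0 0 \0 full (fun _ _ => cycles0 _ _) onto0.
pose nxt n (s : stage n) := sval (cid (next_stage s)).
pose st := fix st n : stage n := if n is m.+1 then nxt m (st m) else s0.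
pose del n : {linear 'rV[R]_(stage_rank (st n.+1)) -> 'rV[R]_(stage_rank (st n))} :=
  sval (cid (svalP (cid (next_stage (st n))))).
have nxtP n := svalP (cid (svalP (cid (next_stage (st n))))).
have delK n x : del n (del n.+1 x) = 0.
  by have [_ _ c1 _] := nxtP n; apply/c1; have [_ c2 _ _] := nxtP n.+1; apply: c2.
pose phi n := stage_map (st n).
have phiD (n : nat) x : cdiff X n.+1 n (phi n.+1 x) = phi n (del n x) by have [] := nxtP n.
have phi0 x : cycles (phi 0%N x) by apply: (stage_sub (s := st 0%N)).
have qphi : quasi_iso (nat_cmap delK phiD phi0).
  apply: nat_cmap_quasi_iso.
  - by move=> i i0; apply: X0; lia.
  - by move=> y /(stage_onto (st 0%N)) [x _ bx]; exists x.
  - move=> n y /(stage_onto (st n.+1)) [x cx bx]; exists x => //.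
    by have [_ _ c1 _] := nxtP n; apply/c1.
  - by move=> x _; exists 0; apply/rowP; case.
  - move=> n x dx bx; have [_ _ _ ex] := nxtP n.+1; apply: ex bx.
    by have [_ _ c1 _] := nxtP n; apply/c1.
have bP : right_bounded (nat_cpx delK).
  by exists 0 => -[//|n] _ x; apply/rowP; case.
have pP i : projectiveM (nat_cpx delK i) by case: i => n; apply: row_projective.
exists (Projres bP pP qphi) => i /=.
by case: i => n; apply: finite_free_row.
Qed.

End FiniteFreeResolution.

Lemma boundary_elim (R : pzRingType) (X : cpx R) i j (x : X i) :
  j = i + 1 -> boundaries x -> exists y : X j, cdiff X j i y = x.
Proof. by move=> jE; subst j. Qed.

Section Shift.
Variables (R : pzRingType) (X : cpx R) (s : int).

Fact shift_shape i j : i != j + 1 -> forall x : X (i + s), cdiff X (i + s) (j + s) x = 0.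
Proof. by move=> ij; apply: diff_shape; apply: contra_neq ij; lia. Qed.

(** A mere relabelling of degrees, without the customary sign on the differential. *)
Definition shift_cpx : cpx R :=
  Cpx shift_shape (fun i j l => @diffK R X (i + s) (j + s) (l + s)).

Lemma shift_cycles i (x : X (i + s)) : cycles (x : shift_cpx i) <-> cycles x.
Proof.
split=> [cx|cx]; last exact: cycle_all cx _.
by apply: (@cycles_intro _ X _ (i - 1 + s)) cx; lia.
Qed.

Lemma shift_boundaries i (x : X (i + s)) : boundaries (x : shift_cpx i) <-> boundaries x.
Proof.
split=> [[y <-]|]; first by apply: boundary_intro; lia.
by apply: (@boundary_elim _ X _ (i + 1 + s)); lia.
Qed.

Lemma shift_homology0 i : homology0 X (i + s) -> homology0 shift_cpx i.
Proof. by move=> X0 x /shift_cycles /X0 /shift_boundaries. Qed.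

Lemma shift_homology_fin_gen i :
  homology_fin_gen X (i + s) -> homology_fin_gen shift_cpx i.
Proof.
move=> [n [g [cg gX]]]; exists n, g; split=> [m|x /shift_cycles /gX [c cE]].
  exact/shift_cycles/cg.
by exists c; apply/shift_boundaries.
Qed.

End Shift.

Section Unshift.
Variables (R : pzRingType) (X : cpx R) (s : int).

Lemma same_degree_cdiff p q p' q' (x : X p) : p = p' -> q = q' ->
  cdiff X p' q' (same_degree p' x) = same_degree q' (cdiff X p q x).
Proof. by move=> pE qE; subst p' q'; rewrite !same_degree_id. Qed.

Lemma same_degreeK p q (x : X p) : p = q -> same_degree p (same_degree q x) = x.
Proof. by move=> pE; subst q; rewrite !same_degree_id. Qed.

Lemma same_degree_cycles p q (x : X p) : p = q -> cycles (same_degree q x) <-> cycles x.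
Proof. by move=> pE; subst q; rewrite same_degree_id. Qed.

Lemma same_degree_boundaries p q (x : X p) : p = q ->
  boundaries (same_degree q x) <-> boundaries x.
Proof. by move=> pE; subst q; rewrite same_degree_id. Qed.

Variable P : projres (shift_cpx X s).

Definition unshift_fun i : {linear shift_cpx P (- s) i -> X i} :=
  mk_lin (@same_degree_linear R X (i - s + s) i) \o projres_map P (i - s).

Fact unshiftD i j x :
  unshift_fun j (cdiff (shift_cpx P (- s)) i j x) = cdiff X i j (unshift_fun i x).
Proof.
rewrite /= cmapD; apply: esym.
by apply: (@same_degree_cdiff (i - s + s) (j - s + s)); rewrite subrK.
Qed.

Lemma projres_unshift : exists Q : projres X, forall i, (Q i : lmodType R) = P (i - s).
Proof.
have bQ : right_bounded (shift_cpx P (- s)).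
  by have [n Pn] := projres_bounded P; exists (n + s) => i iN; apply: Pn; lia.
have pQ i : projectiveM (shift_cpx P (- s) i) by apply: projres_projective.
have qQ : quasi_iso (Cmap unshiftD).
  move=> i; have [p1 p2] := @projres_quasi_iso _ _ P (i - s); split=> [x cx bx|y cy].
    apply/shift_boundaries/p1; first exact/shift_cycles.
    by apply/shift_boundaries; move: bx => /same_degree_boundaries; apply; rewrite subrK.
  have [|x cx bx] := p2 (same_degree (i - s + s) y).
    by apply/shift_cycles/same_degree_cycles; rewrite ?subrK.
  exists x; first exact/shift_cycles.
  apply/(@same_degree_boundaries _ (i - s + s)); first by rewrite subrK.
  move: bx => /shift_boundaries; congr (boundaries _).
  rewrite linearB /=; congr (_ - _).
  by rewrite same_degreeK ?subrK.
by exists (Projres bQ pQ qQ).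
Qed.

End Unshift.

(** * Finiteness of the projective dimension *)

Lemma finite_free_resolution (R : pzRingType) (X : cpx R) :
  left_noetherian R -> hbounded X -> (forall i, homology_fin_gen X i) ->
  exists P : projres X, forall i, finite_free (P i).
Proof.
move=> noethR [n X0] fgX; pose s := - n - 1.
have [||P fP] := @finite_free_resolution_pos R (shift_cpx X s) noethR.
- by move=> i; apply/shift_homology_fin_gen/fgX.
- by move=> i i0; apply/shift_homology0/X0; rewrite /s; lia.
by have [Q QE] := projres_unshift P; exists Q => i; rewrite QE.
Qed.

Section Extension.
Variables (k : comPzRingType) (A : alg k).
Implicit Types (L X : cpx A) (N V : lmodType A).

(* The vanishing of the p-th cohomology of Hom(L, N). *)
Definition coexact L p N : Prop :=
  forall p' p'', p'' = p + 1 -> p = p' + 1 ->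
  forall u : {linear L p -> N}, (forall x : L p'', u (cdiff L p'' p x) = 0) ->
  exists v : {linear L p' -> N}, forall x, u x = v (cdiff L p p' x).

Lemma stalk_diff0 N i j (x : stalk N i) : cdiff (stalk N) i j x = 0.
Proof. by []. Qed.

Lemma coexact_homology L p N : homology0 (homC L (stalk N)) (- p) <-> coexact L p N.
Proof.
split=> [H0 p' p'' p''E pE u ud|ex U cU].
  have pp : 0 = p + - p by lia.
  pose U := gupdate (0 : ghom L (stalk N) (- p)) pp (u : {linear L p -> stalk N 0}).
  have cU : cycles (U : homC L (stalk N) (- p)).
    apply: ghom_eqP => q r rE x.
    rewrite -[LHS]/(dhom (- p - 1) U q r x); have [qE|qp] := eqVneq q p''.
      have {rE} r0 : r = 0 by rewrite rE qE p''E; lia.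
      subst q r; rewrite (dhomE _ _ (p' := p) (q' := 1)) ?subrK //. rewrite stalk_diff0 sub0r.
      by rewrite /U gupdateE ud scaler0 oppr0.
    rewrite (dhomE _ _ (p' := q - 1) (q' := r + 1)) ?subrK // stalk_diff0 sub0r.
    rewrite /U gupdate_out ?scaler0 ?oppr0 //.
    by apply: contra_neq qp => qE; rewrite p''E -qE subrK.
  have [h dh] := H0 _ cU.
  exists (lin_sign _ (- p) \o ghom_lin (h : ghom L (stalk N) (- p + 1)) p' 0) => x.
  have := congr1 (fun f : ghom L (stalk N) (- p) => f p 0 x) dh.
  rewrite {1}/U gupdateE => <-; rewrite -[LHS]/(dhom (- p) h p 0 x).
  rewrite (dhomE _ _ (p' := p') (q' := 1)) // stalk_diff0 sub0r hsignS scaleNr opprK.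
  by [].
have UE (p'' : int) x : p'' = p + 1 -> (U : ghom _ _ _) p 0 (cdiff L p'' p x) = 0.
  move=> p''E; have := congr1 (fun f : ghom L (stalk N) (- p - 1) => f p'' 0 x) cU.
  rewrite -[LHS]/(dhom (- p - 1) U p'' 0 x) (dhomE _ _ (p' := p) (q' := 1)) ?subrK //.
  rewrite stalk_diff0 sub0r => /eqP; rewrite oppr_eq0 => /eqP Ud.
  by rewrite -[LHS](hsignZK (- p)) Ud scaler0.
have [v vE] := ex (p - 1) (p + 1) erefl (esym (subrK 1 p)) (ghom_lin (U : ghom _ _ _) p 0)
  (fun x => UE _ x erefl).
have pp : 0 = (p - 1) + (- p + 1) by lia.
pose H := gupdate (0 : ghom L (stalk N) (- p + 1)) pp
  ((lin_sign _ (- p) \o v) : {linear L (p - 1) -> stalk N 0}).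
exists H; apply: ghom_eqP => q r rE x; rewrite -[LHS]/(dhom (- p) H q r x).
have [qp|qp] := eqVneq q p; last first.
  have r0 : r != 0 by move: qp; rewrite rE; lia.
  exact: etrans (stalk_obj0 _ r0) (esym (stalk_obj0 _ r0)).
have {rE} r0 : r = 0 by rewrite rE qp; lia.
subst q r; rewrite (dhomE _ _ (p' := p - 1) (q' := 1)) ?subrK // stalk_diff0 sub0r.
by rewrite /H gupdateE /= hsignS scaleNr opprK hsignZK -vE.
Qed.

Lemma coexact_finite_free L p N : coexact L p (A^o : lmodType A) -> finite_free N -> coexact L p N.
Proof.
move=> exA [n [e [c [ec ce]]]] p' p'' p''E pE u ud.
have coL (i : 'I_n) : linear (fun x => (c (u x) 0 i : A^o)).
  by move=> a x y; rewrite !linearP !mxE.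
have /choice [v vE] (i : 'I_n) : exists v : {linear L p' -> A^o},
    forall x, c (u x) 0 i = v (cdiff L p p' x).
  by apply: (exA p' p'' p''E pE (mk_lin (coL i))) => x; rewrite /= ud linear0 mxE.
have wL : linear (fun y => \row_i v i y).
  by move=> a x y; apply/rowP => i; rewrite !mxE linearP.
exists (e \o mk_lin wL) => x; rewrite -[LHS]ce /=; congr (e _).
by apply/rowP => i; rewrite mxE vE.
Qed.

End Extension.

(** * Syzygies of a complex of projectives *)

Section Syzygies.
Variables (k : comPzRingType) (A : alg k) (L : cpx A).
Hypothesis projL : forall i, projectiveM (L i).

Definition syzygy j : lmodType A := submod_of (cycles_submod L j).

Definition to_syzygy i j : {linear L i -> syzygy j} :=
  corestr (S := cycles_submod L j) (f := cdiff L i j) (fun x => cycle_diff j x).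

Lemma to_syzygy_eq0 i j x : to_syzygy i j x = 0 <-> cdiff L i j x = 0.
Proof. by split=> [/(congr1 val)|dx]; last exact: val_inj. Qed.

Section Resolution.
Variable j : int.
Hypothesis L0 : forall i, j <= i -> homology0 L i.

Let V n := L (j + 1 + n%:Z).
Let del n : {linear V n.+1 -> V n} := cdiff L (j + 1 + n.+1%:Z) (j + 1 + n%:Z).
Let delK n x : del n (del n.+1 x) = 0. Proof. exact: diffK. Qed.

Let phi (n : nat) : {linear V n -> stalk (syzygy j) n} :=
  match n with
  | 0%N => to_syzygy (j + 1 + 0) j
  | _.+1 => \0
  end.

Let phiD (n : nat) x : cdiff (stalk (syzygy j)) n.+1 n (phi n.+1 x) = phi n (del n x).
Proof. by case: n x => [|n] x //; apply/esym/to_syzygy_eq0; exact: diffK. Qed.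

Let phi0 x : cycles (phi 0 x). Proof. by []. Qed.

Let exact_lift i (x : V i) y : cdiff L (j + 1 + i%:Z) y x = 0 -> j + 1 + i%:Z = y + 1 ->
  exists x', del i x' = x.
Proof.
move=> dx yE; apply: boundary_elim; first lia.
by apply: L0; [lia|apply: cycles_intro dx].
Qed.

(** As L is exact from degree [j] on, its part above [j], renumbered from 0, resolves the module of
    cycles. Thus the positive Ext groups of a syzygy are cohomology groups of Hom(L, N) in high
    degrees. *)
Lemma syzygy_resolution : exists P : projres (stalk (syzygy j)),
  forall (n : nat) N, coexact P n.+1 N <-> coexact L (j + 1 + n.+1%:Z) N.
Proof.
have qphi : quasi_iso (nat_cmap delK phiD phi0).
  apply: nat_cmap_quasi_iso.
  - by move=> i i0 x _; rewrite (stalk_obj0 x) ?lt_eqF //; apply: boundaries0.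
  - move=> y _.
    have [//|z zE] := @boundary_elim _ L j (j + 1 + 0) (val y) _ (L0 (lexx j) (submod_valS y)).
      by lia.
    exists z; rewrite (_ : y - phi 0%N z = 0); first exact: boundaries0.
    by apply: val_inj; rewrite /= zE subrr.
  - move=> n y _; exists 0; rewrite linear0 //.
    by rewrite (stalk_obj0 (_ - _)) //; apply: boundaries0.
  - move=> x /stalk_boundaries /to_syzygy_eq0 dx; apply: exact_lift dx _; lia.
  - move=> n x dx _; apply: exact_lift dx _; lia.
have bP : right_bounded (nat_cpx delK).
  by exists 0 => -[//|n] _ x; apply/rowP; case.
have pP i : projectiveM (nat_cpx delK i).
  by case: i => n; [exact: projL|exact: row_projective].
exists (Projres bP pP qphi) => n N; split=> ex p' p'' p''E pE.
  have p''E' : p'' = j + 1 + n.+2%:Z by rewrite p''E; lia.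
  have pE' : p' = j + 1 + n%:Z by apply: (addIr 1); rewrite -pE; lia.
  clear p''E pE; subst p' p''; have e1 : n.+2%:Z = n.+1%:Z + 1 by lia.
  have e2 : n.+1%:Z = n%:Z + 1 by lia.
  have := ex n n.+2 e1 e2; rewrite /= !nat_diff_succ => ex1; exact: ex1.
have p''E' : p'' = n.+2 by rewrite p''E; lia.
have pE' : p' = n by apply: (addIr 1); rewrite -pE; lia.
clear p''E pE; subst p' p''; rewrite /= !nat_diff_succ.
have e1 : j + 1 + n.+2%:Z = j + 1 + n.+1%:Z + 1 by lia.
have e2 : j + 1 + n.+1%:Z = j + 1 + n%:Z + 1 by lia.
exact: (ex _ _ e1 e2).
Qed.

End Resolution.

(* A cocycle f : L_p -> Z_j is the leading term of a chain map L -> L of      *)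
(* degree j + 1 - p: the lower terms exist since the modules L_i are coexact  *)
(* and the higher ones since L is exact above j.  A null-homotopy of this    *)
(* chain map makes f a coboundary.                                           *)
Lemma coexact_syzygy (s h j : int) (m1 m2 : int) :
  (forall i, i < s -> zero_at L i) ->
  (forall i, h < i -> homology0 L i) -> h < j ->
  (forall p i, m1 <= p -> coexact L p (L i)) ->
  (forall i, i <= m2 -> homology0 (homC L L) i) ->
  exists p1, forall p, p1 <= p -> coexact L p (syzygy j).
Proof.
(* For such [p] the degree [c] is at most [m2], and every [q] at which a component still has a
   target in degree at least [s] satisfies [m1 <= q]. *)
move=> Ls Lh hj ex H0; exists (`|m1| + `|m2| + `|j| + `|j - s| + 2) => p pp p' p'' p''E pE f fd.
pose c := j + 1 - p.
have [|F0 F0E] := @projective_lift _ _ _ _ (to_syzygy (j + 1) j) f (@projL p).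
  move=> x; have [y yE] := Lh j hj (val (f x)) (submod_valS (f x)).
  by exists y; apply: val_inj.
have F0d x : cdiff L (j + 1) j (F0 x) = val (f x) by rewrite -F0E.
have cE : j + 1 = p + c by rewrite /c; lia.
have down (i : nat) : exists F : ghom L L c,
    (forall x, F p (j + 1) x = F0 x) /\
    (forall q r x, p - i%:Z < q -> q <= p -> dhom (c - 1) F q r x = 0).
  elim: i => [|i [F [Fp Fd]]].
    by exists (gupdate 0 cE F0); split=> [x|q r x]; [exact: gupdateE|lia].
  have [q qE] : exists q, q = p - i%:Z by exists (p - i%:Z).
  have qmax : q <= p by lia.
  have Fdd x : cdiff L (q + c) (q + c - 1) (F q (q + c) (cdiff L (q + 1) q x)) = 0.
    have [i0|i0] := eqVneq i 0%N.
      have qp : q = p by rewrite qE i0 subr0.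
      clear qE; subst q; rewrite -cE Fp addrK F0d.
      have := fd; rewrite p''E => ->; exact: linear0.
    have := Fd (q + 1) (q + c) x ltac:(lia) ltac:(lia).
    rewrite (dhomE _ _ (p' := q) (q' := q + c + 1)) ?subrK //.
    move/eqP; rewrite subr_eq0 => /eqP dF.
    by rewrite -[F q _ _](hsignZK c) -dF linearZ_LR /= diffK scaler0.
  have [v vE] : exists v : {linear L (q - 1) -> L (q + c - 1)},
      forall x, hsign A c *: cdiff L (q + c) (q + c - 1) (F q (q + c) x) = v (cdiff L q (q - 1) x).
    have [qs|sq] := ltP (q + c - 1) s; first by exists \0 => x; apply: (Ls _ qs).
    have qm : m1 <= q by move: pp sq; rewrite /c qE; lia.
    pose u := lin_sign (L (q + c - 1)) c \o (cdiff L (q + c) (q + c - 1) \o ghom_lin F q (q + c)).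
    apply: (ex q (q + c - 1) qm (q - 1) (q + 1) erefl (esym (subrK 1 q)) u) => x.
    by rewrite /= Fdd scaler0.
  have vc : q + c - 1 = q - 1 + c by lia.
  exists (gupdate F vc v); split=> [x|q' r x q'p pq']; first by rewrite gupdate_out //; lia.
  have [qq|qq] := eqVneq q' q; last first.
    rewrite -(Fd q' r x); [|lia|lia].
    by apply: dhom_local => r' y; rewrite gupdate_out //; lia.
  subst q'; have [rE|rq] := eqVneq r (q + c - 1); last first.
    by apply: hom_deg; apply: contra_neq rq => ->; lia.
  subst r; rewrite (dhomE _ _ (p' := q - 1) (q' := q + c)) ?subrK //.
  by rewrite gupdateE -vE hsignZK gupdate_out ?subrr //; lia.
(* After this many steps the remaining targets lie below [s], where [L] is zero, so the cycle
   condition holds in all degrees up to [p]. *)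
have [F [Fp Fd]] := down (`|j - s| + 1)%N.
have {}Fd q r x : q < p + 1 -> dhom (c - 1) F q r x = 0.
  move=> qp; have [pq|qp'] := ltP (p - (`|j - s| + 1)%N%:Z) q; first by apply: Fd => //; lia.
  have [rE|rq] := eqVneq r (q + (c - 1)); last exact: hom_deg.
  by apply: (Ls r); rewrite rE /c; lia.
(* Upward extension to a cycle is [proj_extend] for the zero map, whose cone is exact wherever [L]
   is. *)
have [||||||G [_ [GF _ dG _]]] := @proj_extend k A L L L (zero_cmap L L) (p + 1) (c - 1) c (c + 1)
  0 0 F 0 (esym (subrK 1 c)) erefl.
- by move=> q _; apply: projL.
- move=> i ic i1 i2 i1E i2E a e ca; rewrite oppr0 => de.
  have hi : h < i by move: ic; rewrite /c; lia.
  have [w wE] := boundary_elim i1E (Lh i hi a ca).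
  have hi1 : h < i1 by rewrite i1E; lia.
  have [t tE] := boundary_elim i2E (Lh i1 hi1 e (cycles_intro i1E de)).
  by exists w, t; rewrite subr0.
- exact: (linear0 (cdiff (homC L L) (c - 1) (c - 1 - 1))).
- by apply: etrans (linear0 (cdiff (homC L L) c (c - 1))) _; apply: ghomP.
- exact: Fd.
- move=> q r x _; apply: etrans (congr1 (fun h : ghom L L c => h q r x)
    (linear0 (cdiff (homC L L) (c + 1) c))) _.
  by rewrite /= subr0.
have [||H dH] := H0 c _ G; first by rewrite /c; lia.
  exact: dG.
have cd x : cycles (cdiff L (j + 1) j (hsign A c *: (H : ghom L L (c + 1)) p' (j + 1) x)).
  exact: cycle_diff.
pose v := corestr (S := cycles_submod L j) (f := cdiff L (j + 1) j \o
  (lin_sign _ c \o ghom_lin (H : ghom L L (c + 1)) p' (j + 1))) cd.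
exists v => x; apply: val_inj.
rewrite -F0d -Fp -GF; last lia.
have <- : dhom c H p (j + 1) x = G p (j + 1) x by rewrite -dH.
rewrite (dhomE _ _ (p' := p') (q' := j + 1 + 1)) // linearB diffK sub0r hsignS.
by rewrite scaleNr linearN opprK.
Qed.

End Syzygies.

(** * Cutting a resolution at a degree where it splits *)

Section FiniteProjectiveDimension.
Variables (k : comPzRingType) (A : alg k) (X : cpx A).

(** The projection [v] writes [L n] as the sum of the boundaries and of its own kernel. Keeping L
    below [n], the kernel of [v] in degree [n] and zero above gives a subcomplex with projective
    terms, and nothing is lost because L is exact from [n] on. *)
Lemma split_truncation (L : projres X) n (v : {linear L n -> L n}) :
  (forall i, n <= i -> homology0 X i) ->
  (forall x, boundaries (v x)) -> (forall x, boundaries x -> v x = x) ->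
  exists Q : projres X, forall i, n < i -> zero_at Q i.
Proof.
move=> X0 vB vE.
have L0 i : n <= i -> homology0 L i.
  by move=> ni; apply/(quasi_iso_acyclic i (@projres_quasi_iso _ _ L)); apply: X0.
have vd i (x : L i) : v (same_degree n (cdiff L i n x)) = cdiff L i n x.
  rewrite same_degree_id; have [iE|ij] := eqVneq i (n + 1).
    exact/vE/boundary_intro.
  by rewrite diff_shape // linear0.
pose Tset i (x : L i) := (i = n -> v (same_degree n x) = 0) /\ (n < i -> x = 0).
have Tset0 i : Tset i 0 by split=> // _; rewrite !linear0.
have TsetP i a x y : Tset i x -> Tset i y -> Tset i (a *: x + y).
  move=> [xv x0] [yv y0]; split=> ni; last by rewrite x0 // y0 // scaler0 addr0.
  by rewrite !linearP xv // yv // scaler0 addr0.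
pose T i := Submod (Tset0 i) (@TsetP i).
have Td i j (x : L i) : T i x -> T j (cdiff L i j x).
  move=> [xv x0]; have [iE|ij] := eqVneq i (j + 1); last by rewrite diff_shape //; apply: submod0.
  have [ni|i_n] := ltP n i; first by rewrite x0 // linear0; apply: submod0.
  by split=> [jn|nj]; exfalso; move: iE i_n; [rewrite jn|]; lia.
have projT i : projectiveM (subcpx Td i).
  have [i_n|ni|i_n] := ltgtP i n.
  - have Tx (x : L i) : T i x by split=> [E|?]; exfalso; lia.
    have rL : linear (fun x => submod_in (Tx x)) by move=> a x y; apply: val_inj.
    apply: (@projective_retract _ (L i) _ (sub_incl (T i)) (mk_lin rL)).
      by move=> x; apply: val_inj.
    exact: projres_projective.
  - by apply: projective0 => x; apply: val_inj; have [_ x0] := submod_valS x; apply: x0.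
  - subst i; have Tx x : T n (x - v x).
      split=> [_|]; last lia.
      by rewrite same_degree_id linearB (vE (v x)) ?subrr.
    have rL : linear (fun x => submod_in (Tx x)).
      by move=> a x y; apply: val_inj; rewrite /= linearP opprD addrACA scalerBr.
    apply: (@projective_retract _ (L n) _ (sub_incl (T n)) (mk_lin rL)).
      move=> x; apply: val_inj => /=; have [xv _] := submod_valS x.
      by have := xv erefl; rewrite same_degree_id => ->; rewrite subr0.
    exact: projres_projective.
have bT : right_bounded (subcpx Td).
  have [m Lm] := projres_bounded L; exists m => i im x.
  by apply: val_inj; apply: Lm.
have qT : quasi_iso (subcpx_incl Td).
  move=> i; split=> [x cx bx|y cy].
    have [_ x0] := submod_valS x; have [xv _] := submod_valS x.
    have [i_n|ni|i_n] := ltgtP i n; last first.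
    - rewrite (_ : x = 0); first exact: boundaries0.
      subst i; apply: val_inj; rewrite -[LHS]vE //.
      by have := xv erefl; rewrite same_degree_id.
    - by rewrite (_ : x = 0); [exact: boundaries0|apply: val_inj; apply: x0].
    have [y yE] := bx.
    have [iE|i1n] := eqVneq (i + 1) n; last first.
      have Ty : T (i + 1) y by split=> [E|?]; exfalso; [rewrite E eqxx in i1n|lia].
      by exists (submod_in Ty); apply: val_inj.
    have Tz : T (i + 1) (y - same_degree (i + 1) (v (same_degree n y))).
      split=> [_|?]; last by exfalso; lia.
      by rewrite linearB /= same_degreeK ?iE // linearB (vE (v _)) ?subrr.
    exists (submod_in Tz); apply: val_inj; rewrite /= linearB yE.
    rewrite (_ : cdiff L (i + 1) i _ = 0) ?subr0 //; apply: cycle_all.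
    by apply/same_degree_cycles; [rewrite iE|exact: boundary_cycle (vB _)].
  have [i_n|ni] := ltP i n.
    have Ty : T i y by split=> [E|?]; exfalso; lia.
    by exists (submod_in Ty); [exact: val_inj|rewrite /= subrr; exact: boundaries0].
  exists 0; first exact: cycles0.
  by rewrite (linear0 (subcpx_incl Td i)) subr0; apply: L0.
exists (Projres bT projT (quasi_iso_comp qT (@projres_quasi_iso _ _ L))) => i ni x.
by apply: val_inj; have [_ x0] := submod_valS x; apply: x0.
Qed.

Lemma fin_gen_syzygy (L : cpx A) j : homology0 L j -> finite_free (L (j + 1)) ->
  fin_gen (syzygy L j).
Proof.
move=> L0 [n [e [c [ec ce]]]].
exists n, (fun i => to_syzygy L (j + 1) j (e (delta_mx 0 i))) => x.
have [y yE] := L0 (val x) (submod_valS x).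
exists (fun i => c y 0 i).
have -> : x = to_syzygy L (j + 1) j y by apply: val_inj.
rewrite -{1}(ce y) [in LHS](row_sum_delta (c y)) !linear_sum.
by apply: eq_bigr => i _; rewrite !linearZ_LR.
Qed.

Hypotheses (noethA : left_noetherian A) (bX : hbounded X)
  (fgX : forall i, homology_fin_gen X i) (acA : condAC A).
Variable P : projres X.
Hypothesis bPA : hbounded (RHom P (stalk (A^o : lmodType A))).
Hypothesis bXX : exists m, forall (Q : projres X) i, i <= m -> homology0 (RHom Q X) i.

Lemma finite_proj_dim : exists (Q : projres X) (n : int), forall i, n < i -> zero_at Q i.
Proof.
have [L fL] := finite_free_resolution noethA bX fgX.
have projL i : projectiveM (L i) := @projres_projective _ _ L i.
have [h hX] := bX; have [m1 HA] := bPA; have [m2 H2] := bXX; have [s Ls] := projres_bounded L.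
have Lh i : `|h| < i -> homology0 L i.
  move=> hi; apply/(quasi_iso_acyclic i (@projres_quasi_iso _ _ L)); apply: hX; lia.
have exA p i : `|m1| + 1 <= p -> coexact L p (L i).
  move=> mp; apply: coexact_finite_free (fL i); apply/coexact_homology.
  by apply/(RHom_homology0 P L); apply: HA; lia.
have HLL i : i <= m2 -> homology0 (homC L L) i.
  move=> im; apply/(quasi_iso_acyclic i (hom_post_quasi_iso (projres_bounded L) projL
    (@projres_quasi_iso _ _ L))); exact: H2.
pose j0 := `|h| + 1; have hj0 : `|h| < j0 by rewrite /j0; lia.
have fg j : `|h| < j -> fin_gen (syzygy L j).
  by move=> hj; apply: fin_gen_syzygy => //; apply: Lh.
have [b bP] := acA (fg j0 hj0).
(* The bound [b] depends on [j0] only, so [n] may be chosen after it. Degree [b + 1] of the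
   resolution of the syzygy at [j0] is degree [n + 1] of L. *)
pose n := j0 + 1 + b%:Z; have hn : `|h| < n by rewrite /n; lia.
have [P1 P1E] := syzygy_resolution projL (j := j0) (fun i ji => Lh i (lt_le_trans hj0 ji)).
have [p1 ex1] := coexact_syzygy projL Ls Lh hn exA HLL.
(* AC kills the class of the extension 0 -> Z_n -> L_n -> Z_(n-1) -> 0. *)
have [||||v vE] := (P1E b (syzygy L n)).1 _ n (n + 2) _ _ (to_syzygy L (j0 + 1 + b.+1%:Z) n).
- apply/coexact_homology/bP; [exact: fg| |by []].
  exists `|p1|%N => -[//|i] ip Q; apply/(RHom_homology0 P1 Q)/coexact_homology/P1E.
  by apply: ex1; rewrite /j0; lia.
- by rewrite /n; lia.
- by rewrite /n; lia.
- by move=> x; apply/to_syzygy_eq0; apply: diffK.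
have pE : j0 + 1 + b.+1%:Z = n + 1 by rewrite /n; lia.
rewrite pE in vE.
have vB x : boundaries (sub_incl _ (v x)).
  by apply: (Lh n hn); exact: (submod_valS (v x)).
have vid x : boundaries x -> sub_incl _ (v x) = x by move=> [y <-]; rewrite -vE.
have X0 i : n <= i -> homology0 X i.
  by move=> ni; apply/(quasi_iso_acyclic i (@projres_quasi_iso _ _ L)); apply: Lh; lia.
have [Q Qn] := @split_truncation L n (sub_incl _ \o v) X0 vB vid.
by exists Q, n.
Qed.

End FiniteProjectiveDimension.

(** * Exchanging the arguments of an iterated Hom complex *)

Section IntegerSign.
Variable V : zmodType.

(** The sign uses only the additive group, so that one expression serves for the structures over k,
    R and S at once. *)
Definition zsign (n : int) (x : V) : V := if odd `|n|%N then - x else x.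

Lemma zsignD m n x : zsign m (zsign n x) = zsign (m + n) x.
Proof.
rewrite /zsign; have -> : odd `|(m + n)%R|%N = odd `|m|%N (+) odd `|n|%N by lia.
by do 2!case: odd => //=; rewrite opprK.
Qed.

Lemma zsign_eq m n x : odd `|m|%N = odd `|n|%N -> zsign m x = zsign n x.
Proof. by rewrite /zsign => ->. Qed.

Lemma zsignB n x y : zsign n (x - y) = zsign n x - zsign n y.
Proof. by rewrite /zsign; case: odd; rewrite ?opprD. Qed.

Lemma zsign_add n x y : zsign n (x + y) = zsign n x + zsign n y.
Proof. by rewrite /zsign; case: odd; rewrite ?opprD. Qed.

Lemma zsign0 n : zsign n 0 = 0.
Proof. by rewrite /zsign oppr0 if_same. Qed.

End IntegerSign.

Lemma zsign_map (U V : zmodType) (f : U -> V) : {morph f : x y / x - y} ->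
  forall n x, f (zsign n x) = zsign n (f x).
Proof.
move=> fB n x; have f0 : f 0 = 0 by rewrite -(subrr (0 : U)) fB subrr.
by rewrite /zsign; case: odd; rewrite // -sub0r fB f0 sub0r.
Qed.

Lemma hsign_zsign (A : pzRingType) (V : lmodType A) n (x : V) : hsign A n *: x = zsign n x.
Proof.
by rewrite /hsign -signr_odd /zsign; case: odd; rewrite ?expr1 ?expr0 ?scaleN1r ?scale1r.
Qed.

Lemma brightr_morph (k : comPzRingType) (R S : alg k) (M : bimod R S) s :
  {morph bright M s : x y / x - y}.
Proof. by move=> x y; apply: brightrB. Qed.

Lemma bleftrB (k : comPzRingType) (R S : alg k) (M : bimod R S) r :
  {morph bleft M r : x y / x - y}.
Proof. exact: (@brightr_morph k S R (bswap M) r). Qed.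

Section Swap.
Variables (k : comPzRingType) (R S : alg k) (X : cpx R) (Y : cpx S) (I : bicpx R S).

Let HY : cpx R := homT Y (cswap I).
Let HX : cpx S := homT X I.

Section Degree.
Variables (N : int) (F : ghom X HY N).

Let val p m (x : X p) : ghom Y (rcpx I) m := F p m x.

(** The Koszul rule: y and x of degrees q and p are exchanged with the sign (-1)^(pq). The value
    lies in degree [r], which forces F x to have degree [r - q]. *)
Definition swap_fun q m (y : Y q) p r (x : X p) : I r :=
  if m == q + N then @zsign (I r) (p * q) (val (r - q) x q r y) else 0.

Fact swap_fun_linear q m y p r : linear (@swap_fun q m y p r : X p -> lcpx I r).
Proof.
move=> a x x'; rewrite /swap_fun; case: ifP => _; last by rewrite scaler0 addr0.
have -> : val (r - q) (a *: x + x') q r y =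
    bleft (I r) a (val (r - q) x q r y) + val (r - q) x' q r y by rewrite /val linearP.
by rewrite zsign_add -(zsign_map (@bleftrB _ _ _ (I r) a)).
Qed.

Fact swap_fun_deg q m y p r : r != p + m -> forall x : X p, @swap_fun q m y p r x = 0.
Proof.
move=> rp x; rewrite /swap_fun; case: eqP => // mE.
rewrite /val (hom_deg F) ?zsign0 //.
by apply: contra_neq rp => rE; rewrite mE [q + N]addrC addrA -rE subrK.
Qed.

Definition swap_val q m (y : Y q) : HX m :=
  GHom (@swap_fun_linear q m y) (@swap_fun_deg q m y).

Fact swap_linear q m : linear (@swap_val q m).
Proof.
move=> s y y'; apply: ghomP => p r x; rewrite /= /swap_fun.
case: ifP => _; last by rewrite brightr0 addr0.
rewrite linearP zsign_add; congr (_ + _).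
exact: (esym (zsign_map (@brightr_morph _ _ _ (I r) s) _ _)).
Qed.

Fact swap_deg q m : m != q + N -> forall y : Y q, swap_val m y = 0.
Proof. by move=> /negPf mq y; apply: ghomP => p r x; rewrite /= /swap_fun mq. Qed.

Definition swap : ghom Y HX N := GHom swap_linear swap_deg.

Lemma swapE q m y p r x m' : m = q + N -> m' = r - q ->
  (swap q m y : ghom X (lcpx I) m) p r x =
  @zsign (I r) (p * q) ((F p m' x : ghom Y (rcpx I) m') q r y).
Proof. by move=> -> ->; rewrite /= /swap_fun eqxx. Qed.

End Degree.

Fact swap_is_linear N : linear (@swap N : homC X HY N -> homC Y HX N).
Proof.
move=> c F G; apply: ghomP => q m y; apply: ghomP => p r x.
rewrite /= /swap_fun; case: ifP => _; last by rewrite brightr0 addr0.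
rewrite zsign_add; congr (_ + _).
rewrite (zsign_map (@brightr_morph _ _ _ (I r) (alg_str S c))); congr (zsign _ _).
exact: bcentral.
Qed.

(** Both sides expand to the differential of F(x)(y), to F(x)(dy) and to F(dx)(y); their signs agree
    by parity, with [p * q] treated as an atom. *)
Fact swapD i j (F : ghom X HY i) : swap (dhom j F) = dhom j (swap F).
Proof.
have [iE|ij] := eqVneq i (j + 1); last first.
  rewrite !dhom_eq0 //; apply: ghomP => q m y; apply: ghomP => p r x.
  by rewrite /= /swap_fun zsign0 if_same.
apply: ghom_eqP => q m mE y; apply: ghom_eqP => p r rE x.
rewrite (swapE _ _ _ mE erefl).
rewrite (dhomE _ _ (p' := p - 1) (q' := r - q + 1)) ?subrK //.
rewrite [in RHS](dhomE _ _ (p' := q - 1) (q' := m + 1)) ?subrK //.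
pose f1 : I (r + 1) := (F p (r - q + 1) x : ghom Y (rcpx I) _) q (r + 1) y.
pose f2 : I r := (F p (r - q + 1) x : ghom Y (rcpx I) _) (q - 1) r (cdiff Y q (q - 1) y).
pose f3 : I r := (F (p - 1) (r - q) (cdiff X p (p - 1) x) : ghom Y (rcpx I) _) q r y.
have L1 : (cdiff HY (r - q + 1) (r - q) (F p (r - q + 1) x) : ghom Y (rcpx I) (r - q)) q r y =
    bdiff I (r + 1) r f1 - zsign (r - q + 1) f2.
  rewrite -[LHS]/(dhom (r - q) (F p (r - q + 1) x : ghom Y (rcpx I) _) q r y).
  by rewrite (dhomE _ _ (p' := q - 1) (q' := r + 1)) ?subrK // hsign_zsign.
have L2 : (hsign R i *: F (p - 1) (r - q) (cdiff X p (p - 1) x) : ghom Y (rcpx I) (r - q)) q r y =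
    zsign i f3 by exact: (@hsign_zsign R (lcpx I r) i f3).
have R1 : (cdiff HX (m + 1) m (swap F q (m + 1) y) : ghom X (lcpx I) m) p r x =
    bdiff I (r + 1) r (zsign (p * q) f1) - zsign (m + 1) (zsign ((p - 1) * q) f3).
  rewrite -[LHS]/(dhom m (swap F q (m + 1) y : ghom X (lcpx I) _) p r x).
  rewrite (dhomE _ _ (p' := p - 1) (q' := r + 1)) ?subrK // hsign_zsign.
  by rewrite (swapE F _ _ (m' := r - q + 1)) ?(swapE F _ _ (m' := r - q)) //; lia.
have R2 : (hsign S i *: swap F (q - 1) m (cdiff Y q (q - 1) y) : ghom X (lcpx I) m) p r x =
    zsign i (zsign (p * (q - 1)) f2).
  apply: etrans (@hsign_zsign S (rcpx I r) i _) _; congr (zsign i _).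
  by rewrite (swapE F _ _ (m' := r - q + 1)) //; lia.
transitivity (@zsign (I r) (p * q) (bdiff I (r + 1) r f1 - zsign (r - q + 1) f2 - zsign i f3)).
  by rewrite -L1 -L2.
transitivity (bdiff I (r + 1) r (zsign (p * q) f1) - zsign (m + 1) (zsign ((p - 1) * q) f3) -
    zsign i (zsign (p * (q - 1)) f2)); last by rewrite -R1 -R2.
have bdB : {morph bdiff I (r + 1) r : x y / x - y}.
  exact: (linearB (mk_lin (bilin_l (bdiff_bilin I (r + 1) r)))).
rewrite !zsignB (zsign_map bdB) !zsignD addrAC mulrBl mul1r mulrBr mulr1.
move: (p * q) => t; congr (_ - _ - _); apply: zsign_eq; lia.
Qed.

Definition swap_cmap : cmap (homC X HY) (homC Y HX) :=
  @Cmap k (homC X HY) (homC Y HX) (fun N => mk_lin (@swap_is_linear N))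
    (fun i j F => @swapD i j F).

(* [cswap (cswap I)] is not convertible to [I], but has the same components. *)
Section Rebase.
Variables (N : int) (G : ghom Y HX N).

Let J : bicpx R S := cswap (cswap I).

Definition rebase_fun q m (y : Y q) : homT X J m := (G q m y : ghom X (lcpx I) m).

Fact rebase_linear q m : linear (@rebase_fun q m).
Proof. by move=> s y y'; rewrite /rebase_fun linearP; apply: ghomP. Qed.

Fact rebase_deg q m : m != q + N -> forall y : Y q, rebase_fun m y = 0.
Proof. by move=> mq y; rewrite /rebase_fun hom_deg //; apply: ghomP. Qed.

Definition rebase : ghom Y (homT X J) N := GHom rebase_linear rebase_deg.

End Rebase.

End Swap.

Section SwapInverse.
Variables (k : comPzRingType) (R S : alg k) (X : cpx R) (Y : cpx S) (I : bicpx R S) (N : int).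

Definition unswap (G : ghom Y (homT X I) N) : ghom X (homT Y (cswap I)) N :=
  @swap k S R Y X (cswap I) N (rebase G).

Lemma unswapE G p m x q r y m' : m = p + N -> m' = r - p ->
  (unswap G p m x : ghom Y (rcpx I) m) q r y =
  @zsign (I r) (q * p) ((G q m' y : ghom X (lcpx I) m') p r x).
Proof. exact: (@swapE k S R Y X (cswap I) N (rebase G) p m x q r y m'). Qed.

Lemma swapK : cancel (@swap k R S X Y I N) unswap.
Proof.
move=> F; apply: ghom_eqP => p m mE x; apply: ghom_eqP => q r rE y.
rewrite (unswapE _ _ _ mE erefl) (swapE F _ _ (m' := m)); [|lia|lia].
by rewrite zsignD mulrC (@zsign_eq _ _ 0) //; lia.
Qed.

Lemma unswapK : cancel unswap (@swap k R S X Y I N).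
Proof.
move=> G; apply: ghom_eqP => q m mE y; apply: ghom_eqP => p r rE x.
rewrite (swapE _ _ _ mE erefl) (unswapE G _ _ (m' := m)); [|lia|lia].
by rewrite zsignD mulrC (@zsign_eq _ _ 0) //; lia.
Qed.

End SwapInverse.

Lemma bijective_quasi_iso (R : pzRingType) (X Y : cpx R) (f : cmap X Y) :
  (forall i, bijective (f i)) -> quasi_iso f.
Proof.
move=> bij i; split=> [x cx [y yE]|y cy].
  have [g _ gK] := bij (i + 1); exists (g y).
  by apply: (bij_inj (bij i)); rewrite cmapD gK.
have [g _ gK] := bij i; exists (g y); last by rewrite gK subrr; apply: boundaries0.
by apply: (bij_inj (bij (i - 1))); rewrite cmapD gK linear0.
Qed.

Lemma swap_quasi_iso (k : comPzRingType) (R S : alg k) (X : cpx R) (Y : cpx S)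
  (I : bicpx R S) : quasi_iso (swap_cmap X Y I).
Proof.
apply: bijective_quasi_iso => N; exists (@unswap k R S X Y I N).
  exact: swapK.
exact: unswapK.
Qed.

(** * Duality *)

Section DerivedIsomorphism.
Variable R : pzRingType.
Implicit Types X Y Z : cpx R.

Lemma quasi_iso_D_isomorphic X Y (f : cmap X Y) : quasi_iso f -> D_isomorphic X Y.
Proof.
by move=> qf; exists (dfwd f), (dinv qf); split; [apply: deq_invl|apply: deq_invr].
Qed.

Lemma D_isomorphic_sym X Y : D_isomorphic X Y -> D_isomorphic Y X.
Proof. by move=> [u [v [vu uv]]]; exists v, u. Qed.

Lemma dcomp_cancel X Y Z (u : dmor X Y) (v : dmor Y X) (u' : dmor Y Z) (v' : dmor Z Y) :
  deq (dcomp v u) (dfwd (Defs.cid X)) -> deq (dcomp v' u') (dfwd (Defs.cid Y)) ->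
  deq (dcomp (dcomp v v') (dcomp u' u)) (dfwd (Defs.cid X)).
Proof.
move=> vu vu'; apply: deq_trans (deq_sym (deq_assoc _ _ _)) _.
apply: deq_trans vu; apply: deq_dcomp; first exact: deq_refl.
apply: deq_trans (deq_assoc _ _ _) _; apply: deq_trans (deq_idl u).
by apply: deq_dcomp => //; apply: deq_refl.
Qed.

Lemma D_isomorphic_trans X Y Z : D_isomorphic X Y -> D_isomorphic Y Z -> D_isomorphic X Z.
Proof.
move=> [u [v [vu uv]]] [u' [v' [vu' uv']]].
by exists (dcomp u' u), (dcomp v v'); split; apply: dcomp_cancel.
Qed.

End DerivedIsomorphism.

Section DualizingSwap.
Variables (k : comPzRingType) (R S : alg k).

Definition bicmap_swap (X Y : bicpx R S) (f : bicmap X Y) : bicmap (cswap X) (cswap Y) :=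
  @Bicmap k S R (cswap X) (cswap Y) f
    (fun i => conj (bilin_r (bicmap_bilin f i)) (bilin_l (bicmap_bilin f i)))
    (@bicmapD k R S X Y f).

Lemma homothety_swap (D : bicpx R S) :
  (forall P : projres (rcpx D), quasi_iso (homothety P)) ->
  forall P : projres (rcpx (cswap (cswap D))), quasi_iso (homothety P).
Proof.
move=> qD P; apply: quasi_iso_ext (qD P) => -[[|n]|n] x //.
exact: ghomP.
Qed.

Lemma dualizing_swap (D : bicpx R S) : dualizing D -> dualizing (cswap D).
Proof.
move=> [[bD fl fr] [P [f [qf bP pl pr]]] [I [g [qg bI il ir]]] [hl hr]]; split.
- by split.
- by exists (cswap P), (bicmap_swap f); split.
- by exists (cswap I), (bicmap_swap g); split.
- by split=> //; apply: homothety_swap.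
Qed.

End DualizingSwap.

Section Duality.
Variables (k : comPzRingType) (R S : alg k) (D : bicpx R S).
Hypothesis dualD : dualizing D.

(** The units of the two homotheties, valued in a bimodule complex [I], are quasi-isomorphisms; Hom
    out of P and out of Q preserves them, and [swap_cmap] joins the two results. *)
Lemma RHom_ring_isomorphic (P : projres (lcpx D)) (Q : projres (rcpx D)) :
  D_isomorphic (RHom P (stalk (R^o : lmodType R))) (RHom Q (stalk (S^o : lmodType S))).
Proof.
have [_ _ [I [f [qf _ _ _]]] [hl hr]] := dualD.
have q1 := hom_post_quasi_iso (projres_bounded P) (@projres_projective _ _ P)
  (@homT_unit_quasi_iso k S R (cswap D) (homothety_swap hl) (cswap I) (bicmap_swap f) qf Q).
have q2 := hom_post_quasi_iso (projres_bounded Q) (@projres_projective _ _ Q)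
  (homT_unit_quasi_iso hr qf P).
apply: D_isomorphic_trans (quasi_iso_D_isomorphic q1) _.
apply: D_isomorphic_trans (quasi_iso_D_isomorphic (swap_quasi_iso P Q I)) _.
exact: D_isomorphic_sym (quasi_iso_D_isomorphic q2).
Qed.

(** A dimension may be [-oo], as for D without homology; bounds by arbitrarily small integers then
    force [w] to be [-oo]. *)
Lemma ereal_int_add_bound (u v w : \bar int) (a0 b0 : int) :
  (u <= a0%:E)%E -> (v <= b0%:E)%E ->
  (forall a b : int, (u <= a%:E)%E -> (v <= b%:E)%E -> (w <= (a + b)%:E)%E) ->
  (w <= u + v)%E /\ (u + v < +oo)%E.
Proof.
move=> ua vb uvw.
have wNy : u = -oo%E \/ v = -oo%E -> w = -oo%E.
  move=> uv; case: w uvw => [n||] uvw //; last by have := uvw _ _ ua vb.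
  exfalso; case: uv => uvE.
    have := uvw (n - b0 - 1) b0; rewrite uvE leNye lee_fin => /(_ erefl vb); lia.
  have := uvw a0 (n - a0 - 1) ua; rewrite uvE leNye lee_fin => /(_ erefl); lia.
case: u ua uvw wNy => [a| |] ua uvw wNy //; last by rewrite wNy ?leNye //; left.
case: v vb uvw wNy => [b| |] vb uvw wNy //; last by rewrite wNy ?leNye //; right.
by split; [exact: (uvw a b (lexx _) (lexx _))|exact: ltry].
Qed.

Lemma inj_dim_bound (noethR : left_noetherian R) (T : pzRingType)
    (theta : T -> R) (tau : R -> T) (thetaD : {morph theta : a b / a + b})
    (theta1 : theta 1 = 1) (thetaM : forall a b, theta (a * b) = theta b * theta a)
    (thetaK : cancel theta tau) (tauK : cancel tau theta) (P : projres (lcpx D)) :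
  hbounded (RHom P (stalk (R^o : lmodType R))) -> condAC R ->
  [/\ (inj_dim (stalk (T^o : lmodType T)) <= proj_dim (lcpx D) + inj_dim (rcpx D))%E,
      (inj_dim (stalk (S^o : lmodType S)) <= proj_dim (lcpx D) + inj_dim (rcpx D))%E &
      (proj_dim (lcpx D) + inj_dim (rcpx D) < +oo)%E].
Proof.
move=> bPR acR.
have [[bD fl _] [X [f [qf bX pl pr]]] [I [g [qg bI _ ir]]] [hl hr]] := dualD.
(* By the homothety condition RHom_R(D, D) has homology in degree 0 only. *)
have bDD : exists m, forall (Q : projres (lcpx D)) i, i <= m -> homology0 (RHom Q (lcpx D)) i.
  exists (-1) => Q i i1; have /stalk_quasi_isoP [H0 _ _] := hr Q.
  by apply: H0; lia.
have [Q [a0 Qa]] := finite_proj_dim noethR bD fl acR bPR bDD.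
have pd : (proj_dim (lcpx D) <= a0%:E)%E by apply/proj_dim_le; exists Q.
have lbI : left_bounded (rcpx I).
  by have [n In] := bI; exists `|n| => i ni; apply: In; lia.
pose J : injres (rcpx D) := @Injres _ _ _ (rcmap g) lbI ir (quasi_iso_rcmap qg).
have [b0 id] : exists b : int, (inj_dim (rcpx D) <= b%:E)%E.
  have [n In] := bI; exists `|n|; apply/inj_dim_le; exists J => i ni.
  by apply: In; lia.
have [|le1 lt] := @ereal_int_add_bound (proj_dim (lcpx D)) (inj_dim (rcpx D))
  (inj_dim (stalk (T^o : lmodType T))) a0 b0 pd id.
  move=> a b /proj_dim_le [P1 Pa] /inj_dim_le [J1 Jb]; apply/inj_dim_le.
  exact: (source_resolution thetaD theta1 thetaM thetaK tauK hl qf bX pl pr Pa Jb).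
have [|le2 _] := @ereal_int_add_bound (proj_dim (lcpx D)) (inj_dim (rcpx D))
  (inj_dim (stalk (S^o : lmodType S))) a0 b0 pd id.
  move=> a b /proj_dim_le [P1 Pa] /inj_dim_le [J1 Jb]; apply/inj_dim_le.
  exact: (target_resolution hr qg lbI ir Pa Jb).
by split.
Qed.

End Duality.

Theorem proposition3p5 (k : comPzRingType) (A B : alg k)
    (noethA : left_noetherian A) (noethB : left_noetherian B^op)
    (D : bicpx A B^op) (dualD : dualizing D)
    (P : projres (lcpx D)) (Q : projres (rcpx D)) :
  D_isomorphic (RHom P (stalk A^o)) (RHom Q (stalk (B^op)^o)) /\
  (hbounded (RHom P (stalk A^o)) -> hbounded (RHom Q (stalk (B^op)^o)) ->
   (condAC A ->
    [/\ (inj_dim (stalk (A^op)^o) <= proj_dim (lcpx D) + inj_dim (rcpx D))%E,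
        (inj_dim (stalk (B^op)^o) <= proj_dim (lcpx D) + inj_dim (rcpx D))%E &
        (proj_dim (lcpx D) + inj_dim (rcpx D) < +oo)%E]) /\
   (condAC B^op ->
    [/\ (inj_dim (stalk A^o) <= proj_dim (rcpx D) + inj_dim (lcpx D))%E,
        (inj_dim (stalk B^o) <= proj_dim (rcpx D) + inj_dim (lcpx D))%E &
        (proj_dim (rcpx D) + inj_dim (lcpx D) < +oo)%E])).
Proof.
split; first exact: RHom_ring_isomorphic.
move=> bP bQ; split=> ac.
  exact: (@inj_dim_bound k A B^op D dualD noethA A^op id id (fun _ _ => erefl) erefl
    (fun _ _ => erefl) (fun _ => erefl) (fun _ => erefl) P bP ac).
(* For the other half R is [B^op] and S is [A], and the ring opposite to R is [B] itself, through
   the identity map. *)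
have [h1 h2 h3] := @inj_dim_bound k B^op A (cswap D) (dualizing_swap dualD) noethB B id id
  (fun _ _ => erefl) erefl (fun _ _ => erefl) (fun _ => erefl) (fun _ => erefl) Q bQ ac.
exact: And3 h2 h1 h3.
Qed.
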